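(* For the quantum group $\mathfrak{D}$ at $\mathbb{S}_3$ attached to the 12-dimensional Fomin–Kirillov algebra, the quotient $\mathsf{OPU}/\mathsf{S}(\sigma,-)$ is a simple highest-weight module of weight $(\tau,0)$. Therefore $$\mathsf{L}(\tau,0)\simeq M(\tau,0)\oplus M(\sigma,+)\oplus M(e,\rho)$$ as $\mathfrak{D}(\mathbb{S}_3)$-modules.
   Context: $\Bbbk$ is an algebraically closed field of characteristic zero, $\zeta\in\Bbbk$ a fixed primitive cube root of $1$; $\sigma=(12)$, $\tau=(123)$ in $\mathbb{S}_3$, permutations composed right to left, so $\sigma\tau=(23)$, $\sigma\tau^2=(13)$. $V=\Bbbk\{x_{(12)},x_{(23)},x_{(13)}\}$ is the Yetter–Drinfeld module over $\Bbbk\mathbb{S}_3$ with $g\cdot x_{(ij)}=\mathrm{sgn}(g)x_{g(ij)g^{-1}}$ and coaction $x_{(ij)}\mapsto(ij)\otimes x_{(ij)}$. Its Nichols algebra $\mathfrak{B}(V)$ is the 12-dimensional Fomin–Kirillov algebra (top degree 4). $\mathfrak{D}$ is the Drinfeld double of the bosonization $\mathfrak{B}(V)\#\Bbbk\mathbb{S}_3$. Explicitly, $\mathfrak{D}$ is the algebra generated by $x_{(ij)}$, $y_{(ij)}$ (transpositions $(ij)$) and $g,\delta_g$ ($g\in\mathbb{S}_3$), where the $g$ multiply as in $\mathbb{S}_3$, the $\delta_g$ are orthogonal idempotents with sum $1$, and, for distinct $i,j,k$ and $g,h\in\mathbb{S}_3$: $x_{(ij)}^2=0$, $x_{(ij)}x_{(ik)}+x_{(jk)}x_{(ij)}+x_{(ik)}x_{(jk)}=0$;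 the same relations for the $y$'s; $\delta_hg=g\delta_{g^{-1}hg}$; $gx_{(ij)}=\mathrm{sgn}(g)x_{g(ij)g^{-1}}g$; $\delta_hx_{(ij)}=x_{(ij)}\delta_{(ij)h}$; $\delta_gy_{(ij)}=y_{(ij)}\delta_{(ij)g}$; $y_{(ij)}g=\mathrm{sgn}(g)\,g\,y_{g^{-1}(ij)g}$; $y_{(ij)}x_{(ij)}+x_{(ij)}y_{(ij)}=1+(ij)(\delta_{(ij)}-\delta_e)$; $y_{(ik)}x_{(ij)}+x_{(ij)}y_{(jk)}=(ij)(\delta_{(ik)}-\delta_{(ik)(ij)})$. The $g,\delta_g$ generate the Drinfeld double $\mathfrak{D}(\mathbb{S}_3)$ of $\Bbbk\mathbb{S}_3$; $\overline V=\Bbbk\{y_{(ij)}\}$ generates $\mathfrak{B}(\overline V)$; multiplication $\mathfrak{B}(V)\otimes\mathfrak{D}(\mathbb{S}_3)\otimes\mathfrak{B}(\overline V)\to\mathfrak{D}$ is a linear isomorphism. Simple $\mathfrak{D}(\mathbb{S}_3)$-modules relevant here (''degree $h$'' means $\delta_h$ acts as identity and other $\delta$'s by $0$): $M(e,\rho)$, the 2-dimensional irreducible $\mathbb{S}_3$-module in degree $e$; $M(\sigma,\pm)$ with basis $|12\rangle,|23\rangle,|13\rangle$, $|ij\rangle$ of degree $(ij)$, $g|ij\rangle=|g(ij)g^{-1}\rangle$ for $+$ and $g|ij\rangle=\mathrm{sgn}(g)|g(ij)g^{-1}\rangle$ for $-$; $M(\tau,0)$ with basis $|\tau\rangle,|\tau^{-1}\rangle$,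 $|\tau^{\pm1}\rangle$ of degree $\tau^{\pm1}$, $\tau^t|\tau^{\pm1}\rangle=|\tau^{\pm1}\rangle$, $\sigma\tau^t|\tau^{\pm1}\rangle=|\tau^{\mp1}\rangle$. A $\mathfrak{D}(\mathbb{S}_3)$-module is of weight $(g,\varrho)$ if it is isomorphic to $M(g,\varrho)$. Let $\mathfrak{D}^{\ge0}$ be the subalgebra generated by $\mathfrak{D}(\mathbb{S}_3)$ and $\overline V$; a simple $\mathfrak{D}(\mathbb{S}_3)$-module $M(g,\varrho)$ is a $\mathfrak{D}^{\ge0}$-module with $\overline V$ acting by $0$. The Verma module is $\mathsf{M}(g,\varrho)=\mathfrak{D}\otimes_{\mathfrak{D}^{\ge0}}M(g,\varrho)=\mathfrak{B}(V)\otimes M(g,\varrho)$; write $x|h\rangle$ for $x\otimes|h\rangle$. It has a unique maximal $\mathfrak{D}$-submodule; $\mathsf{L}(g,\varrho)$ is its head and $\mathsf{S}(g,\varrho)$ its socle. A $\mathfrak{D}$-module is a highest-weight module of weight $(g,\varrho)$ if it is generated by a $\mathfrak{D}(\mathbb{S}_3)$-submodule $M$ of weight $(g,\varrho)$ with $\overline VM=0$. In $\mathsf{M}(\sigma,-)$, let $\mathsf{U},\mathsf{P},\mathsf{O}_0$ be the $\mathfrak{D}(\mathbb{S}_3)$-submodules generated respectively by $\mathsf u=-\zeta^{-1}x_{(12)}x_{(13)}x_{(12)}|23\rangle+\zeta x_{(12)}x_{(13)}x_{(23)}|13\rangle+x_{(13)}x_{(12)}x_{(23)}|12\rangle$; $\mathsf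 p=-(2x_{(13)}x_{(12)}+x_{(12)}x_{(23)})|23\rangle-(2x_{(13)}x_{(23)}+x_{(12)}x_{(13)})|13\rangle$; $\mathsf o_0=x_{(13)}|12\rangle+x_{(12)}|23\rangle+x_{(23)}|13\rangle$. Set $\mathsf{OPU}=\mathsf{S}(\sigma,-)\oplus\mathsf U\oplus\mathsf P\oplus\mathsf O_0$, a $\mathfrak{D}$-submodule of $\mathsf{M}(\sigma,-)$. *)

(* Defs.v *)
From HB Require Import structures.
From mathcomp Require Import all_boot all_order all_fingroup all_algebra.
From mathcomp Require Import all_character.
From mathcomp Require Import boolp classical_sets.
From mathcomp Require Import monalg.

Set Implicit Arguments.
Unset Strict Implicit.
Unset Printing Implicit Defensive.

Import GRing.Theory.
Local Open Scope quotient_scope.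
Local Open Scope classical_set_scope.
Local Open Scope ring_scope.

Section Modules.
Variables (R : pzRingType) (W : lmodType R).

Definition submodule (N : set W) : Prop :=
  N 0 /\ forall a u v, N u -> N v -> N (a *: u + v).

Definition gen_submodule (A : set W) : set W :=
  [set w | forall N, submodule N -> A `<=` N -> N w].

Definition simple_submodule (N : set W) : Prop :=
  [/\ submodule N, N <> [set 0] &
      forall N', submodule N' -> N' `<=` N -> N' = [set 0] \/ N' = N].

Definition maximal_submodule (N : set W) : Prop :=
  [/\ submodule N, N <> setT &
      forall N', submodule N' -> N `<=` N' -> N' = N \/ N' = setT].

Definition socmod : set W :=
  gen_submodule [set w | exists2 N, simple_submodule N & N w].

Definition radmod : set W :=
  [set w | forall N, maximal_submodule N -> N w].

Lemma gen_submoduleP A : submodule (gen_submodule A).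
Proof.
split=> [N [] // | a u v uA vA N sN AN].
by case: (sN) => _; apply; [apply: uA | apply: vA].
Qed.

Lemma sub_gen_submodule A : A `<=` gen_submodule A.
Proof. by move=> w Aw N _; apply. Qed.

Lemma submoduleB N u v : submodule N -> N u -> N v -> N (u - v).
Proof. by case=> _ sN Nu Nv; rewrite addrC -scaleN1r; apply: sN. Qed.

Lemma submoduleZ N a u : submodule N -> N u -> N (a *: u).
Proof. by case=> N0 sN Nu; rewrite -[a *: u]addr0; apply: sN. Qed.

Lemma radmodP : submodule radmod.
Proof.
split=> [N [[]] // | a u v uN vN N mN].
by case: (mN) => [[_ sN] _ _]; apply: sN; [apply: uN | apply: vN].
Qed.

Lemma gen_submodule_id N : submodule N -> gen_submodule N = N.
Proof.
move=> sN; apply/seteqP; split=> [w | ]; last exact: sub_gen_submodule.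
by apply.
Qed.

(* W / <A>, where <A> is the submodule generated by A; this is W / A when A is
   itself a submodule.                                                        *)
Section Quotient.
Variable A : set W.

Definition gen_pred : {pred W} := [pred w | `[< gen_submodule A w >]].

Lemma gen_pred_zmod : zmod_closed gen_pred.
Proof.
have sA := gen_submoduleP A.
split=> [|u v /asboolP uA /asboolP vA]; apply/asboolP; first by case: sA.
exact: (submoduleB sA uA vA).
Qed.

HB.instance Definition _ := GRing.isZmodClosed.Build W gen_pred gen_pred_zmod.

Definition quotmod : Type := Quotient.quot gen_pred.
HB.instance Definition _ := GRing.Zmodule.on quotmod.

Definition pimod (w : W) : quotmod := \pi_(Quotient.quot gen_pred) w.

Lemma pimod_surj (q : quotmod) : exists w, q = pimod w.
Proof. by exists (generic_quotient.repr (q : Quotient.quot gen_pred)); rewrite /pimod reprK. Qed.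

Lemma pimod_eq u v : (pimod u = pimod v) <-> gen_submodule A (u - v).
Proof.
have e : (u - v \in gen_pred) = (u == v %[mod Quotient.quot gen_pred]).
  exact: Quotient.idealrBE.
split=> [uv | uvA]; last by apply/eqP; rewrite -e; apply/asboolP.
have: u - v \in gen_pred by rewrite e; apply/eqP; exact: uv.
by move/asboolP.
Qed.

Lemma pimodD : {morph pimod : u v / u + v}.
Proof. by move=> u v; rewrite /pimod piE. Qed.

Lemma pimod0 : pimod 0 = 0.
Proof. by apply: (addrI (pimod 0)); rewrite -pimodD !addr0. Qed.

Definition quotmod_scale (a : R) (q : quotmod) : quotmod :=
  pimod (a *: generic_quotient.repr (q : Quotient.quot gen_pred)).

Lemma quotmod_scaleE a w : quotmod_scale a (pimod w) = pimod (a *: w).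
Proof.
apply/pimod_eq; rewrite -scalerBr; apply: submoduleZ (gen_submoduleP A) _.
by apply/pimod_eq; rewrite {1}/pimod reprK.
Qed.

Lemma quotmod_scaleA a b q :
  quotmod_scale a (quotmod_scale b q) = quotmod_scale (a * b) q.
Proof. by have [w ->] := pimod_surj q; rewrite !quotmod_scaleE scalerA. Qed.

Lemma quotmod_scale1 : left_id 1 quotmod_scale.
Proof. by move=> q; have [w ->] := pimod_surj q; rewrite quotmod_scaleE scale1r. Qed.

Lemma quotmod_scaleDr : right_distributive quotmod_scale +%R.
Proof.
move=> a p q; have [u ->] := pimod_surj p; have [v ->] := pimod_surj q.
by rewrite -pimodD !quotmod_scaleE -pimodD scalerDr.
Qed.

Lemma quotmod_scaleDl q : {morph quotmod_scale^~ q : a b / a + b}.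
Proof.
move=> a b; have [w ->] := pimod_surj q.
by rewrite !quotmod_scaleE -pimodD scalerDl.
Qed.

HB.instance Definition _ := GRing.Zmodule_isLmodule.Build R quotmod
  quotmod_scaleA quotmod_scale1 quotmod_scaleDr quotmod_scaleDl.

Lemma pimodZ a w : pimod (a *: w) = a *: pimod w.
Proof. by rewrite -[RHS]/(quotmod_scale a (pimod w)) quotmod_scaleE. Qed.

End Quotient.

(* W / rad W; this is the quotient by the largest proper submodule whenever W
   has a unique maximal submodule.                                            *)
Definition headmod : lmodType R := quotmod radmod.

End Modules.

Arguments submodule {R W} N.
Arguments gen_submodule {R W} A.
Arguments simple_submodule {R W} N.
Arguments maximal_submodule {R W} N.
Arguments socmod {R} W.
Arguments radmod {R} W.
Arguments quotmod {R W} A.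
Arguments pimod {R W} A w.
Arguments headmod {R} W.

Notation free_alg k X := {malg k[{fmonom X}]}.
Notation fgen x := (<< fmu x >> : free_alg _ _).

Section Presentation.
Variables (k : comNzRingType) (X : choiceType).
Local Notation F := (free_alg k X).

Lemma free_scalerAr (c : k) (a b : F) : c *: (a * b) = a * (c *: b).
Proof.
have central (d : F) : malgC c * d = d * malgC c.
  rewrite !malgM_def fgmulUg fgmulgU; apply: eq_bigr => m _.
  by rewrite mul1m mulm1 mulrC.
by rewrite -!mul_malgC mulrA central mulrA.
Qed.

Definition two_sided_ideal (I : set F) : Prop :=
  [/\ I 0, forall a b, I a -> I b -> I (a - b),
      forall a b, I b -> I (a * b) & forall a b, I a -> I (a * b)].

(* rel a b stands for the defining relation a = b. *)
Variable rel : F -> F -> Prop.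

Definition rel_ideal : set F :=
  [set a | forall I, two_sided_ideal I -> (forall b c, rel b c -> I (b - c)) -> I a].

Lemma rel_idealP : two_sided_ideal rel_ideal.
Proof.
split=> [I [] // |a b Ja Jb I iI rI|a b Jb I iI rI|a b Ja I iI rI];
  case: (iI) => _ IB Il Ir.
- by apply: IB; [apply: Ja | apply: Jb].
- by apply: Il; apply: Jb.
- by apply: Ir; apply: Ja.
Qed.

Definition rel_pred : {pred F} := [pred a | `[< rel_ideal a >]].

Lemma rel_pred_zmod : zmod_closed rel_pred.
Proof.
have [I0 IB _ _] := rel_idealP.
by split=> [|a b /asboolP Ia /asboolP Ib]; apply/asboolP; [|apply: IB].
Qed.

HB.instance Definition _ := GRing.isZmodClosed.Build F rel_pred rel_pred_zmod.

Definition presented_alg : Type := Quotient.quot rel_pred.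
HB.instance Definition _ := GRing.Zmodule.on presented_alg.
Local Notation A := presented_alg.

Definition palg (a : F) : A := \pi_(Quotient.quot rel_pred) a.
Let repA (p : A) : F := generic_quotient.repr (p : Quotient.quot rel_pred).

Lemma palg_surj (p : A) : exists a, p = palg a.
Proof. by exists (repA p); rewrite /palg reprK. Qed.

Lemma palg_eq a b : (palg a = palg b) <-> rel_ideal (a - b).
Proof.
have e : (a - b \in rel_pred) = (a == b %[mod Quotient.quot rel_pred]).
  exact: Quotient.idealrBE.
split=> [ab | abI]; last by apply/eqP; rewrite -e; apply/asboolP.
have: a - b \in rel_pred by rewrite e; apply/eqP; exact: ab.
by move/asboolP.
Qed.

Lemma palg_rel a b : rel a b -> palg a = palg b.
Proof. by move=> rab; apply/palg_eq => I _; apply. Qed.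

Lemma palgD : {morph palg : a b / a + b}.
Proof. by move=> a b; rewrite /palg piE. Qed.

Lemma palg0 : palg 0 = 0.
Proof. by apply: (addrI (palg 0)); rewrite -palgD !addr0. Qed.

Let mulA (p q : A) : A := palg (repA p * repA q).
Let scaleA (c : k) (p : A) : A := palg (c *: repA p).

Let repAK a : rel_ideal (repA (palg a) - a).
Proof. by apply/palg_eq; rewrite {1}/palg /repA reprK. Qed.

Let mulAE a b : mulA (palg a) (palg b) = palg (a * b).
Proof.
have [I0 IB Il Ir] := rel_idealP.
have ID c d : rel_ideal c -> rel_ideal d -> rel_ideal (c + d).
  by move=> Ic Id; rewrite -[d]opprK -[- d]sub0r; apply: IB (IB _ _ I0 Id).
apply/palg_eq; rewrite -[X in rel_ideal X](subrKA (a * repA (palg b))).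
by rewrite -mulrBl -mulrBr; apply: ID; [apply: Ir | apply: Il].
Qed.

Let scaleAE c a : scaleA c (palg a) = palg (c *: a).
Proof.
have [_ _ Il _] := rel_idealP.
apply/palg_eq; rewrite -scalerBr -mul_malgC.
exact: Il.
Qed.

Let mulAA : associative mulA.
Proof.
move=> p q r; have [[a ->] [b ->]] := (palg_surj p, palg_surj q).
by have [c ->] := palg_surj r; rewrite !mulAE mulrA.
Qed.
Let mul1A : left_id (palg 1) mulA.
Proof. by move=> p; have [a ->] := palg_surj p; rewrite mulAE mul1r. Qed.
Let mulA1 : right_id (palg 1) mulA.
Proof. by move=> p; have [a ->] := palg_surj p; rewrite mulAE mulr1. Qed.
Let mulADl : left_distributive mulA +%R.
Proof.
move=> p q r; have [[a ->] [b ->]] := (palg_surj p, palg_surj q).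
by have [c ->] := palg_surj r; rewrite -palgD !mulAE -palgD mulrDl.
Qed.
Let mulADr : right_distributive mulA +%R.
Proof.
move=> p q r; have [[a ->] [b ->]] := (palg_surj p, palg_surj q).
by have [c ->] := palg_surj r; rewrite -palgD !mulAE -palgD mulrDr.
Qed.

HB.instance Definition _ := GRing.Zmodule_isPzRing.Build presented_alg
  mulAA mul1A mulA1 mulADl mulADr.

Let scaleAA b c p : scaleA b (scaleA c p) = scaleA (b * c) p.
Proof. by have [a ->] := palg_surj p; rewrite !scaleAE scalerA. Qed.
Let scale1A : left_id 1 scaleA.
Proof. by move=> p; have [a ->] := palg_surj p; rewrite scaleAE scale1r. Qed.
Let scaleADr : right_distributive scaleA +%R.
Proof.
move=> c p q; have [[a ->] [b ->]] := (palg_surj p, palg_surj q).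
by rewrite -palgD !scaleAE -palgD scalerDr.
Qed.
Let scaleADl p : {morph scaleA^~ p : b c / b + c}.
Proof.
by move=> b c; have [a ->] := palg_surj p; rewrite !scaleAE -palgD scalerDl.
Qed.

HB.instance Definition _ := GRing.Zmodule_isLmodule.Build k presented_alg
  scaleAA scale1A scaleADr scaleADl.

Lemma palg1 : palg 1 = 1. Proof. by []. Qed.

Lemma palgM : {morph palg : a b / a * b}.
Proof. by move=> a b; rewrite -[RHS]/(mulA (palg a) (palg b)) mulAE. Qed.

Lemma palgZ c : {morph palg : a / c *: a}.
Proof. by move=> a; rewrite -[RHS]/(scaleA c (palg a)) scaleAE. Qed.

Lemma palg_scalerAl (c : k) (p q : A) : c *: (p * q) = (c *: p) * q.
Proof.
have [[a ->] [b ->]] := (palg_surj p, palg_surj q).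
by rewrite -palgM -!(palgZ c) -palgM scalerAl.
Qed.

Lemma palg_scalerAr (c : k) (p q : A) : c *: (p * q) = p * (c *: q).
Proof.
have [[a ->] [b ->]] := (palg_surj p, palg_surj q).
by rewrite -palgM -!(palgZ c) -palgM free_scalerAr.
Qed.

End Presentation.

Arguments palg {k X} rel a.

(* Products of permutations are composed right to left here, whereas MathComp's
   (g * h)%g applies g first. The points 1, 2, 3 are the elements 0, 1, 2 of
   'I_3.                                                                      *)
Definition pcomp (g h : 'S_3) : 'S_3 := (h * g)%g.
Definition pconj (g h : 'S_3) : 'S_3 := pcomp (pcomp g h) g^-1%g.
Notation "g ∘ h" := (pcomp g h) (at level 40, left associativity).

Definition s12 : 'S_3 := tperm (@Ordinal 3 0 isT) (@Ordinal 3 1 isT).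
Definition s23 : 'S_3 := tperm (@Ordinal 3 1 isT) (@Ordinal 3 2 isT).
Definition s13 : 'S_3 := tperm (@Ordinal 3 0 isT) (@Ordinal 3 2 isT).

(* i |-> i + 1 mod 3, i.e. the cycle (123). *)
Definition tau : 'S_3 := perm (@addIr 'I_3 1).

Definition sgn {k : pzRingType} (g : 'S_3) : k := (-1) ^+ odd_perm g.

Definition transp : Type :=
  {t : 'S_3 | [exists i, exists j, (i != j) && (t == tperm i j)]}.
HB.instance Definition _ := Choice.on transp.
HB.instance Definition _ := SubType.on transp.

Local Notation i0 := (@Ordinal 3 0 isT).
Local Notation i1 := (@Ordinal 3 1 isT).
Local Notation i2 := (@Ordinal 3 2 isT).

Lemma ord3P (i : 'I_3) : [\/ i = i0, i = i1 | i = i2].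
Proof.
by case: i => [[|[|[|//]]] lti]; [constructor 1 | constructor 2 | constructor 3];
   apply: val_inj.
Qed.

Lemma tauE : (tau i0 = i1) * (tau i1 = i2) * (tau i2 = i0).
Proof. by rewrite /tau !permE; do !split; apply: val_inj. Qed.

Lemma S3P (g h : 'S_3) : g i0 = h i0 -> g i1 = h i1 -> g i2 = h i2 -> g = h.
Proof. by move=> e0 e1 e2; apply/permP=> i; case: (ord3P i) => ->. Qed.

Definition transp_deg (i : 'I_3) : 'S_3 := tnth [tuple s12; s23; s13] i.
Definition tau_deg (i : 'I_2) : 'S_3 := tnth [tuple tau; tau^-1%g] i.

Lemma transp_deg_inj : injective transp_deg.
Proof.
have E i : (transp_deg i : 'S_3) =
    if i == i0 then s12 else if i == i1 then s23 else s13.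
  by case: (ord3P i) => ->.
move=> i j; rewrite !E.
by case: (ord3P i) => ->; case: (ord3P j) => -> //= /permP e;
   move: (e i0) (e i1) (e i2); rewrite /s12 /s23 /s13 !permE.
Qed.

Lemma tpermP3 (i j : 'I_3) : i != j -> exists l, transp_deg l = tperm i j.
Proof.
case: (ord3P i) => ->; case: (ord3P j) => -> // _;
  [exists i0 | exists i2 | exists i0 | exists i1 | exists i2 | exists i1];
  rewrite /transp_deg /tnth /= // tpermC //.
Qed.

Lemma pconjE g t : pconj g t = (t ^ g)%g. Proof. by []. Qed.

Lemma transp_deg_stable g i : exists j, transp_deg j = pconj g (transp_deg i).
Proof.
suff [a [b [ab ->]]] : exists a b, a != b /\ transp_deg i = tperm a b.
  by rewrite pconjE tpermJ; apply: tpermP3; rewrite (inj_eq perm_inj).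
by case: (ord3P i) => ->; [exists i0, i1 | exists i1, i2 | exists i0, i2].
Qed.

Lemma tau_deg_inj : injective tau_deg.
Proof.
have ne : tau != (tau^-1)%g.
  apply/eqP => /permP/(_ i0)/(congr1 tau).
  by rewrite permKV !tauE.
case=> [[|[|//]] lti] [[|[|//]] ltj]; rewrite /tau_deg /tnth /= => /eqP e;
  apply: val_inj => //; move: e; rewrite ?(negPf ne) //.
by rewrite eq_sym (negPf ne).
Qed.

Lemma tau_deg_stable g i : exists j, tau_deg j = pconj g (tau_deg i).
Proof.
have tauV : ((tau^-1)%g i0 = i2) * ((tau^-1)%g i1 = i0) * ((tau^-1)%g i2 = i1).
  by do !split; apply: (@perm_inj _ tau); rewrite permKV !tauE.
have [j ej] : exists j, tau_deg j = pconj g tau.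
  have J x : (tau ^ g)%g (g x) = g (tau x) by rewrite permJ.
  have := (J i0, J i1, J i2); rewrite !tauE.
  have n01 : g i0 != g i1 by rewrite (inj_eq perm_inj).
  have n02 : g i0 != g i2 by rewrite (inj_eq perm_inj).
  have n12 : g i1 != g i2 by rewrite (inj_eq perm_inj).
  move: n01 n02 n12.
  case: (ord3P (g i0)) => ->; case: (ord3P (g i1)) => ->;
    case: (ord3P (g i2)) => -> // _ _ _ [[e1 e2] e3];
    by [exists ord0; apply: S3P; rewrite ?tauE pconjE ?e1 ?e2 ?e3
       |exists ord_max; apply: S3P; rewrite /tau_deg /tnth /= ?tauV pconjE ?e1 ?e2 ?e3].
have [k ek] : exists k, tau_deg k = (tau_deg j)^-1%g.
  case: j {ej} => [[|[|//]] ltj]; [exists ord_max | exists ord0] => //.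
  by rewrite /tau_deg /tnth /= invgK.
case: i => [[|[|//]] lti]; first by exists j.
by exists k; rewrite ek ej !pconjE -conjVg.
Qed.

Section DoubleRelations.
Variable k : comNzRingType.

Definition dgen : Type := ((transp + transp) + ('S_3 + 'S_3))%type.
HB.instance Definition _ := Choice.on dgen.

Local Notation F := (free_alg k dgen).

(* fx t and fy t are the generators x_t and y_t when t is a transposition, and
   0 (never used) otherwise.                                                  *)
Definition fx (t : 'S_3) : F :=
  if insub t is Some t' then fgen (inl (inl t') : dgen) else 0.
Definition fy (t : 'S_3) : F :=
  if insub t is Some t' then fgen (inl (inr t') : dgen) else 0.
Definition fg (g : 'S_3) : F := fgen (inr (inl g) : dgen).
Definition fd (g : 'S_3) : F := fgen (inr (inr g) : dgen).

Local Notation p i j := (tperm i j : 'S_3).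

Inductive drel : F -> F -> Prop :=
| Rel_1 : drel (fg 1%g) 1
| Rel_gg g h : drel (fg g * fg h) (fg (g ∘ h))
| Rel_dd g h : drel (fd g * fd h) (if g == h then fd g else 0)
| Rel_d1 : drel (\sum_(g : 'S_3) fd g) 1
| Rel_xx i j : i != j -> drel (fx (p i j) * fx (p i j)) 0
| Rel_xxx i j l : uniq [:: i; j; l] ->
    drel (fx (p i j) * fx (p i l) + fx (p j l) * fx (p i j)
          + fx (p i l) * fx (p j l)) 0
| Rel_yy i j : i != j -> drel (fy (p i j) * fy (p i j)) 0
| Rel_yyy i j l : uniq [:: i; j; l] ->
    drel (fy (p i j) * fy (p i l) + fy (p j l) * fy (p i j)
          + fy (p i l) * fy (p j l)) 0
| Rel_dg g h : drel (fd h * fg g) (fg g * fd (g^-1%g ∘ h ∘ g))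
| Rel_gx g i j : i != j ->
    drel (fg g * fx (p i j)) (sgn g *: (fx (pconj g (p i j)) * fg g))
| Rel_dx h i j : i != j -> drel (fd h * fx (p i j)) (fx (p i j) * fd (p i j ∘ h))
| Rel_dy h i j : i != j -> drel (fd h * fy (p i j)) (fy (p i j) * fd (p i j ∘ h))
| Rel_yg g i j : i != j ->
    drel (fy (p i j) * fg g) (sgn g *: (fg g * fy (g^-1%g ∘ p i j ∘ g)))
| Rel_yx i j : i != j ->
    drel (fy (p i j) * fx (p i j) + fx (p i j) * fy (p i j))
         (1 + fg (p i j) * (fd (p i j) - fd 1%g))
| Rel_yx' i j l : uniq [:: i; j; l] ->
    drel (fy (p i l) * fx (p i j) + fx (p i j) * fy (p j l))
         (fg (p i j) * (fd (p i l) - fd (p i l ∘ p i j))).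

End DoubleRelations.

Notation dalg k := (presented_alg (@drel k)).

Section Double.
Variable k : fieldType.
Local Notation D := (dalg k).

Definition Dx (t : 'S_3) : D := palg (@drel k) (fx k t).
Definition Dy (t : 'S_3) : D := palg (@drel k) (fy k t).
Definition Dg (g : 'S_3) : D := palg (@drel k) (fg k g).
Definition Ddelta (g : 'S_3) : D := palg (@drel k) (fd k g).
Definition scal (c : k) : D := c *: (1 : D).

(* A finite-dimensional D(S_3)-module, on the row vectors 'rV[k]_n: an
   S_3-module together with an S_3-degree for each vector of the standard basis,
   such that g maps degree h to degree g h g^-1; delta_h is the projection onto
   degree h. Acting on row vectors by v |-> v *m rep g turns MathComp's
   rep (h * g) = rep h *m rep g into (g ∘ h) v = g (h v).                      *)
Record ds3_module := DS3Module {
  ds3_dim : nat;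
  ds3_rep : mx_representation k [set: 'S_3]%SET ds3_dim;
  ds3_deg : 'I_ds3_dim -> 'S_3;
  ds3_compat : forall g i j,
    ds3_rep g i j != 0 -> ds3_deg j = pconj g (ds3_deg i) }.

Arguments ds3_deg : clear implicits.

Implicit Types M : ds3_module.

Definition ds3_g M (g : 'S_3) (v : 'rV[k]_(ds3_dim M)) := v *m ds3_rep M g.
Definition ds3_delta M (h : 'S_3) (v : 'rV[k]_(ds3_dim M)) :=
  v *m diag_mx (\row_i (ds3_deg M i == h)%:R).

Lemma ds3_deltaE M h (v : 'rV[k]_(ds3_dim M)) i :
  ds3_delta h v 0 i = if ds3_deg M i == h then v 0 i else 0 :> k.
Proof.
rewrite /ds3_delta mul_mx_diag !mxE.
by case: ifP => _; rewrite ?mulr1 ?mulr0.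
Qed.

Lemma ds3_delta_g M g h (v : 'rV[k]_(ds3_dim M)) :
  ds3_delta h (ds3_g g v) = ds3_g g (ds3_delta (g^-1%g ∘ h ∘ g) v).
Proof.
apply/rowP=> j; rewrite ds3_deltaE /ds3_g [RHS]mxE [in LHS]mxE.
have E i : ds3_rep M g i j != 0 ->
    (ds3_deg M i == g^-1%g ∘ h ∘ g) = (ds3_deg M j == h).
  move=> /ds3_compat ->; rewrite /pconj /pcomp.
  apply/eqP/eqP => [->|<-]; first by rewrite !mulgA mulVg mul1g mulgKV.
  by rewrite !mulgA mulgV mul1g mulgK.
case: ifP => [jh|jh]; last first.
  rewrite big1 // => i _; rewrite ds3_deltaE.
  by have [->|/E ->] := eqVneq (ds3_rep M g i j) 0; rewrite ?mulr0 ?jh ?mul0r.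
apply: eq_bigr => i _; rewrite ds3_deltaE.
by have [->|/E ->] := eqVneq (ds3_rep M g i j) 0; rewrite ?mulr0 ?jh.
Qed.

(* The class {deg i} of S_3 with basis |deg i>, where
   g |h> = chi(g) |g h g^-1>.                                                 *)
Section ClassModule.
Variables (n : nat) (deg : 'I_n -> 'S_3) (chi : 'S_3 -> k).
Hypothesis deg_inj : injective deg.
Hypothesis deg_stable : forall g i, exists j, deg j = pconj g (deg i).
Hypothesis chi1 : chi 1%g = 1.
Hypothesis chiM : forall g h, chi (g * h)%g = chi g * chi h.

Definition class_mx (g : 'S_3) : 'M[k]_n :=
  \matrix_(i, j) (if deg j == pconj g (deg i) then chi g else 0).

Lemma class_mx_repr : mx_repr [set: 'S_3]%SET class_mx.
Proof.
have conj1 x : pconj 1%g x = x by rewrite /pconj /pcomp invg1 mulg1 mul1g.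
have conjM g h x : pconj (g * h)%g x = pconj h (pconj g x).
  by rewrite /pconj /pcomp invMg !mulgA.
split=> [|g h _ _]; apply/matrixP => i j; rewrite !mxE.
  by rewrite conj1 (inj_eq deg_inj) eq_sym chi1; case: eqP.
have [l dl] := deg_stable g i.
rewrite (bigD1 l) //= !mxE dl eqxx big1 ?addr0.
  by rewrite conjM; case: eqP; rewrite ?mulr0 ?chiM.
move=> l' l'l; rewrite !mxE -dl (inj_eq deg_inj) (negPf l'l).
by rewrite mul0r.
Qed.

Lemma class_compat g i j :
  MxRepresentation class_mx_repr g i j != 0 -> deg j = pconj g (deg i).
Proof. by rewrite /= mxE; case: (eqVneq (deg j)) => //; rewrite eqxx. Qed.

Definition class_module := DS3Module class_compat.
End ClassModule.

Lemma sgn1 : sgn 1%g = 1 :> k.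
Proof. by rewrite /sgn odd_perm1. Qed.

Lemma sgnM g h : sgn (g * h)%g = sgn g * sgn h :> k.
Proof. by rewrite /sgn odd_permM signr_addb. Qed.

Definition Msigma_plus : ds3_module :=
  class_module transp_deg_inj transp_deg_stable (chi := fun=> 1)
    erefl (fun _ _ => esym (mulr1 1)).

Definition Msigma_minus : ds3_module :=
  class_module transp_deg_inj transp_deg_stable sgn1 sgnM.

(* Powers of tau fix |tau> and |tau^-1>, and transpositions swap them, since
   this is their action on {tau, tau^-1} by conjugation.                      *)
Definition Mtau0 : ds3_module :=
  class_module tau_deg_inj tau_deg_stable (chi := fun=> 1)
    erefl (fun _ _ => esym (mulr1 1)).

Lemma Me_compat n (rho : mx_representation k [set: 'S_3]%SET n) g i j :
  rho g i j != 0 -> (fun _ : 'I_n => 1%g) j = pconj g ((fun _ : 'I_n => 1%g) i).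
Proof. by move=> _; rewrite pconjE conj1g. Qed.

Definition Me n (rho : mx_representation k [set: 'S_3]%SET n) : ds3_module :=
  DS3Module (@Me_compat n rho).

Section DirectSum.
Variables M N : ds3_module.
Let m := ds3_dim M.
Let n := ds3_dim N.

Definition dsum_mx (g : 'S_3) : 'M[k]_(m + n) :=
  block_mx (ds3_rep M g) 0 0 (ds3_rep N g).

Definition dsum_deg (i : 'I_(m + n)) : 'S_3 :=
  match split i with inl a => ds3_deg M a | inr b => ds3_deg N b end.

Lemma dsum_repr : mx_repr [set: 'S_3]%SET dsum_mx.
Proof.
split=> [|g h gS hS]; first by rewrite /dsum_mx !repr_mx1 -scalar_mx_block.
by rewrite /dsum_mx !repr_mxM // mulmx_block !(mulmx0, mul0mx, addr0, add0r).
Qed.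

Lemma dsum_compat g i j :
  MxRepresentation dsum_repr g i j != 0 -> dsum_deg j = pconj g (dsum_deg i).
Proof.
rewrite /= /dsum_deg /dsum_mx /block_mx !mxE.
case: (split i) => a; rewrite !mxE; case: (split j) => b; rewrite ?mxE ?eqxx //;
  exact: ds3_compat.
Qed.

Definition dsum : ds3_module := DS3Module dsum_compat.
End DirectSum.

Section DS3InD.
Variable W : lmodType D.

Definition ds3_hom M (f : 'rV[k]_(ds3_dim M) -> W) : Prop :=
  [/\ forall c u v, f (c *: u + v) = scal c *: f u + f v,
      forall g v, f (ds3_g g v) = Dg g *: f v &
      forall h v, f (ds3_delta h v) = Ddelta h *: f v].

Definition ds3_iso M : Prop :=
  exists2 f : 'rV[k]_(ds3_dim M) -> W, ds3_hom f & bijective f.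

Definition of_weight M (A : set W) : Prop :=
  exists f : 'rV[k]_(ds3_dim M) -> W,
    [/\ ds3_hom f, injective f & A = range f].

Definition ds3_submodule (A : set W) : Prop :=
  [/\ A 0, forall c u v, A u -> A v -> A (scal c *: u + v),
      forall g v, A v -> A (Dg g *: v) & forall h v, A v -> A (Ddelta h *: v)].

Definition ds3_gen (w : W) : set W :=
  [set v | forall A, ds3_submodule A -> A w -> A v].

Definition highest_weight M (N : set W) : Prop :=
  exists A, [/\ of_weight M A, forall t v, A v -> Dy t *: v = 0 &
                N = gen_submodule A].
End DS3InD.

(* D ⊗_{D^{>=0}} M, where V-bar acts on M by 0: the quotient of the D-module
   D ⊗_k M = 'rV[D]_n, in which 1 ⊗ v is map_mx scal v, by the submodule
   generated by the a (1 ⊗ v) - 1 ⊗ a v, where it suffices to let a run over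
   the generators g, delta_h, y_t of D^{>=0}.                                 *)
Section Verma.
Variable M : ds3_module.
Local Notation n := (ds3_dim M).

Definition one_tensor (v : 'rV[k]_n) : 'rV[D]_n := map_mx scal v.

Inductive verma_rel : set 'rV[D]_n :=
| Verma_g g v : verma_rel (Dg g *: one_tensor v - one_tensor (ds3_g g v))
| Verma_delta h v : verma_rel (Ddelta h *: one_tensor v - one_tensor (ds3_delta h v))
| Verma_y t v : verma_rel (Dy t *: one_tensor v).

Definition verma : lmodType D := quotmod verma_rel.

Definition ket (i : 'I_n) : verma := pimod verma_rel (one_tensor (delta_mx 0 i)).

Definition Lmod : lmodType D := headmod verma.
End Verma.

Section OPU.
Variable zeta : k.
Local Notation W := (verma Msigma_minus).

Let k12 : W := @ket Msigma_minus i0.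
Let k23 : W := @ket Msigma_minus i1.
Let k13 : W := @ket Msigma_minus i2.
Let x12 := Dx s12.
Let x23 := Dx s23.
Let x13 := Dx s13.

Definition u_vec : W :=
  (- zeta^-1 *: (x12 * x13 * x12)) *: k23 + (zeta *: (x12 * x13 * x23)) *: k13
  + (x13 * x12 * x23) *: k12.

Definition p_vec : W :=
  - ((2%:R *: (x13 * x12) + x12 * x23) *: k23)
  - ((2%:R *: (x13 * x23) + x12 * x13) *: k13).

Definition o0_vec : W := x13 *: k12 + x12 *: k23 + x23 *: k13.

Definition U_sub : set W := ds3_gen u_vec.
Definition P_sub : set W := ds3_gen p_vec.
Definition O0_sub : set W := ds3_gen o0_vec.

Definition OPU : set W :=
  [set w | exists s u p o, [/\ socmod W s, U_sub u, P_sub p, O0_sub o & w = s + u + p + o]].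

Definition OPU_direct : Prop :=
  forall s u p o, socmod W s -> U_sub u -> P_sub p -> O0_sub o -> s + u + p + o = 0 ->
    [/\ s = 0, u = 0, p = 0 & o = 0].

(* OPU / S(sigma, -), as a submodule of M(sigma, -) / S(sigma, -). *)
Definition OPU_mod_S : set (quotmod (socmod W)) := pimod (socmod W) @` OPU.
End OPU.

End Double.

(* Main.v *)
(* The Fomin-Kirillov relations reduce every word in the x_t to one of twelve normal
   words, so M(sigma, -) is spanned by 36 vectors; since an explicit action of D on a
   36-dimensional space satisfies the defining relations, these vectors form a basis
   and D acts on them by integer matrices. B(V) being Frobenius, every nonzero
   submodule contains the longest normal word times a ket, which generates a
   10-dimensional submodule: this is the socle S. Modulo S, explicit elements of D
   carry each of the 7 basis vectors of OPU to a multiple of o_0 and back, so OPU / S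
   is simple and generated by o_0, which the y_t annihilate. The Verma module of
   weight (tau, 0) thus maps onto OPU / S. The kernel is its only maximal submodule:
   a submodule N outside the kernel maps onto the simple module OPU / S, hence
   contains each highest weight vector up to the augmentation ideal of B(V), and is
   everything by nilpotency of this ideal. *)
Require Import Defs.
From HB Require Import structures.
From mathcomp Require Import all_boot all_order all_fingroup all_algebra.
From mathcomp Require Import all_character.
From mathcomp Require Import boolp classical_sets.
From mathcomp Require Import monalg.

Set Implicit Arguments.
Unset Strict Implicit.
Unset Printing Implicit Defensive.

Import GRing.Theory.
Local Open Scope quotient_scope.
Local Open Scope classical_set_scope.
Local Open Scope ring_scope.

(** * Algebras given by generators and relations *)

(** No triangular decomposition is assumed: D is given by generators and relations only, so linear
    independence in a Verma module has to be earned. Rewriting bounds every Verma module from above,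
    but the explicit model is built only for M(sigma, -); for M(tau, 0) spanning suffices, because
    independence is needed only after mapping to OPU / S. All structure constants are integers, so
    identities are evaluated on lists of integer coefficients and then transferred to k. The root
    zeta enters only through u and through the tau-eigenvectors that compare U with rho; an integral
    basis of U keeps it out of the tables. Characteristic zero inverts the pivots and common
    denominators, which are 2 and 3 up to sign. The lists of words and linear forms are
    certificates: their origin is irrelevant once the checks return true. The same checks serve
    M(sigma, -) and its quotient by S, because they are stated for any sequence of vectors on which
    D acts by the tables and for any test [null] that implies vanishing. *)

Section PresentationTheory.
Variables (k : comNzRingType) (X : choiceType).
Local Notation F := (free_alg k X).
Variable rel : F -> F -> Prop.
Local Notation pi := (palg rel).

Section Lift.
Variables (S : algType k) (gen : X -> S).

Definition word_eval (m : {fmonom X}) : S := \prod_(x <- m) gen x.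

Lemma word_eval_mmorphism : mmorphism word_eval.
Proof.
split=> [x y|]; first by rewrite /word_eval fmM big_cat.
by rewrite /word_eval fm1 big_nil.
Qed.

HB.instance Definition _ :=
  isMultiplicative.Build {fmonom X} S word_eval word_eval_mmorphism.

Definition free_eval (a : F) : S := mmap (in_alg S) word_eval a.

Lemma free_evalM : {morph free_eval : a b / a * b}.
Proof.
apply: (@commr_mmap_is_multiplicative _ _ _ _ _ _).1 => g m m'.
by rewrite /GRing.comm -scalerAl -scalerAr mul1r mulr1.
Qed.

Lemma free_eval1 : free_eval 1 = 1.
Proof. exact: mmap1. Qed.

Lemma free_evalB : {morph free_eval : a b / a - b}.
Proof. exact: mmapB. Qed.

Lemma free_evalD : {morph free_eval : a b / a + b}.
Proof. exact: mmapD. Qed.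

Lemma free_eval0 : free_eval 0 = 0.
Proof. exact: mmap0. Qed.

Lemma free_evalZ c a : free_eval (c *: a) = c *: free_eval a.
Proof. by rewrite /free_eval mmapZ /= -scalerAl mul1r. Qed.

Lemma free_eval_gen x : free_eval (fgen x) = gen x.
Proof.
by rewrite /free_eval mmapU /= scale1r mul1r /word_eval fmU big_seq1.
Qed.

Hypothesis gen_rel : forall a b, rel a b -> free_eval a = free_eval b.

Definition palg_lift (p : presented_alg rel) : S :=
  free_eval (generic_quotient.repr (p : Quotient.quot (rel_pred rel))).

Lemma palg_liftE a : palg_lift (pi a) = free_eval a.
Proof.
have [b eb] : exists b, generic_quotient.repr (pi a : Quotient.quot (rel_pred rel)) = b
  by eexists.
have: pi b = pi a by rewrite -eb /palg reprK.
(* [rel_ideal] is the intersection of all two-sided ideals containing the relations; here it is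
   compared with the kernel of the evaluation. *)
rewrite /palg_lift eb => /palg_eq/(_ [set c | free_eval c = 0]) ba.
apply/eqP; rewrite -subr_eq0 -free_evalB; apply/eqP; apply: ba => /=.
  split=> /= [|c d c0 d0|c d d0|c d c0]; first exact: free_eval0.
  - by rewrite free_evalB c0 d0 subrr.
  - by rewrite free_evalM d0 mulr0.
  - by rewrite free_evalM c0 mul0r.
by move=> c d /gen_rel cd; rewrite free_evalB cd subrr.
Qed.

Lemma palg_lift_gen x : palg_lift (pi (fgen x)) = gen x.
Proof. by rewrite palg_liftE free_eval_gen. Qed.

Lemma palg_liftD : {morph palg_lift : p q / p + q}.
Proof.
move=> p q; have [[a ->] [b ->]] := (palg_surj p, palg_surj q).
by rewrite -palgD !palg_liftE free_evalD.
Qed.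

Lemma palg_liftM : {morph palg_lift : p q / p * q}.
Proof.
move=> p q; have [[a ->] [b ->]] := (palg_surj p, palg_surj q).
by rewrite -palgM !palg_liftE free_evalM.
Qed.

Lemma palg_lift1 : palg_lift 1 = 1.
Proof. by rewrite -palg1 palg_liftE free_eval1. Qed.

Lemma palg_liftZ c p : palg_lift (c *: p) = c *: palg_lift p.
Proof. by have [a ->] := palg_surj p; rewrite -palgZ !palg_liftE free_evalZ. Qed.

End Lift.

(** Words span the free algebra and are built by left multiplication with generators. Left
    multiplication is the form needed for stability of subsets of a module. *)
Lemma palg_ind (P : presented_alg rel -> Prop) :
  (forall c p q, P p -> P q -> P (c *: p + q)) -> P 0 -> P 1 ->
  (forall x p, P p -> P (pi (fgen x) * p)) -> forall p, P p.
Proof.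
move=> PL P0 P1 PM p; have [a ->] := palg_surj p.
have Pword (m : {fmonom X}) : P (pi << m >>).
  case: m => m; elim: m => [|x m IH].
    by rewrite -fmoneE; rewrite -[<< _ >>]/(1 : F) palg1.
  suff -> : FMonom (x :: m) = mmul (fmu x) (FMonom m).
    by rewrite -(mul1r (1 : k)) -fgmulUU -malgM_def palgM; exact: PM.
  by rewrite fmuE; apply: esym; apply: (etrans (fmmulE _ _)).
rewrite (monalgE a); elim/big_rec: _ => [|m b _ Pb]; first by rewrite palg0.
rewrite palgD; suff -> : << a@_m *g m >> = a@_m *: << m >> :> F by rewrite palgZ; apply: PL.
by apply/malgP=> j; rewrite mcoeffZ !mcoeffU mulrnAr mulr1.
Qed.

End PresentationTheory.

(** * Arithmetic in S_3 and formal integer combinations *)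

Local Notation i0 := (@Ordinal 3 0 isT).
Local Notation i1 := (@Ordinal 3 1 isT).
Local Notation i2 := (@Ordinal 3 2 isT).

Section SymmetricGroupThree.
Local Open Scope nat_scope.

(** One-line notations of 1, (12), (23), (13), tau, tau^-1. Elements of S_3 are numbered 0 to 5 in
    this order, so the transpositions are 1, 2, 3 and products can be evaluated on numbers. *)
Definition s3_codes : seq (seq nat) :=
  [:: [:: 0; 1; 2]; [:: 1; 0; 2]; [:: 0; 2; 1]; [:: 2; 1; 0]; [:: 1; 2; 0]; [:: 2; 0; 1]].
Definition s3_code (m : nat) : seq nat := nth [:: 0; 1; 2] s3_codes m.
Definition s3_elt (m : nat) : 'S_3 := nth 1%g [:: 1%g; s12; s23; s13; tau; tau^-1%g] m.
Definition s3_idx (g : 'S_3) : nat :=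
  index [:: (g i0 : nat); (g i1 : nat); (g i2 : nat)] s3_codes.

Definition mulc (m n : nat) : nat :=
  index [seq nth 0 (s3_code m) x | x <- s3_code n] s3_codes.
Definition invc (m : nat) : nat := nth 0 [:: 0; 1; 2; 3; 5; 4] m.
Definition conjc (m n : nat) : nat := mulc (mulc m n) (invc m).
Definition oddc (m : nat) : bool := 0 < m < 4.
(** Two distinct points of {0, 1, 2} are determined by their sum, which is 1, 2 or 3. *)
Definition transpc (i j : nat) : nat := nth 0 [:: 0; 1; 3; 2] (i + j).

Lemma tauVE : ((tau^-1)%g i0 = i2) * ((tau^-1)%g i1 = i0) * ((tau^-1)%g i2 = i1).
Proof. by do !split; apply: (@perm_inj _ tau); rewrite permKV !tauE. Qed.

Lemma s3_eltE m (i : 'I_3) : s3_elt m i = nth 0 (s3_code m) i :> nat.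
Proof.
case: m => [|[|[|[|[|[|m]]]]]]; rewrite /s3_elt /s3_code /=;
  by case: (ord3P i) => ->; rewrite ?nth_nil /s12 /s23 /s13 ?tauE ?tauVE ?permE.
Qed.

Lemma s3_code_mem (g : 'S_3) :
  [:: (g i0 : nat); (g i1 : nat); (g i2 : nat)] \in s3_codes.
Proof.
have : [&& g i0 != g i1, g i0 != g i2 & g i1 != g i2] by rewrite !(inj_eq perm_inj).
case: (ord3P (g i0)) => ->; case: (ord3P (g i1)) => ->;
  by case: (ord3P (g i2)) => ->.
Qed.

Lemma s3_idx_lt g : s3_idx g < 6.
Proof. by rewrite -[6]/(size s3_codes) index_mem s3_code_mem. Qed.

Lemma s3_idxK g : s3_elt (s3_idx g) = g.
Proof.
by apply: S3P; apply: ord_inj; rewrite s3_eltE /s3_code /s3_idx nth_index ?s3_code_mem.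
Qed.

Lemma s3_eltK m : m < 6 -> s3_idx (s3_elt m) = m.
Proof. by rewrite /s3_idx !s3_eltE; case: m => [|[|[|[|[|[|m]]]]]]. Qed.

Lemma s3_eltM m n : s3_elt m ∘ s3_elt n = s3_elt (mulc m n).
Proof.
apply: S3P; apply: ord_inj; rewrite /pcomp permM !s3_eltE;
case: m => [|[|[|[|[|[|m]]]]]]; case: n => [|[|[|[|[|[|n]]]]]];
by rewrite /mulc /s3_code /= ?nth_nil.
Qed.

Lemma s3_eltV m : (s3_elt m)^-1%g = s3_elt (invc m).
Proof.
apply: (mulgI (s3_elt m)); rewrite mulgV -[RHS]/(s3_elt (invc m) ∘ s3_elt m) s3_eltM.
by case: m => [|[|[|[|[|[|m]]]]]]; rewrite /invc /mulc /s3_code /= ?nth_nil.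
Qed.

Lemma s3_eltJ m n : pconj (s3_elt m) (s3_elt n) = s3_elt (conjc m n).
Proof. by rewrite /pconj s3_eltV !s3_eltM. Qed.

Lemma s3_elt_odd m : odd_perm (s3_elt m) = oddc m.
Proof.
have odd_tau : odd_perm tau = false.
  rewrite -[tau]/(s3_elt 4) -[4]/(mulc 1 2) -s3_eltM /pcomp odd_permM.
  by rewrite /s3_elt /= !odd_tperm.
case: m => [|[|[|[|[|[|m]]]]]]; rewrite /s3_elt /= ?nth_nil ?odd_perm1 //.
- by rewrite odd_tperm.
- by rewrite odd_tperm.
- by rewrite odd_tperm.
- by rewrite odd_permV.
Qed.

Lemma s3_elt_transp (i j : 'I_3) : i != j -> tperm i j = s3_elt (transpc i j).
Proof.
case: (ord3P i) => ->; case: (ord3P j) => ->; try by case/eqP.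
all: rewrite /transpc /= /s3_elt /= /s12 /s13 /s23 => _.
all: [> exact: erefl | exact: erefl | exact: tpermC | exact: erefl | exact: tpermC | exact: tpermC].
Qed.

Lemma transp_degE (i : 'I_3) : transp_deg i = s3_elt i.+1.
Proof. by case: (ord3P i) => ->. Qed.

End SymmetricGroupThree.

(* A formal integer combination of vectors indexed by nat. *)
Definition vec : Type := seq (nat * int).

Definition scalev (c : int) (v : vec) : vec := [seq (p.1, c * p.2) | p <- v].
Definition coefv (v : vec) (j : nat) : int :=
  foldr (fun p s => if p.1 == j then p.2 + s else s) 0 v.

Definition op : Type := nat -> vec.
(** [A] lists the images of the basis vectors. Indices from n on are dropped, in agreement with the
    convention that they denote the zero vector. *)
Definition lin (n : nat) (A : op) (v : vec) : vec :=
  flatten [seq if (p.1 < n)%N then scalev p.2 (A p.1) else [::] | p <- v].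

(** Lists are never normalised: an index may occur several times, so comparison goes through the
    total coefficients. *)
Definition eqv n (u v : vec) : bool := all (fun j => coefv u j == coefv v j) (iota 0 n).
Definition eqop n (A B : op) : bool := all (fun j => eqv n (A j) (B j)) (iota 0 n).
Definition addop (A B : op) : op := fun j => A j ++ B j.
Definition scaleop (c : int) (A : op) : op := fun j => scalev c (A j).
Definition mulop n (A B : op) : op := fun j => lin n A (B j).
Definition op1 : op := fun j => [:: (j, 1)].
Definition op0 : op := fun j => [::].

Section Eval.
Variables (V : zmodType) (b : nat -> V) (n : nat).
Hypothesis b_out : forall j, (n <= j)%N -> b j = 0.

Definition ev (v : vec) : V := \sum_(p <- v) b p.1 *~ p.2.

Lemma ev_nil : ev [::] = 0. Proof. exact: big_nil. Qed.

Lemma ev_cons p v : ev (p :: v) = b p.1 *~ p.2 + ev v.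
Proof. exact: big_cons. Qed.

Lemma ev_cat u v : ev (u ++ v) = ev u + ev v. Proof. exact: big_cat. Qed.

Lemma ev1 j : ev [:: (j, 1)] = b j.
Proof. by rewrite /ev big_seq1. Qed.

Lemma ev_scale c v : ev (scalev c v) = ev v *~ c.
Proof.
rewrite /ev big_map mulrz_suml.
by apply: eq_bigr => p _ /=; rewrite mulrC mulrzA.
Qed.

Lemma ev_coef v : ev v = \sum_(j < n) b j *~ coefv v j.
Proof.
elim: v => [|[i c] v IH]; first by rewrite ev_nil big1.
rewrite ev_cons IH /=; have [lt_in|le_ni] := ltnP i n; last first.
  rewrite b_out // mul0rz add0r; apply: eq_bigr => j _.
  by rewrite gtn_eqF // (leq_trans (ltn_ord j)).
rewrite (bigD1 (Ordinal lt_in)) //= [in RHS](bigD1 (Ordinal lt_in)) //= eqxx.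
rewrite mulrzDr addrA; congr (_ + _); apply: eq_bigr => j.
by rewrite -val_eqE /= eq_sym => /negPf ->.
Qed.

Lemma ev_eqv u v : eqv n u v -> ev u = ev v.
Proof.
move=> /allP uv; rewrite !ev_coef; apply: eq_bigr => j _.
by have := uv j; rewrite mem_iota ltn_ord => /(_ isT)/eqP ->.
Qed.

Lemma ev_lin (V' : zmodType) (f : {additive V -> V'}) (b' : nat -> V') (A : op) v :
  (forall j, (j < n)%N -> f (b j) = \sum_(p <- A j) b' p.1 *~ p.2) ->
  f (ev v) = \sum_(p <- lin n A v) b' p.1 *~ p.2.
Proof.
move=> fA; elim: v => [|[i c] v IH]; first by rewrite ev_nil raddf0 big_nil.
rewrite ev_cons raddfD IH raddfMz /lin /= big_cat /=; congr (_ + _).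
case: ltnP => [lt_in|/b_out ->]; last by rewrite raddf0 mul0rz big_nil.
rewrite fA // big_map mulrz_suml.
by apply: eq_bigr => p _; rewrite /= mulrC mulrzA.
Qed.

End Eval.

(** * The 36-dimensional model of the Verma module M(sigma, -) *)

Section Tables.
Local Open Scope nat_scope.

(* The normal words of the Groebner basis aa, bb, cc, ca + ab + bc,
   cb + ba + ac, bab - aba of the relations between a = x_(12), b = x_(23) and
   c = x_(13); the letters 1, 2, 3 are the indices of these transpositions.   *)
Definition xwords : seq (seq nat) :=
  [:: [::]; [:: 1]; [:: 2]; [:: 1; 2]; [:: 2; 1]; [:: 1; 2; 1];
      [:: 3]; [:: 1; 3]; [:: 2; 3]; [:: 1; 2; 3]; [:: 2; 1; 3]; [:: 1; 2; 1; 3]].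

(** Row t holds the normal forms of x_t times the twelve normal words; row 0 is padding. The entries
    are justified by [xmulE]. *)
Definition xmul (t m : nat) : vec :=
  nth [::] (nth [::] [:: [::];
    [:: [:: (1, 1%R)]; [::]; [:: (3, 1%R)]; [::]; [:: (5, 1%R)]; [::];
        [:: (7, 1%R)]; [::]; [:: (9, 1%R)]; [::]; [:: (11, 1%R)]; [::]];
    [:: [:: (2, 1%R)]; [:: (4, 1%R)]; [::]; [:: (5, 1%R)]; [::]; [::];
        [:: (8, 1%R)]; [:: (10, 1%R)]; [::]; [:: (11, 1%R)]; [::]; [::]];
    [:: [:: (6, 1%R)]; [:: (3, (-1)%R); (8, (-1)%R)]; [:: (4, (-1)%R); (7, (-1)%R)];
        [:: (10, 1%R)]; [:: (9, 1%R)]; [:: (11, (-1)%R)];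
        [::]; [:: (9, (-1)%R)]; [:: (10, (-1)%R)]; [::]; [::]; [::]]] t) m.

(* The index 3 m + i stands for x_w |d_i>, where w is the m-th normal word and
   d_i has index i + 1.                                                       *)
Definition opX (t : nat) : op := fun j =>
  [seq (3 * p.1 + j %% 3, p.2) | p <- xmul t (j %/ 3)].

Definition sgnc (m : nat) : int := (if oddc m then -1 else 1)%R.

(** The recursion moves g past x_t by the relation for g x_t; the empty word leaves the action on
    M(sigma, -). The shifts by one arise because the ket of index i has the transposition numbered i
    + 1 as its degree. *)
Fixpoint wordG (g : nat) (w : seq nat) (i : nat) : vec :=
  if w is t :: w' then scalev (sgnc g) (lin 36 (opX (conjc g t)) (wordG g w' i))
  else [:: ((conjc g i.+1).-1, sgnc g)].

Definition opG (g : nat) : op := fun j => wordG g (nth [::] xwords (j %/ 3)) (j %% 3).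

(** By the relation between delta_h and x_t, the degree of x_w |d_i> is the product of the letters
    of w and of d_i. *)
Definition opD (h : nat) : op := fun j =>
  if foldr mulc (j %% 3).+1 (nth [::] xwords (j %/ 3)) == h then [:: (j, 1%R)] else [::].

(** The recursion solves the two cross relations for y_u x_t, and y_u kills the kets. The third
    transposition has number 6 - u - t. The tail w' can be looked up because suffixes of normal
    words are normal. *)
Fixpoint wordY (u : nat) (w : seq nat) (i : nat) : vec :=
  if w is t :: w' then
    let v : vec := [:: (3 * index w' xwords + i, 1%R)] in
    if u == t then
      scalev (-1) (lin 36 (opX t) (wordY t w' i)) ++ v
      ++ lin 36 (opG t) (lin 36 (opD t) v ++ scalev (-1) (lin 36 (opD 0) v))
    else
      scalev (-1) (lin 36 (opX t) (wordY (6 - u - t) w' i))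
      ++ lin 36 (opG t) (lin 36 (opD u) v ++ scalev (-1) (lin 36 (opD (mulc u t)) v))
  else [::].

Definition opY (u : nat) : op := fun j => wordY u (nth [::] xwords (j %/ 3)) (j %% 3).

End Tables.

Definition subop (A B : op) : op := addop A (scaleop (-1) B).

Definition all6 (P : nat -> bool) : bool := all P (iota 0 6).
Definition all66 (P : nat -> nat -> bool) : bool := all6 (fun m => all6 (P m)).
Definition transp2 (P : nat -> nat -> bool) : bool :=
  all (fun i => all (fun j => (i != j) ==> P i j) (iota 0 3)) (iota 0 3).
Definition transp3 (P : nat -> nat -> nat -> bool) : bool :=
  all (fun i => all (fun j => all (fun l => uniq [:: i; j; l] ==> P i j l)
    (iota 0 3)) (iota 0 3)) (iota 0 3).

Lemma all_iotaP (P : pred nat) n j : all P (iota 0 n) -> (j < n)%N -> P j.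
Proof. by move=> /allP aP lt_j; apply: aP; rewrite mem_iota. Qed.

Lemma all6P P m : all6 P -> (m < 6)%N -> P m.
Proof. exact: all_iotaP. Qed.

Lemma all66P P m n : all66 P -> (m < 6)%N -> (n < 6)%N -> P m n.
Proof. by move=> /all6P aP /aP /all6P; apply. Qed.

Lemma transp2P P (i j : 'I_3) : transp2 P -> i != j -> P i j.
Proof.
move=> aP ij; have := all_iotaP (all_iotaP aP (ltn_ord i)) (ltn_ord j).
by rewrite val_eqE ij.
Qed.

Lemma transp3P P (i j l : 'I_3) : transp3 P -> uniq [:: i; j; l] -> P i j l.
Proof.
move=> aP u; have /implyP := all_iotaP (all_iotaP (all_iotaP aP (ltn_ord i)) (ltn_ord j)) (ltn_ord l).
by apply; rewrite -[[:: _; _; _]]/(map val [:: i; j; l]) (map_inj_uniq val_inj).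
Qed.

Section Model.
Variable k : comNzRingType.
Local Notation E := 'cV[k]_36.

Definition bE (j : nat) : E := \col_i (i == j :> nat)%:R.

Lemma bE_out j : (36 <= j)%N -> bE j = 0.
Proof. by move=> le; apply/colP => i; rewrite !mxE ltn_eqF // (leq_trans (ltn_ord i)). Qed.

Definition op_mx (A : op) : 'M[k]_36 := \matrix_(i, j) ev bE (A j) i 0.

Lemma op_mxE A j : (j < 36)%N -> op_mx A *m bE j = ev bE (A j).
Proof.
move=> lt_j; apply/colP=> i; rewrite !mxE (bigD1 (Ordinal lt_j)) //= big1 ?addr0.
  by rewrite !mxE eqxx mulr1.
by move=> l; rewrite -val_eqE !mxE /= => /negPf ->; rewrite mulr0.
Qed.

Lemma op_mx_ev A v : op_mx A *m ev bE v = ev bE (lin 36 A v).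
Proof.
apply: (@ev_lin _ bE 36 bE_out _ (mulmx (op_mx A)) bE) => j; exact: op_mxE.
Qed.

Lemma bE_mx_inj (M N : 'M[k]_36) :
  (forall j, (j < 36)%N -> M *m bE j = N *m bE j) -> M = N.
Proof.
move=> MN; apply/matrixP=> i j.
have col (L : 'M[k]_36) : L i j = (L *m bE j) i 0.
  rewrite mxE (bigD1 j) //= big1 ?addr0 ?mxE ?eqxx ?mulr1 // => l.
  by rewrite -val_eqE mxE => /negPf ->; rewrite mulr0.
by rewrite !col MN.
Qed.

(** This is the passage from an evaluated check over the integers to an identity over k. *)
Lemma op_mx_eq A B : eqop 36 A B -> op_mx A = op_mx B.
Proof.
move=> /allP AB; apply: bE_mx_inj => j lt_j; rewrite !op_mxE //.
by apply: (ev_eqv bE_out); apply: AB; rewrite mem_iota.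
Qed.

Lemma op_mxM A B : op_mx A * op_mx B = op_mx (mulop 36 A B).
Proof. by apply: bE_mx_inj => j lt_j; rewrite -mulmxA !op_mxE // op_mx_ev. Qed.

Lemma op_mxD A B : op_mx A + op_mx B = op_mx (addop A B).
Proof. by apply: bE_mx_inj => j lt_j; rewrite mulmxDl !op_mxE // -ev_cat. Qed.

Lemma op_mxZ c A : c%:~R *: op_mx A = op_mx (scaleop c A).
Proof.
apply: bE_mx_inj => j lt_j.
by rewrite -scalemxAl !op_mxE // scaler_int -ev_scale.
Qed.

Lemma op_mx0 : op_mx op0 = 0.
Proof. by apply: bE_mx_inj => j lt_j; rewrite op_mxE // ev_nil mul0mx. Qed.

Lemma op_mx1 : op_mx op1 = 1.
Proof. by apply: bE_mx_inj => j lt_j; rewrite op_mxE // ev1 mul1mx. Qed.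

Lemma op_mxB A B : op_mx A - op_mx B = op_mx (subop A B).
Proof. by rewrite -op_mxD -op_mxZ scaleN1r. Qed.

Lemma sgn_s3_elt m : sgn (s3_elt m) = (sgnc m)%:~R :> k.
Proof. by rewrite /sgn s3_elt_odd /sgnc; case: (oddc m). Qed.

Definition dgen_op (x : dgen) : op :=
  match x with
  | inl (inl t) => opX (s3_idx (val t))
  | inl (inr t) => opY (s3_idx (val t))
  | inr (inl g) => opG (s3_idx g)
  | inr (inr h) => opD (s3_idx h)
  end.

Local Notation feval := (free_eval (fun x => op_mx (dgen_op x))).

Lemma transpc_lt i j : (transpc i j < 6)%N.
Proof. by rewrite /transpc; case: (i + j)%N => [|[|[|[|n]]]]; rewrite //= nth_nil. Qed.

Lemma feval_fx (i j : 'I_3) : i != j ->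
  feval (fx k (tperm i j)) = op_mx (opX (transpc i j)).
Proof.
move=> ij; have tP : [exists a, exists b, (a != b) && (tperm i j == tperm a b)].
  by apply/existsP; exists i; apply/existsP; exists j; rewrite ij eqxx.
by rewrite /fx insubT free_eval_gen /= s3_elt_transp // s3_eltK // transpc_lt.
Qed.

Lemma feval_fy (i j : 'I_3) : i != j ->
  feval (fy k (tperm i j)) = op_mx (opY (transpc i j)).
Proof.
move=> ij; have tP : [exists a, exists b, (a != b) && (tperm i j == tperm a b)].
  by apply/existsP; exists i; apply/existsP; exists j; rewrite ij eqxx.
by rewrite /fy insubT free_eval_gen /= s3_elt_transp // s3_eltK // transpc_lt.
Qed.

End Model.

Lemma s3_eltP g : exists2 m, (m < 6)%N & g = s3_elt m.
Proof. by exists (s3_idx g); rewrite ?s3_idxK ?s3_idx_lt. Qed.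

Lemma s3_elt_eq m n : (m < 6)%N -> (n < 6)%N -> (s3_elt m == s3_elt n) = (m == n).
Proof.
move=> ltm ltn; apply/eqP/eqP => [|-> //].
by move=> /(congr1 s3_idx); rewrite !s3_eltK.
Qed.

Section ModelRelations.
Variable k : comNzRingType.
Local Notation feval := (free_eval (fun x => op_mx k (dgen_op x))).
Local Notation eq36 := (eqop 36).
Local Notation "A ** B" := (mulop 36 A B) (at level 40, left associativity).
Local Notation "A +++ B" := (addop A B) (at level 50, left associativity).

Lemma sum_s3 (V : nmodType) (F : 'S_3 -> V) : \sum_g F g = \sum_(m < 6) F (s3_elt m).
Proof.
rewrite (reindex (fun m : 'I_6 => s3_elt m)) //.
exists (fun g => Ordinal (s3_idx_lt g)) => [m _|g _]; last exact: s3_idxK.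
by apply: val_inj; rewrite /= s3_eltK.
Qed.

Lemma mulc_lt m n : (m < 6)%N -> (n < 6)%N -> (mulc m n < 6)%N.
Proof.
have chk : all66 (fun m n => mulc m n < 6)%N by vm_compute.
exact: all66P chk.
Qed.

Lemma invc_lt m : (m < 6)%N -> (invc m < 6)%N.
Proof. by case: m => [|[|[|[|[|[|m]]]]]]. Qed.

Lemma conjc_lt m n : (m < 6)%N -> (n < 6)%N -> (conjc m n < 6)%N.
Proof. by move=> ltm ltn; rewrite !mulc_lt ?invc_lt. Qed.

Lemma feval_g m : (m < 6)%N -> feval (fg k (s3_elt m)) = op_mx k (opG m).
Proof. by move=> lt; rewrite free_eval_gen /= s3_eltK. Qed.

Lemma feval_d m : (m < 6)%N -> feval (fd k (s3_elt m)) = op_mx k (opD m).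
Proof. by move=> lt; rewrite free_eval_gen /= s3_eltK. Qed.

Lemma feval_x m : (0 < m < 4)%N -> feval (fx k (s3_elt m)) = op_mx k (opX m).
Proof.
case: m => [|[|[|[|m]]]] // _.
- exact: (@feval_fx k (@Ordinal 3 0 isT) (@Ordinal 3 1 isT) isT).
- exact: (@feval_fx k (@Ordinal 3 1 isT) (@Ordinal 3 2 isT) isT).
- exact: (@feval_fx k (@Ordinal 3 0 isT) (@Ordinal 3 2 isT) isT).
Qed.

Lemma feval_y m : (0 < m < 4)%N -> feval (fy k (s3_elt m)) = op_mx k (opY m).
Proof.
case: m => [|[|[|[|m]]]] // _.
- exact: (@feval_fy k (@Ordinal 3 0 isT) (@Ordinal 3 1 isT) isT).
- exact: (@feval_fy k (@Ordinal 3 1 isT) (@Ordinal 3 2 isT) isT).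
- exact: (@feval_fy k (@Ordinal 3 0 isT) (@Ordinal 3 2 isT) isT).
Qed.

Definition all_conj (P : nat -> nat -> bool) : bool :=
  all6 (fun m => all (fun t => P m t) [:: 1; 2; 3]%N).

Lemma all_conjP P m (i j : 'I_3) : all_conj P -> (m < 6)%N -> i != j -> P m (transpc i j).
Proof.
move=> aP ltm ij; have /allP := all6P aP ltm; apply; move: i j ij.
by do 2!case=> [[|[|[|//]]] ?].
Qed.

Lemma transpc_range (i j : 'I_3) : i != j -> (0 < transpc i j < 4)%N.
Proof. by move: i j; do 2!case=> [[|[|[|//]]] ?]. Qed.

(* The operator of a compound element is assembled by applying these lemmas:
   rewriting with [free_evalM] would compare distinct products of generators by
   conversion, which is expensive. *)
Lemma feval_mul a b A B : feval a = op_mx k A -> feval b = op_mx k B ->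
  feval (a * b) = op_mx k (A ** B).
Proof. by move=> aA bB; rewrite free_evalM aA bB op_mxM. Qed.

Lemma feval_add a b A B : feval a = op_mx k A -> feval b = op_mx k B ->
  feval (a + b) = op_mx k (A +++ B).
Proof. by move=> aA bB; rewrite free_evalD aA bB op_mxD. Qed.

Lemma feval_sub a b A B : feval a = op_mx k A -> feval b = op_mx k B ->
  feval (a - b) = op_mx k (subop A B).
Proof. by move=> aA bB; rewrite free_evalB aA bB op_mxB. Qed.

Lemma feval_sgnZ m a A : feval a = op_mx k A ->
  feval (sgn (s3_elt m) *: a) = op_mx k (scaleop (sgnc m) A).
Proof. by move=> aA; rewrite free_evalZ aA sgn_s3_elt op_mxZ. Qed.

Lemma feval0 : feval 0 = op_mx k op0. Proof. by rewrite free_eval0 op_mx0. Qed.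
Lemma feval1 : feval 1 = op_mx k op1. Proof. by rewrite free_eval1 op_mx1. Qed.

Lemma feval_eq a b A B : feval a = op_mx k A -> feval b = op_mx k B ->
  eq36 A B -> feval a = feval b.
Proof. by move=> -> -> AB; apply: op_mx_eq. Qed.

Lemma uniq3 (i j l : 'I_3) : uniq [:: i; j; l] -> [/\ i != j, i != l & j != l].
Proof. by rewrite /= !inE negb_or => /andP[/andP[-> ->] /andP[-> _]]. Qed.

(** Once group elements and pairs of points are replaced by numbers, each family of relations is a
    finite list of identities between integer tables, evaluated for all indices at once. *)
Lemma dgen_rel_op a b : drel a b -> feval a = feval b.
Proof.
case=> {a b}.
- by rewrite -[1%g]/(s3_elt 0); apply: feval_eq (feval_g _) feval1 _; vm_compute.
- move=> g h; have [[m ltm ->] [n ltn ->]] := (s3_eltP g, s3_eltP h).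
  have chk : all66 (fun m n => eq36 (opG m ** opG n) (opG (mulc m n))) by vm_compute.
  rewrite s3_eltM; apply: feval_eq (all66P chk ltm ltn).
    by apply: feval_mul; apply: feval_g.
  by apply: feval_g; apply: mulc_lt.
- move=> g h; have [[m ltm ->] [n ltn ->]] := (s3_eltP g, s3_eltP h).
  have chk : all66 (fun m n => eq36 (opD m ** opD n) (if m == n then opD m else op0))
    by vm_compute.
  rewrite (s3_elt_eq ltm ltn); apply: feval_eq (all66P chk ltm ltn).
    by apply: feval_mul; apply: feval_d.
  by case: eqP => _; [apply: feval_d | apply: feval0].
- rewrite sum_s3 !big_ord_recr big_ord0.
  apply: feval_eq feval1 _; first by do 6!(apply: feval_add; last exact: feval_d); apply: feval0.
  by vm_compute.
- move=> i j ij.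
  have chk : transp2 (fun i j => eq36 (opX (transpc i j) ** opX (transpc i j)) op0)
    by vm_compute.
  exact: feval_eq (feval_mul (feval_fx k ij) (feval_fx k ij)) feval0 (transp2P chk ij).
- move=> i j l u; have [ij il jl] := uniq3 u.
  have chk : transp3 (fun i j l => eq36 (opX (transpc i j) ** opX (transpc i l)
      +++ opX (transpc j l) ** opX (transpc i j)
      +++ opX (transpc i l) ** opX (transpc j l)) op0) by vm_compute.
  apply: feval_eq feval0 (transp3P chk u).
  by apply: feval_add; [apply: feval_add; apply: feval_mul | apply: feval_mul]; apply: feval_fx.
- move=> i j ij.
  have chk : transp2 (fun i j => eq36 (opY (transpc i j) ** opY (transpc i j)) op0)
    by vm_compute.
  exact: feval_eq (feval_mul (feval_fy k ij) (feval_fy k ij)) feval0 (transp2P chk ij).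
- move=> i j l u; have [ij il jl] := uniq3 u.
  have chk : transp3 (fun i j l => eq36 (opY (transpc i j) ** opY (transpc i l)
      +++ opY (transpc j l) ** opY (transpc i j)
      +++ opY (transpc i l) ** opY (transpc j l)) op0) by vm_compute.
  apply: feval_eq feval0 (transp3P chk u).
  by apply: feval_add; [apply: feval_add; apply: feval_mul | apply: feval_mul]; apply: feval_fy.
- move=> g h; have [[m ltm ->] [n ltn ->]] := (s3_eltP g, s3_eltP h).
  have chk : all66 (fun m n => eq36 (opD n ** opG m) (opG m ** opD (mulc (mulc (invc m) n) m)))
    by vm_compute.
  rewrite s3_eltV !s3_eltM; apply: feval_eq (all66P chk ltm ltn).
    by apply: feval_mul; [apply: feval_d | apply: feval_g].
  by apply: feval_mul; [apply: feval_g | apply: feval_d; rewrite !mulc_lt ?invc_lt].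
- move=> g i j ij; have [m ltm ->] := s3_eltP g.
  (* [fx] is 0 outside the transpositions, so the check also records that the conjugate is a
     transposition. *)
  have chk : all_conj (fun m t => (0 < conjc m t < 4)%N &&
      eq36 (opG m ** opX t) (scaleop (sgnc m) (opX (conjc m t) ** opG m))) by vm_compute.
  have /andP[cij chk_ij] := all_conjP chk ltm ij.
  have tij := transpc_range ij.
  rewrite (s3_elt_transp ij) s3_eltJ; apply: feval_eq chk_ij.
    by apply: feval_mul; [apply: feval_g | apply: feval_x].
  by apply: feval_sgnZ; apply: feval_mul; [apply: feval_x | apply: feval_g].
- move=> h i j ij; have [m ltm ->] := s3_eltP h.
  have chk : all_conj (fun m t => eq36 (opD m ** opX t) (opX t ** opD (mulc t m)))
    by vm_compute.
  have tij := transpc_range ij.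
  rewrite (s3_elt_transp ij) s3_eltM; apply: feval_eq (all_conjP chk ltm ij).
    by apply: feval_mul; [apply: feval_d | apply: feval_x].
  by apply: feval_mul; [apply: feval_x | apply: feval_d; rewrite mulc_lt ?transpc_lt].
- move=> h i j ij; have [m ltm ->] := s3_eltP h.
  have chk : all_conj (fun m t => eq36 (opD m ** opY t) (opY t ** opD (mulc t m)))
    by vm_compute.
  have tij := transpc_range ij.
  rewrite (s3_elt_transp ij) s3_eltM; apply: feval_eq (all_conjP chk ltm ij).
    by apply: feval_mul; [apply: feval_d | apply: feval_y].
  by apply: feval_mul; [apply: feval_y | apply: feval_d; rewrite mulc_lt ?transpc_lt].
- move=> g i j ij; have [m ltm ->] := s3_eltP g.
  have chk : all_conj (fun m t => (0 < mulc (mulc (invc m) t) m < 4)%N &&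
      eq36 (opY t ** opG m)
           (scaleop (sgnc m) (opG m ** opY (mulc (mulc (invc m) t) m)))) by vm_compute.
  have /andP[cij chk_ij] := all_conjP chk ltm ij.
  have tij := transpc_range ij.
  rewrite (s3_elt_transp ij) s3_eltV !s3_eltM; apply: feval_eq chk_ij.
    by apply: feval_mul; [apply: feval_y | apply: feval_g].
  by apply: feval_sgnZ; apply: feval_mul; [apply: feval_g | apply: feval_y].
- move=> i j ij; have tij := transpc_range ij.
  have chk : transp2 (fun i j => let t := transpc i j in
      eq36 (opY t ** opX t +++ opX t ** opY t) (op1 +++ opG t ** subop (opD t) (opD 0)))
    by vm_compute.
  rewrite (s3_elt_transp ij) -[1%g]/(s3_elt 0); apply: feval_eq (transp2P chk ij).
    by apply: feval_add; apply: feval_mul;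
      [apply: feval_y | apply: feval_x | apply: feval_x | apply: feval_y].
  apply: feval_add; first exact: feval1.
  by apply: feval_mul; [| apply: feval_sub]; [apply: feval_g | apply: feval_d | apply: feval_d]; rewrite ?transpc_lt.
- move=> i j l u; have [ij il jl] := uniq3 u.
  have chk : transp3 (fun i j l => eq36
      (opY (transpc i l) ** opX (transpc i j) +++ opX (transpc i j) ** opY (transpc j l))
      (opG (transpc i j) ** subop (opD (transpc i l)) (opD (mulc (transpc i l) (transpc i j)))))
    by vm_compute.
  rewrite (s3_elt_transp ij) (s3_elt_transp il) (s3_elt_transp jl) s3_eltM; apply: feval_eq (transp3P chk u).
    apply: feval_add; apply: feval_mul; [apply: feval_y | apply: feval_x | apply: feval_x | apply: feval_y]; exact: transpc_range.
  by apply: feval_mul; [| apply: feval_sub]; [apply: feval_g | apply: feval_d | apply: feval_d];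
    rewrite ?mulc_lt ?transpc_lt.
Qed.
End ModelRelations.

(** * Generators of the double and Verma modules *)

Section QuotientLift.
Variables (R : pzRingType) (W X : lmodType R) (A : set W).

Lemma linear_ker_submodule (F : {linear W -> X}) : submodule [set w | F w = 0].
Proof.
split=> /= [|a u v u0 v0]; first by rewrite linear0.
by rewrite linearP u0 v0 scaler0 addr0.
Qed.

Lemma pimod_linear : linear (pimod A).
Proof. by move=> a u v; rewrite pimodD pimodZ. Qed.

HB.instance Definition _ := GRing.isLinear.Build R W (quotmod A) *:%R (pimod A) pimod_linear.

Lemma quotmod_lift (F : {linear W -> X}) : (forall w, A w -> F w = 0) ->
  exists G : {linear quotmod A -> X}, forall w, G (pimod A w) = F w.
Proof.
move=> FA; pose G (q : quotmod A) := F (generic_quotient.repr (q : Quotient.quot (gen_pred A))).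
have GE w : G (pimod A w) = F w.
  have [u eu] : exists u, generic_quotient.repr (pimod A w : Quotient.quot (gen_pred A)) = u
    by eexists.
  have : pimod A u = pimod A w by rewrite -eu /pimod reprK.
  move=> /pimod_eq uw; apply/eqP; rewrite /G eu -subr_eq0 -linearB; apply/eqP.
  exact: uw (linear_ker_submodule F) FA.
have Glin : linear G.
  move=> a p q; have [[u ->] [v ->]] := (pimod_surj p, pimod_surj q).
  by rewrite -pimodZ -pimodD !GE linearP.
pose G' : {linear quotmod A -> X} := HB.pack_for {linear quotmod A -> X} G
  (GRing.isLinear.Build _ _ _ _ G Glin).
by exists G'.
Qed.

End QuotientLift.

Lemma scale_sum_lin (R : pzRingType) (W : lmodType R) (I : finType) (c : R) (f g : I -> R)
    (b : I -> W) :
  c *: (\sum_i f i *: b i) + \sum_i g i *: b i = \sum_i (c * f i + g i) *: b i.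
Proof.
rewrite scaler_sumr -big_split; apply: eq_bigr => i _ /=.
by rewrite scalerDl scalerA.
Qed.

Section Generators.
Variable k : fieldType.
Local Notation D := (dalg k).

Definition is_transp (t : 'S_3) : bool := [exists i, exists j, (i != j) && (t == tperm i j)].

Lemma is_transpP t : is_transp t -> exists i j, i != j /\ t = tperm i j.
Proof.
by case/existsP=> i /existsP[j /andP[ij /eqP ->]]; exists i, j.
Qed.

Lemma Dx_transp (t : transp) : Dx k (val t) = palg (@drel k) (fgen (inl (inl t) : dgen)).
Proof. by rewrite /Dx /fx valK. Qed.

Lemma Dy_transp (t : transp) : Dy k (val t) = palg (@drel k) (fgen (inl (inr t) : dgen)).
Proof. by rewrite /Dy /fy valK. Qed.

Lemma Dy_out t : ~~ is_transp t -> Dy k t = 0.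
Proof. by move=> nt; rewrite /Dy /fy insubN // palg0. Qed.

Lemma scalE c (p : D) : c *: p = scal c * p.
Proof. by rewrite /scal -palg_scalerAl mul1r. Qed.

(** D-modules carry no separate k-action here: k acts through the elements [scal c], and centrality
    makes the action of D k-linear. *)
Lemma scal_comm c (p : D) : scal c * p = p * scal c.
Proof. by rewrite /scal -palg_scalerAl mul1r -palg_scalerAr mulr1. Qed.

Lemma scalM c d : scal (c * d) = scal c * scal d :> D.
Proof. by rewrite -scalE /scal scalerA. Qed.

Lemma scal1 : scal 1 = 1 :> D. Proof. exact: scale1r. Qed.
Lemma scal0 : scal 0 = 0 :> D. Proof. exact: scale0r. Qed.
Lemma scalD c d : scal (c + d) = scal c + scal d :> D. Proof. exact: scalerDl. Qed.
Lemma scalN c : scal (- c) = - scal c :> D. Proof. exact: scaleNr. Qed.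

Lemma scal_int (c : int) : scal c%:~R = c%:~R :> D.
Proof. by rewrite /scal scaler_int. Qed.

Lemma scal_sum (I : Type) (r : seq I) (F : I -> k) :
  scal (\sum_(i <- r) F i) = \sum_(i <- r) scal (F i) :> D.
Proof. by rewrite /scal scaler_suml. Qed.

Section Module.
Variable W : lmodType D.
Implicit Types (u v w : W) (N : set W).

Lemma scal_swap c (p : D) w : p *: (scal c *: w) = scal c *: (p *: w).
Proof. by rewrite !scalerA scal_comm. Qed.

Lemma scal_lin c (p : D) u v : p *: (scal c *: u + v) = scal c *: (p *: u) + p *: v.
Proof. by rewrite scalerDr scal_swap. Qed.

Lemma submodule_gen N :
  N 0 -> (forall c u v, N u -> N v -> N (scal c *: u + v)) ->
  (forall t u, is_transp t -> N u -> N (Dx k t *: u)) ->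
  (forall t u, is_transp t -> N u -> N (Dy k t *: u)) ->
  (forall g u, N u -> N (Dg k g *: u)) ->
  (forall h u, N u -> N (Ddelta k h *: u)) -> submodule N.
Proof.
move=> N0 Nlin Nx Ny Ng Nd.
have NZ c u : N u -> N (scal c *: u) by move=> Nu; rewrite -[_ *: _]addr0; apply: Nlin.
have ND u v : N u -> N v -> N (u + v) by move=> Nu Nv; rewrite -[u]scale1r -scal1; apply: Nlin.
suff NM (a : D) u : N u -> N (a *: u) by split=> // a u v Nu Nv; apply: ND (NM a u Nu) Nv.
move=> Nu; elim/palg_ind: a => [c p q Np Nq|||x p Np].
- by rewrite scalE scalerDl -scalerA; apply: Nlin.
- by rewrite scale0r.
- by rewrite scale1r.
case: x => [[t|t]|[g|h]]; rewrite -scalerA.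
- by rewrite -Dx_transp; apply: Nx => //; apply: (valP t).
- by rewrite -Dy_transp; apply: Ny => //; apply: (valP t).
- exact: Ng.
- exact: Nd.
Qed.

Lemma submoduleD N u v : submodule N -> N u -> N v -> N (u + v).
Proof. by case=> _ Nl Nu Nv; rewrite -[u]scale1r; apply: Nl. Qed.

End Module.
End Generators.

Lemma ds3_hom0 (k : fieldType) (M : ds3_module k) (W : lmodType (dalg k))
  (f : 'rV[k]_(ds3_dim M) -> W) : ds3_hom f -> f 0 = 0.
Proof.
move=> [f_lin _ _]; have := f_lin (-1) 0 0; rewrite scaler0 addr0 scalN scal1.
by rewrite scaleN1r addNr.
Qed.

Section VermaLift.
Variables (k : fieldType) (M : ds3_module k) (X : lmodType (dalg k)).
Local Notation D := (dalg k).
Local Notation n := (ds3_dim M).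

Definition vtensor (v : 'rV[k]_n) : verma M := pimod (@verma_rel k M) (one_tensor v).

Lemma one_tensorP c u v : one_tensor (c *: u + v) = scal c *: one_tensor u + one_tensor v :> 'rV[D]_n.
Proof. by apply/rowP=> i; rewrite !mxE scalD scalM. Qed.

Lemma vtensor_hom : ds3_hom vtensor.
Proof.
have rel w w' : verma_rel (w - w') -> pimod (@verma_rel k M) w = pimod (@verma_rel k M) w'.
  by move=> ww'; apply/pimod_eq; apply: sub_gen_submodule.
split=> [c u v|g v|h v]; rewrite /vtensor.
- by rewrite one_tensorP pimodD pimodZ.
- by rewrite -pimodZ; apply/esym/rel; apply: Verma_g.
- by rewrite -pimodZ; apply/esym/rel; apply: Verma_delta.
Qed.

Lemma vtensor_y t v : Dy k t *: vtensor v = 0.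
Proof.
rewrite -pimodZ -(pimod0 (@verma_rel k M)); apply/pimod_eq; rewrite subr0.
by apply: sub_gen_submodule; apply: Verma_y.
Qed.

(** Universal property of the induced module: f is a map of D^{>=0}-modules, as V-bar acts on M by
    0. *)
Lemma verma_lift (f : 'rV[k]_n -> X) :
  ds3_hom f -> (forall t v, Dy k t *: f v = 0) ->
  exists F : {linear verma M -> X}, forall v, F (vtensor v) = f v.
Proof.
move=> f_hom f_y; have f0 := ds3_hom0 f_hom; have [f_lin f_g f_d] := f_hom.
pose F0 (r : 'rV[D]_n) : X := \sum_i r 0 i *: f (delta_mx 0 i).
have F0lin : linear F0.
  move=> a r s; rewrite /F0 scaler_sumr -big_split; apply: eq_bigr => i _ /=.
  by rewrite !mxE scalerDl scalerA.
have [F F0E] : exists F : {linear 'rV[D]_n -> X}, F =1 F0.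
  by exists (HB.pack_for {linear 'rV[D]_n -> X} F0 (GRing.isLinear.Build _ _ _ _ F0 F0lin)).
have FE v : F (one_tensor v) = f v.
  rewrite {2}(row_sum_delta v) F0E /F0.
  elim/big_rec2: _ => [|i x y _ ->]; first by rewrite f0.
  by rewrite f_lin mxE.
have [G GE] : exists G : {linear verma M -> X}, forall w, G (pimod (@verma_rel k M) w) = F w.
  apply: quotmod_lift => w [g v|h v|t v].
  - by rewrite linearB linearZ /= !FE f_g subrr.
  - by rewrite linearB linearZ /= !FE f_d subrr.
  - by rewrite linearZ /= FE f_y.
by exists G => v; rewrite GE FE.
Qed.

End VermaLift.

(** * Normal words in the Fomin-Kirillov algebra *)

Section FominKirillovRewriting.
Variables (R : pzRingType) (x : nat -> R).
Local Notation a := (x 1).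
Local Notation b := (x 2).
Local Notation c := (x 3).
Hypotheses (aa : a * a = 0) (bb : b * b = 0) (cc : c * c = 0).
Hypothesis acbacb : a * c + b * a + c * b = 0.
Hypothesis cabcab : c * a + b * c + a * b = 0.

Definition xword (m : nat) : R :=
  if (m < 12)%N then \prod_(t <- nth [::] xwords m) x t else 0.

Lemma xmulE t m : (0 < t < 4)%N -> (m < 12)%N ->
  x t * xword m = \sum_(p <- xmul t m) xword p.1 *~ p.2.
Proof.
(* The quadratic relations are oriented so that no c stands before a or b. Every rule carries a tail
   z because words are products nested to the right. *)
have ca z : c * (a * z) = - (b * (c * z)) - a * (b * z).
  move/eqP: cabcab; rewrite -addrA addr_eq0 => /eqP ca.
  by rewrite !mulrA ca opprD mulrDl !mulNr.
have cb z : c * (b * z) = - (a * (c * z)) - b * (a * z).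
  move/eqP: acbacb; rewrite addrC addr_eq0 => /eqP cb.
  by rewrite !mulrA cb opprD mulrDl !mulNr.
have a0 z : a * (a * z) = 0 by rewrite mulrA aa mul0r.
have b0 z : b * (b * z) = 0 by rewrite mulrA bb mul0r.
have c0 z : c * (c * z) = 0 by rewrite mulrA cc mul0r.
(* The missing rule of the Groebner basis comes from the overlap c a a: reducing c a first turns 0
   into bab - aba. *)
have bab z : b * (a * (b * z)) = a * (b * (a * z)).
  have : c * (a * (a * z)) = 0 by rewrite a0 mulr0.
  rewrite !ca mulrDr !mulrN b0 oppr0 add0r opprK => /eqP.
  by rewrite subr_eq0 => /eqP.
have simp := (ca, cb, a0, b0, c0, bab, @mulrDr R, @mulrN R, @mulr0 R, @oppr0 R,
  @addr0 R, @add0r R, @opprD R, @opprK R).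
case: t => [|[|[|[|t]]]] // _; do 12?[case: m => [|m] //] => _;
  rewrite /xword /xmul /= ?big_cons ?big_nil /= ?big_cons ?big_nil ?mulr1z ?mulrN1z ?simp //;
  by rewrite addrC.
Qed.
End FominKirillovRewriting.

Section DoubleCommutation.
Variable k : fieldType.
Local Notation D := (dalg k).
Local Notation i0 := (@Ordinal 3 0 isT).
Local Notation i1 := (@Ordinal 3 1 isT).
Local Notation i2 := (@Ordinal 3 2 isT).

Lemma transp_elt m : (0 < m < 4)%N -> is_transp (s3_elt m).
Proof.
case: m => [|[|[|[|m]]]] // _; apply/existsP.
- by exists i0; apply/existsP; exists i1; rewrite /= eqxx.
- by exists i1; apply/existsP; exists i2; rewrite /= eqxx.
- by exists i0; apply/existsP; exists i2; rewrite /= eqxx.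
Qed.

Lemma transp_eltP t : is_transp t -> exists2 m, (0 < m < 4)%N & t = s3_elt m.
Proof.
move=> /is_transpP[i [j [ij ->]]]; exists (transpc i j); first exact: transpc_range.
exact: s3_elt_transp.
Qed.

Lemma transp_conj g t : is_transp t -> is_transp (pconj g t).
Proof.
move=> /is_transpP[i [j [ij ->]]]; rewrite pconjE tpermJ.
by apply/existsP; exists (g i); apply/existsP; exists (g j); rewrite eqxx (inj_eq perm_inj) ij.
Qed.

Definition Dxi (m : nat) : D := Dx k (s3_elt m).

Lemma Dxi_sqr m : (0 < m < 4)%N -> Dxi m * Dxi m = 0.
Proof.
move=> /transp_elt/is_transpP[i [j [ij e]]].
by rewrite /Dxi e /Dx -palgM -(palg0 (@drel k)); apply: palg_rel; apply: Rel_xx.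
Qed.

Lemma Dxi_acbacb : Dxi 1 * Dxi 3 + Dxi 2 * Dxi 1 + Dxi 3 * Dxi 2 = 0.
Proof.
rewrite /Dxi /Dx -!palgM -!palgD -(palg0 (@drel k)); apply: palg_rel.
exact: (@Rel_xxx k i0 i1 i2).
Qed.

Lemma Dxi_cabcab : Dxi 3 * Dxi 1 + Dxi 2 * Dxi 3 + Dxi 1 * Dxi 2 = 0.
Proof.
have s23E : s23 = tperm i2 i1 by apply: tpermC.
rewrite /Dxi /Dx -!palgM -!palgD -(palg0 (@drel k)); apply: palg_rel.
rewrite /s3_elt /= s23E; exact: (@Rel_xxx k i0 i2 i1).
Qed.

Lemma Dg_Dx g t : is_transp t ->
  Dg k g * Dx k t = scal (sgn g) * (Dx k (pconj g t) * Dg k g).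
Proof.
move=> /is_transpP[i [j [ij ->]]]; rewrite -scalE /Dg /Dx -!palgM -palgZ.
by apply: palg_rel; apply: Rel_gx.
Qed.

Lemma Ddelta_Dx h t : is_transp t -> Ddelta k h * Dx k t = Dx k t * Ddelta k (t ∘ h).
Proof.
move=> /is_transpP[i [j [ij ->]]]; rewrite /Ddelta /Dx -!palgM.
by apply: palg_rel; apply: Rel_dx.
Qed.

Lemma Dg_Dg g h : Dg k g * Dg k h = Dg k (g ∘ h).
Proof. by rewrite /Dg -palgM; apply: palg_rel; apply: Rel_gg. Qed.

Lemma Dg1 : Dg k 1%g = 1.
Proof. by rewrite -palg1; apply: palg_rel; apply: Rel_1. Qed.

(** Both cross relations in one shape: y passes x at the cost of an integer and terms g delta_h. The
    spanning argument needs no more than this shape. *)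
Lemma Dy_Dx s t : is_transp s -> is_transp t ->
  exists s' e h1 h2, Dy k s * Dx k t + Dx k t * Dy k s' =
    e%:R + Dg k t * (Ddelta k h1 - Ddelta k h2).
Proof.
have neq i j l : uniq [:: i; j; l] -> exists s' e h1 h2,
    Dy k (tperm i l) * Dx k (tperm i j) + Dx k (tperm i j) * Dy k s' =
    e%:R + Dg k (tperm i j) * (Ddelta k h1 - Ddelta k h2).
  move=> u; exists (tperm j l), 0, (tperm i l), (tperm i l ∘ tperm i j).
  rewrite add0r -[- Ddelta _ _]scaleN1r /Dy /Dx /Dg /Ddelta.
  rewrite -palgZ -palgD -!palgM -!palgD scaleN1r; apply: palg_rel; exact: Rel_yx'.
case/transp_eltP=> m mr ->; case/transp_eltP=> n nr ->.
have [->|mn] := eqVneq m n.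
  have /is_transpP[i [j [ij ->]]] := transp_elt nr.
  exists (tperm i j), 1%N, (tperm i j), 1%g.
  rewrite -[- Ddelta _ _]scaleN1r -[1%:R]/(1 : D) -palg1 /Dy /Dx /Dg /Ddelta.
  rewrite -palgZ -palgD -!palgM -!palgD scaleN1r; apply: palg_rel; exact: Rel_yx.
(* Two distinct transpositions share exactly one point, which is i. *)
have [i [j [l [u <- <-]]]] : exists i j l : 'I_3,
    [/\ uniq [:: i; j; l], transpc i l = m & transpc i j = n].
  case: m n mr nr mn => [|[|[|[|m]]]] [|[|[|[|n]]]] // _ _ _.
  - by exists i1, i2, i0.
  - by exists i0, i2, i1.
  - by exists i1, i0, i2.
  - by exists i2, i0, i1.
  - by exists i0, i1, i2.
  - by exists i2, i1, i0.
have [ij il _] := uniq3 u.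
by rewrite -(s3_elt_transp il) -(s3_elt_transp ij); apply: neq.
Qed.
End DoubleCommutation.

Lemma commutator_act (R : pzRingType) (W : lmodType R) (y x y' g d1 d2 : R) (n : nat) (w : W) :
  y * x + x * y' = n%:R + g * (d1 - d2) ->
  y *: (x *: w) = n%:R *: w + (g *: (d1 *: w) - g *: (d2 *: w)) - x *: (y' *: w).
Proof.
move=> e; apply/eqP; rewrite eq_sym subr_eq !scalerA -scalerBl -!scalerDl e.
by rewrite mulrBr.
Qed.

(** * Verma modules are spanned by normal words *)

Section VermaSpan.
Variables (k : fieldType) (M : ds3_module k).
Local Notation D := (dalg k).
Local Notation V := (verma M).
Local Notation xw := (xword (Dxi k)).

Definition xspan (w : V) : Prop :=
  exists c : nat -> 'rV[k]_(ds3_dim M), w = \sum_(m < 12) xw m *: vtensor (c m).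

Lemma xspan_lin c u v : xspan u -> xspan v -> xspan (scal c *: u + v).
Proof.
have [tl _ _] := vtensor_hom M.
move=> [a ->] [b ->]; exists (fun m => c *: a m + b m).
rewrite scaler_sumr -big_split; apply: eq_bigr => m _ /=.
by rewrite tl scalerDr scal_swap.
Qed.

Lemma xspan0 : xspan 0.
Proof.
exists (fun=> 0); rewrite big1 // => m _.
by rewrite (ds3_hom0 (vtensor_hom M)) scaler0.
Qed.

Lemma xspanZ c u : xspan u -> xspan (scal c *: u).
Proof. by move=> us; rewrite -[_ *: _]addr0; apply: xspan_lin us xspan0. Qed.

Lemma xspanD u v : xspan u -> xspan v -> xspan (u + v).
Proof. by rewrite -[u in u + _]scale1r -scal1; apply: xspan_lin. Qed.

Lemma xspanB u v : xspan u -> xspan v -> xspan (u - v).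
Proof. by rewrite -scaleN1r -scal1 -scalN => us vs; apply/xspanD/xspanZ. Qed.

Lemma xspan_sum (I : Type) (r : seq I) (P : pred I) (F : I -> V) :
  (forall i, P i -> xspan (F i)) -> xspan (\sum_(i <- r | P i) F i).
Proof. by move=> FP; elim/big_ind: _ => //; [exact: xspan0 | exact: xspanD]. Qed.

Lemma xspan_xw m v : xspan (xw m *: vtensor v).
Proof.
have [lt_m|ge_m] := ltnP m 12; last by rewrite /xword ltnNge ge_m scale0r; apply: xspan0.
exists (fun n => if n == m then v else 0).
rewrite (bigD1 (Ordinal lt_m)) //= eqxx big1 ?addr0 // => n.
by rewrite -val_eqE /= => /negPf ->; rewrite (ds3_hom0 (vtensor_hom M)) scaler0.
Qed.

Lemma xspan_Dx t w : is_transp t -> xspan w -> xspan (Dx k t *: w).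
Proof.
move=> /transp_eltP[m mr ->] [c ->]; rewrite scaler_sumr; apply: xspan_sum => i _.
have sqr n : (0 < n < 4)%N -> Dxi k n * Dxi k n = 0 by apply: Dxi_sqr.
rewrite scalerA -/(Dxi k m).
rewrite (xmulE (sqr 1 isT) (sqr 2 isT) (sqr 3 isT) (Dxi_acbacb k) (Dxi_cabcab k)) //.
rewrite scaler_suml; apply: xspan_sum => p _.
by rewrite -mulrzl -scal_int -scalerA; apply: xspanZ; apply: xspan_xw.
Qed.

(* By the triangular decomposition, the other generators can be moved to the right
   past the words in the x_t. *)
Definition xspan_stable (w : V) : Prop :=
  [/\ xspan w, forall g h, xspan (Dg k g *: (Ddelta k h *: w)),
      forall g, xspan (Dg k g *: w), forall h, xspan (Ddelta k h *: w) &
      forall t, xspan (Dy k t *: w)].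

Lemma xspan_stable_vtensor v : xspan_stable (vtensor v).
Proof.
have s0 u : xspan (vtensor u).
  by have := xspan_xw 0 u; rewrite /xword /= big_nil scale1r.
have [_ tg td] := vtensor_hom M.
split=> [|g h|g|h|t]; rewrite -?tg -?td -?tg; try exact: s0.
by rewrite vtensor_y; apply: xspan0.
Qed.

(** Moving y_s past x_t produces terms g delta_h w; this is why [xspan_stable] includes the products
    g delta_h, so that the induction on words closes. *)
Lemma xspan_stable_Dx t w : is_transp t -> xspan_stable w -> xspan_stable (Dx k t *: w).
Proof.
move=> tt [w_s w_gd w_g w_d w_y].
have g_s g u : (forall g, xspan (Dg k g *: u)) -> xspan (Dg k g *: (Dx k t *: u)).
  move=> u_g; rewrite scalerA Dg_Dx // -!scalerA; apply: xspanZ.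
  by apply: xspan_Dx; [apply: transp_conj | apply: u_g].
have d_s h : Ddelta k h *: (Dx k t *: w) = Dx k t *: (Ddelta k (t ∘ h) *: w).
  by rewrite !scalerA Ddelta_Dx.
split=> [|g h|g|h|s].
- exact: xspan_Dx.
- by rewrite d_s; apply: g_s => g'; apply: w_gd.
- exact: g_s.
- by rewrite d_s; apply: xspan_Dx => //; apply: w_d.
have [st|nst] := boolP (is_transp s); last by rewrite Dy_out // scale0r; apply: xspan0.
have [s' [e [h1 [h2 yx]]]] := Dy_Dx k st tt.
rewrite (commutator_act w yx); apply: xspanB; last by apply: xspan_Dx => //; apply: w_y.
apply: xspanD; last by apply: xspanB; apply: w_gd.
by have := xspanZ e%:R w_s; rewrite -[e%:R]/(e%:Z%:~R) scal_int.
Qed.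

Lemma xspan_stableP w : xspan w -> xspan_stable w.
Proof.
have lin : forall c u v, xspan_stable u -> xspan_stable v -> xspan_stable (scal c *: u + v).
  move=> c u v [u1 u2 u3 u4 u5] [v1 v2 v3 v4 v5].
  split=> [|g h|g|h|t]; first exact: xspan_lin.
  - by rewrite (scal_lin c (Ddelta k h)) (scal_lin c (Dg k g)); apply: xspan_lin.
  - by rewrite (scal_lin c (Dg k g)); apply: xspan_lin.
  - by rewrite (scal_lin c (Ddelta k h)); apply: xspan_lin.
  - by rewrite (scal_lin c (Dy k t)); apply: xspan_lin.
have stD u v : xspan_stable u -> xspan_stable v -> xspan_stable (u + v).
  by rewrite -[u in u + _]scale1r -scal1; apply: lin.
have st0 : xspan_stable 0 by split=> *; rewrite ?scaler0; apply: xspan0.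
move=> [c ->]; elim/big_ind: _ => [||m _]; [exact: st0 | exact: stD | rewrite /xword ltn_ord].
have: all (fun t => 0 < t < 4)%N (nth [::] xwords m).
  by have /all_nthP := erefl (all (all (fun t => 0 < t < 4)%N) xwords); apply.
elim: (nth [::] xwords m) => [_|t s IH /= /andP[tr sr]].
  by rewrite big_nil scale1r; apply: xspan_stable_vtensor.
by rewrite big_cons -scalerA; apply: xspan_stable_Dx (transp_elt tr) (IH sr).
Qed.

Lemma verma_gen (N : set V) : submodule N -> (forall v, N (vtensor v)) -> forall w, N w.
Proof.
move=> sN Nv w; have [r ->] := pimod_surj w; rewrite [r]row_sum_delta.
rewrite (big_morph _ (@pimodD _ _ _) (pimod0 _)).
elim/big_rec: _ => [|i x _ Nx]; first by case: sN.
rewrite pimodZ; case: (sN) => _; apply=> //.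
have -> : delta_mx 0 i = one_tensor (delta_mx 0 i) :> 'rV[D]_(ds3_dim M).
  by apply/rowP => j; rewrite !mxE; case: (_ && _); rewrite ?scal1 ?scal0.
exact: Nv.
Qed.

Lemma verma_span w : xspan w.
Proof.
have sub : submodule xspan.
  apply: submodule_gen; [exact: xspan0 | exact: xspan_lin | exact: xspan_Dx | ..].
  - by move=> t u _ /xspan_stableP[].
  - by move=> g u /xspan_stableP[].
  - by move=> h u /xspan_stableP[].
by apply: (verma_gen sub) => v; case: (xspan_stable_vtensor v).
Qed.

End VermaSpan.

(** * Identification of M(sigma, -) with the model *)

(** Names of generators. Words in them have two readings, as elements of D and as operations on
    integer vectors; the rightmost letter acts first. *)
Inductive dcode := GX of nat | GY of nat | GG of nat | GD of nat.

Definition ok_dcode (c : dcode) : bool :=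
  match c with GX t | GY t => (0 < t < 4)%N | GG m | GD m => (m < 6)%N end.

Definition dcode_op (c : dcode) : op :=
  match c with GX t => opX t | GY t => opY t | GG m => opG m | GD m => opD m end.

Definition act_word (d : seq dcode) (v : vec) : vec :=
  foldr (fun c => lin 36 (dcode_op c)) v d.

Section ModelModule.
Variable k : fieldType.
Local Notation D := (dalg k).

Definition dcode_elt (c : dcode) : D :=
  match c with
  | GX t => Dx k (s3_elt t) | GY t => Dy k (s3_elt t)
  | GG m => Dg k (s3_elt m) | GD m => Ddelta k (s3_elt m)
  end.

Definition word_elt (d : seq dcode) : D := \prod_(c <- d) dcode_elt c.

Definition model_mx : D -> 'M[k]_36 := palg_lift (fun x => op_mx k (dgen_op x)).

(** A copy of the column space, whose scalars are the elements of D instead of k. *)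
Definition model : Type := 'cV[k]_36.
HB.instance Definition _ := GRing.Zmodule.on model.

Definition model_scale (a : D) (v : model) : model := model_mx a *m v.

Lemma model_scaleA a b v : model_scale a (model_scale b v) = model_scale (a * b) v.
Proof. by rewrite /model_scale /model_mx (palg_liftM (@dgen_rel_op k)) mulmxA. Qed.

Lemma model_scale1 : left_id 1 model_scale.
Proof. by move=> v; rewrite /model_scale /model_mx (palg_lift1 (@dgen_rel_op k)) mul1mx. Qed.

Lemma model_scaleDr : right_distributive model_scale +%R.
Proof. by move=> a u v; rewrite /model_scale mulmxDr. Qed.

Lemma model_scaleDl v : {morph model_scale^~ v : a b / a + b}.
Proof.
by move=> a b; rewrite /model_scale /model_mx (palg_liftD (@dgen_rel_op k)) mulmxDl.
Qed.

HB.instance Definition _ := GRing.Zmodule_isLmodule.Build D model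
  model_scaleA model_scale1 model_scaleDr model_scaleDl.

Lemma model_scalE c (v : model) : scal c *: v = (c *: (v : 'cV[k]_36)) :> 'cV[k]_36.
Proof.
rewrite -[LHS]/(model_mx (scal c) *m v) /model_mx (palg_liftZ (@dgen_rel_op k)).
by rewrite (palg_lift1 (@dgen_rel_op k)) -scalemxAl mul1mx.
Qed.

Lemma model_mx_gen (x : dgen) : model_mx (palg (@drel k) (fgen x)) = op_mx k (dgen_op x).
Proof. by rewrite /model_mx (palg_lift_gen (@dgen_rel_op k)). Qed.

Lemma model_dcode c : ok_dcode c -> model_mx (dcode_elt c) = op_mx k (dcode_op c).
Proof.
have lt6 t : (0 < t < 4)%N -> (t < 6)%N by case/andP=> _ /leq_trans; apply.
case: c => [t tr|t tr|m lt|m lt] /=.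
- by rewrite -[s3_elt t](SubK transp (transp_elt tr)) Dx_transp model_mx_gen /= s3_eltK ?lt6.
- by rewrite -[s3_elt t](SubK transp (transp_elt tr)) Dy_transp model_mx_gen /= s3_eltK ?lt6.
- by rewrite /Dg model_mx_gen /= s3_eltK.
- by rewrite /Ddelta model_mx_gen /= s3_eltK.
Qed.

Lemma model_act d (v : vec) : all ok_dcode d ->
  word_elt d *: (ev (bE k) v : model) = ev (bE k) (act_word d v).
Proof.
rewrite /word_elt; elim: d => [_|c d IH /= /andP[okc okd]].
  by rewrite big_nil scale1r.
rewrite big_cons -scalerA IH // -[LHS]/(model_mx (dcode_elt c) *m _) model_dcode //.
exact: op_mx_ev.
Qed.

End ModelModule.

Section TableBasis.
Variables (k : fieldType) (X : lmodType (dalg k)) (b : nat -> X).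

(** Independence is not demanded, so that the images of the 36 vectors in a quotient module qualify
    as well. *)
Definition table_basis : Prop :=
  (forall j, (36 <= j)%N -> b j = 0) /\
  forall d v, all ok_dcode d -> word_elt k d *: ev b v = ev b (act_word d v).

Hypothesis bT : table_basis.

Lemma table_act d u v : all ok_dcode d -> eqv 36 (act_word d u) v ->
  word_elt k d *: ev b u = ev b v.
Proof. by case: bT => b_out bact okd uv; rewrite bact //; apply: ev_eqv uv. Qed.

Lemma table_act1 c u v : ok_dcode c -> eqv 36 (lin 36 (dcode_op c) u) v ->
  dcode_elt k c *: ev b u = ev b v.
Proof.
move=> okc uv; have := @table_act [:: c] u v; rewrite /word_elt big_seq1 /=.
by apply=> //; rewrite okc.
Qed.

Lemma ev_scal c v : ev b (scalev c v) = scal c%:~R *: ev b v.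
Proof. by rewrite ev_scale scal_int scaler_int. Qed.
End TableBasis.

Section DS3Hom.
Variables (k : fieldType) (W : lmodType (dalg k)).

Lemma ds3_hom_basis (M : ds3_module k) (b : 'I_(ds3_dim M) -> W) :
  (forall g i, Dg k g *: b i = \sum_j scal (ds3_rep M g i j) *: b j) ->
  (forall h i, Ddelta k h *: b i = if ds3_deg i == h then b i else 0) ->
  ds3_hom (fun v => \sum_i scal (v 0 i) *: b i).
Proof.
move=> bg bd; split=> [c u v|g v|h v].
- by rewrite scale_sum_lin; apply: eq_bigr => i _; rewrite !mxE scalD scalM.
- rewrite scaler_sumr; transitivity
    (\sum_i \sum_j scal (v 0 i) *: (scal (ds3_rep M g i j) *: b j)); last first.
    by apply: eq_bigr => i _; rewrite scal_swap bg scaler_sumr.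
  rewrite exchange_big; apply: eq_bigr => j _ /=.
  rewrite mxE scal_sum scaler_suml; apply: eq_bigr => i _.
  by rewrite scalM scalerA.
- rewrite scaler_sumr; apply: eq_bigr => i _.
  rewrite scal_swap bd ds3_deltaE; case: ifP => // _.
  by rewrite scal0 scale0r scaler0.
Qed.

Section ClassHom.
Variables (n : nat) (deg : 'I_n -> 'S_3) (chi : 'S_3 -> k).
Hypothesis deg_inj : injective deg.
Hypothesis deg_stable : forall g i, exists j, deg j = pconj g (deg i).
Hypothesis chi1 : chi 1%g = 1.
Hypothesis chiM : forall g h, chi (g * h)%g = chi g * chi h.
Local Notation M := (class_module deg_inj deg_stable chi1 chiM).

Lemma class_hom (b : 'I_n -> W) :
  (forall g i j, deg j = pconj g (deg i) -> Dg k g *: b i = scal (chi g) *: b j) ->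
  (forall h i, Ddelta k h *: b i = if deg i == h then b i else 0) ->
  ds3_hom (fun v : 'rV[k]_(ds3_dim M) => \sum_i scal (v 0 i) *: b i).
Proof.
move=> bg bd; apply: ds3_hom_basis => // g i.
have [j dj] := deg_stable g i.
rewrite (bg g i j dj) (bigD1 j) //= mxE dj eqxx big1 ?addr0 // => l.
rewrite mxE -dj (inj_eq deg_inj) => /negPf ->.
by rewrite scal0 scale0r.
Qed.

Variables (b : nat -> W) (bT : table_basis b).
Variables (vs : seq vec) (dc : seq nat) (sc : nat -> int).
Hypothesis deg_code : forall i, deg i = s3_elt (nth 0 dc i).
Hypothesis chi_code : forall m, (m < 6)%N -> chi (s3_elt m) = (sc m)%:~R.

(** Certificate that the vectors [vs] transform like the kets of a class module with degrees
    numbered by [dc] and character [sc]. *)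
Definition class_table (n : nat) : bool :=
  [&& all (fun d => d < 6)%N dc,
      all6 (fun m => all (fun i => all (fun j =>
        (nth 0 dc j == conjc m (nth 0 dc i))%N ==>
        eqv 36 (lin 36 (opG m) (nth [::] vs i)) (scalev (sc m) (nth [::] vs j)))
        (iota 0 n)) (iota 0 n)) &
      all6 (fun m => all (fun i => eqv 36 (lin 36 (opD m) (nth [::] vs i))
        (if nth 0 dc i == m then nth [::] vs i else [::])) (iota 0 n))].

Lemma class_hom_table : class_table n ->
  ds3_hom (fun v : 'rV[k]_(ds3_dim M) => \sum_i scal (v 0 i) *: ev b (nth [::] vs i)).
Proof.
case/and3P=> dc6 chkg chkd.
have dc_lt i : (nth 0 dc i < 6)%N.
  have [lt|ge] := ltnP i (size dc); first by move/all_nthP: dc6; apply.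
  by rewrite nth_default.
have in_iota (i : 'I_n) : (i : nat) \in iota 0 n by rewrite mem_iota ltn_ord.
apply: (@class_hom (fun i => ev b (nth [::] vs i))) => [g i j|h i].
- have [m ltm ->] := s3_eltP g; rewrite !deg_code s3_eltJ => e.
  have {}e : nth 0 dc j = conjc m (nth 0 dc i).
    by apply/eqP; rewrite -s3_elt_eq ?conjc_lt // e.
  have /allP/(_ _ (in_iota i))/allP/(_ _ (in_iota j)) := all6P chkg ltm.
  rewrite e eqxx /= => chk; rewrite chi_code // -ev_scal.
  exact: (table_act1 (c := GG m) bT).
- have [m ltm ->] := s3_eltP h; rewrite deg_code s3_elt_eq //.
  have /allP/(_ _ (in_iota i)) chk := all6P chkd ltm.
  rewrite (table_act1 (c := GD m) bT ltm chk).
  by case: ifP => // _; rewrite ev_nil.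
Qed.
End ClassHom.
End DS3Hom.

Section SigmaVerma.
Variable k : fieldType.
Local Notation D := (dalg k).
Local Notation W := (verma (Msigma_minus k)).

Definition bW (j : nat) : W :=
  xword (Dxi k) (j %/ 3) *: vtensor (delta_mx 0 (inord (j %% 3)) : 'rV[k]_(ds3_dim (Msigma_minus k))).

Lemma bW_out j : (36 <= j)%N -> bW j = 0.
Proof.
move=> le_j; rewrite /bW /xword ltnNge leq_divRL // le_j /=.
exact: scale0r.
Qed.

Lemma model_table : table_basis (bE k : nat -> model k).
Proof. by split; [exact: bE_out | move=> d v; exact: model_act]. Qed.

Definition ket_vecs : seq vec := [seq [:: (i, 1%R)] | i <- iota 0 3].

Lemma Dy_ev_eq0 (X : lmodType D) (b : nat -> X) v : table_basis b ->
  all (fun t => eqv 36 (lin 36 (opY t) v) [::]) [:: 1; 2; 3]%N ->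
  forall t, Dy k t *: ev b v = 0.
Proof.
move=> bT /and4P[v1 v2 v3 _] t; have [tt|nt] := boolP (is_transp t); last first.
  by rewrite Dy_out // scale0r.
have [m mr ->] := transp_eltP tt; rewrite -(ev_nil b).
apply: (table_act1 (c := GY m) bT mr).
by case: m mr => [|[|[|[|m]]]].
Qed.

Lemma verma_to_model : exists f : {linear W -> model k},
  forall v, f (vtensor v) = \sum_i scal (v 0 i) *: (ev (bE k) (nth [::] ket_vecs i) : model k).
Proof.
apply: verma_lift => [|t v].
  apply: (@class_hom_table _ _ _ _ _ _ _ _ _ _ model_table _ [:: 1; 2; 3]%N sgnc) => //.
  - by move=> i; rewrite transp_degE; case: i => [[|[|[|]]]].
  - by move=> m _; apply: sgn_s3_elt.
rewrite scaler_sumr big1 // => i _; rewrite scal_swap Dy_ev_eq0 ?scaler0 //.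
  exact: model_table.
by case: i => [[|[|[|]]]].
Qed.

Definition to_model : {linear W -> model k} := projT1 (cid verma_to_model).

Lemma to_model_vtensor v :
  to_model (vtensor v) = \sum_i scal (v 0 i) *: (ev (bE k) (nth [::] ket_vecs i) : model k).
Proof. exact: projT2 (cid verma_to_model) v. Qed.

Lemma xword_elt m : (m < 12)%N -> xword (Dxi k) m = word_elt k (map GX (nth [::] xwords m)).
Proof. by move=> lt_m; rewrite /xword lt_m /word_elt big_map. Qed.

Lemma to_model_bW j : to_model (bW j) = bE k j.
Proof.
have [lt_j|ge_j] := ltnP j 36; last by rewrite bW_out // bE_out // linear0.
rewrite /bW linearZ /= to_model_vtensor (bigD1 (inord (j %% 3))) //= big1 ?addr0; last first.
  by move=> i /negPf ne; rewrite mxE eqxx ne scal0 scale0r.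
rewrite mxE !eqxx scal1 scale1r inordK ?ltn_mod // xword_elt ?ltn_divLR //.
have chk : all (fun j => all ok_dcode (map GX (nth [::] xwords (j %/ 3))) && eqv 36
    (act_word (map GX (nth [::] xwords (j %/ 3))) (nth [::] ket_vecs (j %% 3)))
    [:: (j, 1)]) (iota 0 36) by vm_compute.
have /andP[okj eqj] := all_iotaP chk lt_j.
by rewrite (table_act model_table okj eqj) ev1.
Qed.

Lemma to_model_ev v : to_model (ev bW v) = ev (bE k) v.
Proof.
by rewrite /ev raddf_sum; apply: eq_bigr => p _; rewrite raddfMz /= to_model_bW.
Qed.

Definition coordW (w : W) (j : nat) : k := (to_model w : 'cV[k]_36) (inord j) 0.

Lemma coordW_lin c u v j : coordW (scal c *: u + v) j = c * coordW u j + coordW v j.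
Proof. by rewrite /coordW linearP model_scalE !mxE. Qed.

Lemma coordW_ev v j : (j < 36)%N -> coordW (ev bW v) j = (coefv v j)%:~R.
Proof.
move=> lt_j; rewrite /coordW to_model_ev (ev_coef (@bE_out k)) summxE.
rewrite (bigD1 (Ordinal lt_j)) //= big1 ?addr0 => [|i].
  by rewrite -scaler_int !mxE inordK // eqxx mulr1.
by rewrite -val_eqE /= -scaler_int !mxE inordK // eq_sym => /negPf ->; rewrite mulr0.
Qed.

Lemma coordW_bW i j : (j < 36)%N -> coordW (bW i) j = (i == j)%:R.
Proof.
move=> lt_j; have := coordW_ev [:: (i, 1)] lt_j; rewrite ev1 => ->.
by rewrite /=; case: eqP.
Qed.

Lemma bW_span w : w = \sum_(j < 36) scal (coordW w j) *: bW j.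
Proof.
have lin c u v : u = \sum_(j < 36) scal (coordW u j) *: bW j ->
    v = \sum_(j < 36) scal (coordW v j) *: bW j ->
    scal c *: u + v = \sum_(j < 36) scal (coordW (scal c *: u + v) j) *: bW j.
  move=> {1}-> {1}->; apply: etrans (scale_sum_lin _ _ _ _) _; apply: eq_bigr => j _.
  by rewrite coordW_lin scalD scalM.
have b0 : 0 = \sum_(j < 36) scal (coordW 0 j) *: bW j.
  by rewrite big1 // => j _; rewrite /coordW linear0 mxE scal0 scale0r.
have bb i : (i < 36)%N -> bW i = \sum_(j < 36) scal (coordW (bW i) j) *: bW j.
  move=> lt_i; rewrite (bigD1 (Ordinal lt_i)) //= coordW_bW // eqxx scal1 scale1r.
  rewrite big1 ?addr0 // => j; rewrite -val_eqE /= eq_sym => /negPf ne.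
  by rewrite coordW_bW // ne scal0 scale0r.
have bD u v : u = \sum_(j < 36) scal (coordW u j) *: bW j ->
    v = \sum_(j < 36) scal (coordW v j) *: bW j ->
    u + v = \sum_(j < 36) scal (coordW (u + v) j) *: bW j.
  by move=> eu ev; rewrite -[u in LHS]scale1r -[u in RHS]scale1r -scal1; apply: lin.
have [c ->] := verma_span w.
elim/big_ind: _ => [||m _]; [exact: b0 | exact: bD | ].
have vt : vtensor (c m) = \sum_i scal (c m 0 i) *: vtensor (delta_mx 0 i) :> W.
  rewrite {1}(row_sum_delta (c m)).
  elim/big_rec2: _ => [|i x y _ <-]; first exact: ds3_hom0 (vtensor_hom _).
  by have [-> _ _] := vtensor_hom (Msigma_minus k).
rewrite vt scaler_sumr; elim/big_ind: _ => [||i _]; [exact: b0 | exact: bD | ].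
rewrite scal_swap -[scal _ *: _]addr0; apply: lin b0.
have lt_mi : (3 * m + i < 36)%N.
  have := ltn_ord i; have := ltn_ord m; rewrite -[ds3_dim _]/3%N => lm li.
  by rewrite -[36%N]/(3 * 11 + 3)%N -addnS leq_add // leq_mul2l -ltnS.
have -> : xword (Dxi k) m *: vtensor (delta_mx 0 i) = bW (3 * m + i) :> W.
  have [em ei] : ((3 * m + i) %/ 3 = m /\ (3 * m + i) %% 3 = i)%N.
    by rewrite mulnC divnMDl // modnMDl divn_small ?modn_small ?addn0.
  by rewrite /bW em ei inord_val.
exact: bb.
Qed.

Lemma to_model_inj : injective to_model.
Proof.
by move=> u v uv; rewrite (bW_span u) (bW_span v) /coordW uv.
Qed.

(** The tables for y, g and delta are never recomputed inside the Verma module: both sides have the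
    same image in the model, and [to_model] is injective. *)
Lemma bW_table : table_basis bW.
Proof.
split=> [|d v okd]; first exact: bW_out.
by apply: to_model_inj; rewrite linearZ /= !to_model_ev model_act.
Qed.

End SigmaVerma.

(** * Submodules spanned by integer combinations *)

Lemma intr_neq0 (k : fieldType) (z : int) : [pchar k] =i pred0 -> z != 0 -> z%:~R != 0 :> k.
Proof.
move=> char0 z0; have /pcharf0P natr0 := char0.
by case: z z0 => n n0; rewrite ?NegzE ?mulrNz ?oppr_eq0 -pmulrn natr0.
Qed.

Definition dpoly : Type := seq (int * seq dcode).
Definition act_poly (d : dpoly) (v : vec) : vec :=
  flatten [seq scalev p.1 (act_word p.2 v) | p <- d].
Definition ok_dpoly (d : dpoly) : bool := all (fun p => all ok_dcode p.2) d.
Definition subv (u v : vec) : vec := u ++ scalev (-1) v.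
Definition dotv (f v : vec) : int := foldr (fun p s => p.2 * coefv v p.1 + s) 0 f.

Section TableSpan.
Variables (k : fieldType) (char0 : [pchar k] =i pred0).
Local Notation D := (dalg k).
Variables (X : lmodType D) (b : nat -> X) (bT : table_basis b).
Variables (null : vec -> bool) (nullP : forall v, null v -> ev b v = 0).
Implicit Types (N : set X) (vs : seq vec).

Definition poly_elt (d : dpoly) : D := \sum_(p <- d) word_elt k p.2 *~ p.1.

Lemma act_polyE d v : ok_dpoly d -> poly_elt d *: ev b v = ev b (act_poly d v).
Proof.
rewrite /poly_elt /act_poly; elim: d => [_|p d IH /= /andP[okp okd]].
  by rewrite big_nil scale0r ev_nil.
rewrite big_cons scalerDl IH // ev_cat ev_scale -scalerMzl; congr (_ *~ _ + _).
by case: bT => _ ->.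
Qed.

Lemma ev_subv u v : ev b (subv u v) = ev b u - ev b v.
Proof. by rewrite ev_cat ev_scale mulrN1z. Qed.

Definition evspan vs : set X :=
  [set w | exists c : nat -> k, w = \sum_(i < size vs) scal (c i) *: ev b (nth [::] vs i)].

Lemma evspan_mem vs i : (i < size vs)%N -> evspan vs (ev b (nth [::] vs i)).
Proof.
move=> lt_i; exists (fun j => (j == i)%:R).
rewrite (bigD1 (Ordinal lt_i)) //= eqxx scal1 scale1r big1 ?addr0 // => j.
by rewrite -val_eqE /= => /negPf ->; rewrite scal0 scale0r.
Qed.

Lemma evspan0 vs : evspan vs 0.
Proof. by exists (fun=> 0); rewrite big1 // => i _; rewrite scal0 scale0r. Qed.

Lemma evspan_lin vs c u v : evspan vs u -> evspan vs v -> evspan vs (scal c *: u + v).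
Proof.
move=> [f ->] [g ->]; exists (fun i => c * f i + g i).
apply: etrans (scale_sum_lin _ _ _ _) _; apply: eq_bigr => i _.
by rewrite scalD scalM.
Qed.

Definition combv vs (fs : seq vec) (w : vec) : vec :=
  flatten [seq scalev (dotv (nth [::] fs i) w) (nth [::] vs i) | i <- iota 0 (size vs)].

Lemma ev_combv vs fs w :
  ev b (combv vs fs w) = \sum_(i < size vs) scal (dotv (nth [::] fs i) w)%:~R *: ev b (nth [::] vs i).
Proof.
rewrite /combv -(big_mkord xpredT (fun i => scal (dotv (nth [::] fs i) w)%:~R *: ev b (nth [::] vs i))).
rewrite /index_iota subn0; elim: (iota _ _) => [|i r IH]; first by rewrite big_nil ev_nil.
by rewrite /= ev_cat IH big_cons ev_scal.
Qed.

Lemma evspan_combv vs fs w : evspan vs (ev b (combv vs fs w)).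
Proof. by rewrite ev_combv; exists (fun i => (dotv (nth [::] fs i) w)%:~R). Qed.

(** The forms [fs], divided by L, propose coordinates on the span of [ws]. Only the resulting
    identity is tested, after clearing the denominator L, so nothing about [fs] has to be known
    beforehand. *)
Definition maps_under vs ws fs (L : int) (c : dcode) : bool :=
  all (fun v => let w := lin 36 (dcode_op c) v in
    null (subv (scalev L w) (combv ws fs w))) vs.

Definition stable_under vs := maps_under vs vs.

Definition stable_table vs fs (L : int) : bool :=
  [&& all (fun t => stable_under vs fs L (GX t) && stable_under vs fs L (GY t)) [:: 1; 2; 3]%N
    & all6 (fun m => stable_under vs fs L (GG m) && stable_under vs fs L (GD m))].

Lemma evspan_sum vs (I : Type) (r : seq I) (F : I -> X) :
  (forall i, evspan vs (F i)) -> evspan vs (\sum_(i <- r) F i).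
Proof.
move=> sF; elim/big_rec: _ => [|i x _ sx]; first exact: evspan0.
by rewrite -[F i]scale1r -scal1; apply: evspan_lin.
Qed.

Lemma evspanZ vs c u : evspan vs u -> evspan vs (scal c *: u).
Proof. by move=> su; rewrite -[_ *: _]addr0; apply: evspan_lin su (evspan0 vs). Qed.

Lemma dcode_act c v : ok_dcode c -> dcode_elt k c *: ev b v = ev b (lin 36 (dcode_op c) v).
Proof.
by move=> okc; case: bT => _ /(_ [:: c] v); rewrite /word_elt big_seq1 /= okc; apply.
Qed.

Lemma scal_intK (L : int) (u v : X) : L != 0 ->
  scal L%:~R *: u = v -> u = scal (L%:~R)^-1 *: v.
Proof.
by move=> L0 <-; rewrite scalerA -scalM mulVf ?scal1 ?scale1r // intr_neq0.
Qed.

Lemma maps_underP vs ws fs L c : L != 0 -> ok_dcode c -> maps_under vs ws fs L c ->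
  forall u, evspan vs u -> evspan ws (dcode_elt k c *: u).
Proof.
move=> L0 okc chk u [f ->]; rewrite scaler_sumr.
apply: evspan_sum => i; rewrite scal_swap; apply: evspanZ.
have /nullP := allP chk _ (mem_nth [::] (ltn_ord i)).
have combS := evspan_combv ws fs (lin 36 (dcode_op c) (nth [::] vs i)).
rewrite ev_subv ev_scal -dcode_act // => /eqP; rewrite subr_eq0 => /eqP.
by move/(scal_intK L0) => ->; apply: evspanZ.
Qed.

Lemma evspan_submodule vs fs L : L != 0 -> stable_table vs fs L -> submodule (evspan vs).
Proof.
move=> L0 /andP[/allP chkxy chkgd].
have gen c := maps_underP (fs := fs) (vs := vs) (ws := vs) (c := c) L0.
have chk3 m : (0 < m < 4)%N -> stable_under vs fs L (GX m) && stable_under vs fs L (GY m).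
  by move=> mr; apply: chkxy; case: m mr => [|[|[|[|m]]]].
apply: submodule_gen => [||t u|t u|g u|h u].
- exact: evspan0.
- exact: evspan_lin.
- by move=> /transp_eltP[m mr ->]; have /andP[chk _] := chk3 m mr; apply: (gen (GX m)).
- by move=> /transp_eltP[m mr ->]; have /andP[_ chk] := chk3 m mr; apply: (gen (GY m)).
- by have [m ltm ->] := s3_eltP g; have /andP[chk _] := all6P chkgd ltm; apply: (gen (GG m)).
- by have [m ltm ->] := s3_eltP h; have /andP[_ chk] := all6P chkgd ltm; apply: (gen (GD m)).
Qed.

(* The elements ds_i of D send vs_i to a nonzero multiple of t and vs_j to 0 for
   j > i, so that every submodule meeting the span of vs contains t. *)
Definition down_table vs (ds : seq dpoly) (zs : seq int) (t : vec) : bool :=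
  all (fun i => [&& ok_dpoly (nth [::] ds i), nth 0 zs i != 0,
    null (subv (act_poly (nth [::] ds i) (nth [::] vs i)) (scalev (nth 0 zs i) t)) &
    all (fun j => null (act_poly (nth [::] ds i) (nth [::] vs j))) (iota i.+1 (size vs - i.+1))])
  (iota 0 (size vs)).

Lemma down_table_memc vs ds zs t N (c : nat -> k) : down_table vs ds zs t ->
  submodule N -> N (\sum_(i < size vs) scal (c i) *: ev b (nth [::] vs i)) ->
  (exists i : 'I_(size vs), c i != 0) -> N (ev b t).
Proof.
move=> chk sN Nw [i0 ci0].
(* For the least index i with a nonzero coefficient, the earlier terms are absent and ds_i kills the
   later ones; only a nonzero multiple of t survives. *)
have [i ci i_min] := @arg_minnP _ i0 (fun i => c i != 0) (fun i : 'I_(size vs) => i : nat) ci0.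
have /and4P[okd z0 /nullP dt /allP d0] := all_iotaP chk (ltn_ord i).
have z0k := intr_neq0 char0 z0.
have : N (poly_elt (nth [::] ds i) *: \sum_(i < size vs) scal (c i) *: ev b (nth [::] vs i)).
  exact: submoduleZ.
rewrite scaler_sumr (bigD1 i) //= big1 ?addr0 => [|j ji].
  rewrite scal_swap act_polyE //; move: dt => /eqP; rewrite ev_subv ev_scal subr_eq0 => /eqP ->.
  rewrite scalerA -scalM => /(submoduleZ (scal (c i * (nth 0 zs i)%:~R)^-1) sN).
  by rewrite scalerA -scalM mulVf ?scal1 ?scale1r // mulf_neq0.
have [lt_ij|le_ji] := ltnP i j; last first.
  have -> : c j = 0; last by rewrite scal0 scale0r scaler0.
  apply/eqP; apply: contraNT ji => cj.
  by rewrite -val_eqE eqn_leq le_ji i_min.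
rewrite scal_swap act_polyE // nullP ?scaler0 //; apply: d0.
by rewrite mem_iota lt_ij subnKC ?ltn_ord.
Qed.

Lemma down_table_mem vs ds zs t N w : down_table vs ds zs t ->
  submodule N -> evspan vs w -> N w -> w <> 0 -> N (ev b t).
Proof.
move=> chk sN [c wE] Nw w0; rewrite wE in Nw.
apply: (down_table_memc (c := c) chk sN Nw).
apply: contrapT => nc; apply: w0; rewrite wE; apply: big1 => i _.
suff -> : c i = 0 by rewrite scal0 scale0r.
apply/eqP/negPn/negP => ci; apply: nc; exact: (ex_intro _ i ci).
Qed.

(** A nontrivial linear relation would be a nontrivial combination lying in the zero submodule,
    which would then contain t. The certificate thus also proves independence. *)
Lemma down_table_inj vs ds zs t (c : nat -> k) : down_table vs ds zs t -> ev b t <> 0 ->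
  \sum_(i < size vs) scal (c i) *: ev b (nth [::] vs i) = 0 ->
  forall i, (i < size vs)%N -> c i = 0.
Proof.
move=> chk t0 w0 i lt_i.
apply/eqP/negPn/negP => ci; apply: t0.
apply: (@down_table_memc _ _ _ _ [set 0] c chk _ w0); last by exists (Ordinal lt_i).
by split=> // a u v -> ->; rewrite scaler0 addr0.
Qed.

(** The companion of [down_table]: L us_i t equals zs_i vs_i up to null vectors, with zs_i
    invertible in k, so t generates every vs_i. *)
Definition up_table vs (us : seq (seq dcode)) (L : int) (zs : seq int) (t : vec) : bool :=
  all (fun i => [&& all ok_dcode (nth [::] us i), nth 0 zs i != 0 &
    null (subv (scalev L (act_word (nth [::] us i) t)) (scalev (nth 0 zs i) (nth [::] vs i)))])
  (iota 0 (size vs)).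

Lemma up_table_mem vs us L zs t N : up_table vs us L zs t -> submodule N ->
  N (ev b t) -> evspan vs `<=` N.
Proof.
move=> chk sN Nt w [c ->].
have mem i : (i < size vs)%N -> N (ev b (nth [::] vs i)).
  move=> lt_i; have /and3P[okd z0 /nullP] := all_iotaP chk lt_i.
  rewrite ev_subv !ev_scal => /eqP; rewrite subr_eq0 eq_sym => /eqP/(scal_intK z0) ->.
  by case: bT => _ <- //; do 3!apply: (submoduleZ _ sN).
elim/big_rec: _ => [|i x _ Nx]; first by case: sN.
by case: (sN) => _; apply => //; apply: mem.
Qed.
End TableSpan.

(** * The socle of M(sigma, -) *)

Section Socle.
Local Open Scope nat_scope.

(** 33 = 3 * 11 + 0 stands for the longest normal word times |12>. *)
Definition top_vec : vec := [:: (33, 1%R)].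

(* The normal words ordered by length, each with a word whose product with it
   is plus or minus the longest normal word and whose products with the later
   normal words vanish: B(V) is a Frobenius algebra. *)
Definition dual_words : seq (nat * (seq nat * int)) :=
  [:: (0, ([:: 1; 2; 1; 3], 1%R)); (1, ([:: 2; 1; 3], (-1)%R)); (2, ([:: 1; 2; 3], (-1)%R));
      (6, ([:: 1; 2; 1], 1%R)); (3, ([:: 3; 2], (-1)%R)); (4, ([:: 3; 1], (-1)%R));
      (7, ([:: 1; 2], 1%R)); (8, ([:: 1; 3], (-1)%R)); (5, ([:: 3], (-1)%R));
      (9, ([:: 2], 1%R)); (10, ([:: 1], 1%R)); (11, ([::], 1%R))].

Definition degree_order : seq nat := [seq 3 * p.1 + i | p <- dual_words, i <- iota 0 3].

(** The dual word acts first. As the longest normal word has degree e, the projection to degree d_i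
    then isolates the ket |d_i>, and (13) or (23) conjugates d_i to (12). *)
Definition down_top : seq dpoly := [seq [:: (1%R, [:: GG (nth 0 [:: 0; 3; 2] i); GD i.+1]
    ++ map GX p.2.1)] | p <- dual_words, i <- iota 0 3].

(** The conjugating transposition fixes the longest normal word, so for nonzero i the extra sign is
    the one by which it acts on the kets of M(sigma, -). *)
Definition down_top_coef : seq int :=
  [seq (p.2.2 * (if i == 0 then 1 else -1))%R | p <- dual_words, i <- iota 0 3].

(** Three vectors with words of length 2, four of length 3, and the longest word times each of the
    three kets. *)
Definition socle_vecs : seq vec :=
  [:: [:: (9, 1%R); (13, 1%R); (22, 1%R); (24, 1%R)];
      [:: (10, 1%R); (23, 1%R)];
      [:: (12, 1%R); (26, 1%R)];
      [:: (15, 1%R); (29, 1%R)];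
      [:: (16, 1%R); (32, 1%R)];
      [:: (27, 1%R); (32, (-1)%R)];
      [:: (29, (-1)%R); (31, 1%R)];
      [:: (33, 1%R)]; [:: (34, 1%R)]; [:: (35, 1%R)]].

(** At each listed index exactly one of [socle_vecs] has a nonzero coefficient, equal to 1. The
    forms are therefore dual to [socle_vecs], and [in_socle] compares a vector with its
    projection. *)
Definition socle_funs : seq vec :=
  [seq [:: (j, 1%R)] | j <- [:: 9; 10; 12; 15; 16; 27; 31; 33; 34; 35]].

(** Each y lowers the word length by one: two, one or no letters y lead from the top to lengths 2, 3
    and 4. *)
Definition socle_words : seq (seq dcode) :=
  [:: [:: GY 1; GY 2]; [:: GY 2; GY 1; GG 2]; [:: GY 1; GY 2; GG 2]; [:: GY 3];
      [:: GY 3; GG 3]; [:: GY 1; GG 2]; [:: GY 2; GG 2]; [::]; [:: GG 3]; [:: GG 2]].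

Definition socle_coefs : seq int :=
  [:: 1; -1; -1; -1; 1; 1; 1; 1; -1; -1]%R.

Definition in_socle (v : vec) : bool := eqv 36 v (combv socle_vecs socle_funs v).
Definition is_zero (v : vec) : bool := eqv 36 v [::].
End Socle.

Lemma sum_perm_iota (V : nmodType) (F : nat -> V) (s : seq nat) n :
  perm_eq s (iota 0 n) -> \sum_(i < size s) F (nth 0 s i)%N = \sum_(j < n) F j.
Proof.
move=> sn; transitivity (\sum_(j <- s) F j); first by rewrite (big_nth 0%N) big_mkord.
by rewrite (perm_big _ sn) -(big_mkord xpredT) /index_iota subn0.
Qed.

Section SocleTheory.
Variables (k : fieldType) (char0 : [pchar k] =i pred0).
Local Notation D := (dalg k).
Local Notation W := (verma (Msigma_minus k)).
Local Notation b := (bW k).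

Lemma is_zeroP v : is_zero v -> ev b v = 0.
Proof. by move=> /(ev_eqv (@bW_out k)) ->; rewrite ev_nil. Qed.

Lemma ev_top : ev b top_vec = b 33. Proof. exact: ev1. Qed.

Lemma bW_neq0 j : (j < 36)%N -> b j <> 0.
Proof.
move=> lt_j bj0; have := coordW_bW k j lt_j; rewrite bj0 eqxx /coordW linear0 mxE.
by move/eqP; rewrite eq_sym oner_eq0.
Qed.

Lemma nonzero_mem (X : lmodType D) (N : set X) :
  submodule N -> N <> [set 0] -> exists2 w, N w & w <> 0.
Proof.
move=> sN N0; apply: contrapT => nw; apply: N0; apply/seteqP; split=> [w Nw | w -> ].
  by apply: contrapT => w0; apply: nw; exists w.
by case: sN.
Qed.

Lemma degree_order_span w : evspan b [seq [:: (j, 1)] | j <- degree_order] w.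
Proof.
have perm : perm_eq degree_order (iota 0 36) by vm_compute.
pose F j := scal (coordW w j) *: b j.
have wF : w = \sum_(i < size degree_order) F (nth 0 degree_order i)%N.
  by apply: (etrans (_ : w = \sum_(j < 36) F j)); [exact: bW_span | exact: esym (sum_perm_iota F perm)].
exists (fun i => coordW w (nth 0 degree_order i)%N).
rewrite {1}wF -(size_map (fun j => [:: (j, 1 : int)])); apply: eq_bigr => i _.
have lt_i : (i < size degree_order)%N by apply: leq_trans (ltn_ord i) _; rewrite size_map.
rewrite (nth_map 0%N [::] _ lt_i) /F; congr (_ *: _); exact: esym (ev1 b _).
Qed.

Lemma submodule_top (N : set W) : submodule N -> N <> [set 0] -> N (ev b top_vec).
Proof.
move=> sN N0; have [w Nw w0] := nonzero_mem sN N0.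
have chk : down_table is_zero [seq [:: (j, 1)] | j <- degree_order] down_top down_top_coef top_vec.
  by vm_compute.
exact: (down_table_mem char0 (@bW_table k) is_zeroP chk sN (degree_order_span w) Nw w0).
Qed.

Lemma socle_evspan_sub : submodule (evspan b socle_vecs).
Proof.
have chk : stable_table is_zero socle_vecs socle_funs 1 by vm_compute.
exact: (evspan_submodule char0 (@bW_table k) is_zeroP _ chk).
Qed.

Lemma socle_up (N : set W) : submodule N -> N (ev b top_vec) -> evspan b socle_vecs `<=` N.
Proof.
have chk : up_table is_zero socle_vecs socle_words 1 socle_coefs top_vec by vm_compute.
exact: (up_table_mem char0 (@bW_table k) is_zeroP chk).
Qed.

Lemma socle_evspan_simple : simple_submodule (evspan b socle_vecs).
Proof.
split=> [||N sN NS].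
- exact: socle_evspan_sub.
- move=> S0; apply: (@bW_neq0 33) => //.
  have : evspan b socle_vecs (b 33) by rewrite -ev_top; exact: (@evspan_mem _ _ _ socle_vecs 7).
  by rewrite S0.
have [->|N0] := pselect (N = [set 0]); [by left | right].
by apply/seteqP; split=> //; apply: socle_up => //; apply: submodule_top.
Qed.

(** This simple submodule lies in every nonzero submodule, hence it is the only simple one. *)
Lemma socmodE : socmod W = evspan b socle_vecs.
Proof.
rewrite /socmod; have -> : [set w : W | exists2 N, simple_submodule N & N w] = evspan b socle_vecs.
  apply/seteqP; split=> [w [N [sN N0 Nmin] Nw] | w Sw]; last first.
    by exists (evspan b socle_vecs) => //; exact: socle_evspan_simple.
  have SN := socle_up sN (submodule_top sN N0).
  have [_ S0 _] := socle_evspan_simple.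
  by case: (Nmin _ socle_evspan_sub SN) => [/S0 //|->].
exact: gen_submodule_id socle_evspan_sub.
Qed.

End SocleTheory.

(** * The quotient OPU / S *)

Section QuotientData.
Local Open Scope nat_scope.

(** Bases of O_0, P and U, ordered by degree: tau, tau^-1 for O_0, then (12), (23), (13) for P, and
    e twice for U. The first entries of [o_vecs] and [p_vecs] are o_0 and p. *)
Definition o_vecs : seq vec :=
  [:: [:: (4, 1%R); (8, 1%R); (18, 1%R)]; [:: (5, 1%R); (6, 1%R); (19, 1%R)]].
Definition p_vecs : seq vec :=
  [:: [:: (10, 1%R); (14, 2%R); (23, 1%R); (25, 2%R)];
      [:: (11, (-2)%R); (12, (-1)%R); (21, (-2)%R); (26, (-1)%R)];
      [:: (9, 1%R); (13, (-1)%R); (22, 1%R); (24, (-1)%R)]].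
(** An integral basis of U; in it u has coordinates zeta^2 and 1. *)
Definition u_vecs : seq vec := [:: [:: (17, 1%R); (28, 1%R)]; [:: (17, 1%R); (30, 1%R)]].
Definition opu_vecs : seq vec := o_vecs ++ p_vecs ++ u_vecs.

(* Twice the coordinate forms of the basis [opu_vecs] of OPU / S. *)
Definition opu_funs : seq vec :=
  [:: [:: (18, 2%R)]; [:: (6, 2%R)]; [:: (25, 1%R)]; [:: (21, (-1)%R)];
      [:: (9, 1%R); (24, (-1)%R)]; [:: (28, 2%R)]; [:: (30, 2%R)]].

(** Degrees separate the vectors of O_0 and P, so one projection delta_h suffices before going down
    by y. The two vectors of U share degree e and are separated by a combination of two words,
    whence the coefficient 3. *)
Definition opu_down : seq dpoly :=
  [:: [:: (1%R, [:: GD 4])]; [:: (1%R, [:: GG 1; GD 5])];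
      [:: (1%R, [:: GG 1; GY 2; GD 1])]; [:: (1%R, [:: GY 1; GD 2])];
      [:: (1%R, [:: GG 1; GY 1; GD 3])];
      [:: (2%R, [:: GG 1; GY 2; GY 1; GD 0]); ((-1)%R, [:: GY 1; GY 2; GD 0])];
      [:: (2%R, [:: GY 1; GY 2; GD 0]); ((-1)%R, [:: GG 1; GY 2; GY 1; GD 0])]].
Definition opu_down_coef : seq int := [:: 1; 1; 2; -2; 2; 3; 3]%R.

(** One letter x leads from O_0 to P and two lead to U. Modulo S, the vectors of P are obtained with
    coefficient -1/2, which the common factor 2 clears. *)
Definition opu_up : seq (seq dcode) :=
  [:: [::]; [:: GG 1]; [:: GG 3; GX 1]; [:: GX 1]; [:: GG 1; GX 1]; [:: GX 1; GX 3];
      [:: GG 3; GX 1; GX 3]].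
Definition opu_up_coef : seq int := [:: 2; 2; -1; -1; -1; -2; -2]%R.
End QuotientData.

Lemma opu_stable : stable_table in_socle opu_vecs opu_funs 2.
Proof. by vm_compute. Qed.

Lemma opu_downP : down_table in_socle opu_vecs opu_down opu_down_coef (nth [::] o_vecs 0).
Proof. by vm_compute. Qed.

Lemma o_downP : down_table in_socle o_vecs opu_down opu_down_coef (nth [::] o_vecs 0).
Proof. by vm_compute. Qed.

Lemma opu_upP : up_table in_socle opu_vecs opu_up 2 opu_up_coef (nth [::] o_vecs 0).
Proof. by vm_compute. Qed.

Section SocleQuotient.
Variables (k : fieldType) (char0 : [pchar k] =i pred0).
Local Notation D := (dalg k).
Local Notation W := (verma (Msigma_minus k)).
Local Notation b := (bW k).
Local Notation Q := (quotmod (socmod W)).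

Definition bQ (j : nat) : Q := pimod (socmod W) (b j).

Lemma ev_bQ v : ev bQ v = pimod (socmod W) (ev b v).
Proof. by rewrite /ev raddf_sum; apply: eq_bigr => p _; rewrite raddfMz. Qed.

Lemma bQ_table : table_basis bQ.
Proof.
split=> [j le_j|d v okd]; first by rewrite /bQ bW_out // linear0.
by rewrite !ev_bQ -pimodZ; congr (pimod _ _); case: (bW_table k) => _ ->.
Qed.

Lemma pimod_socle_eq0 w : pimod (socmod W) w = 0 <-> socmod W w.
Proof.
rewrite -(pimod0 (socmod W)); split => [/pimod_eq | Sw].
  by rewrite subr0 gen_submodule_id //; apply: gen_submoduleP.
by apply/pimod_eq; rewrite subr0; apply: sub_gen_submodule.
Qed.

Lemma in_socleP v : in_socle v -> ev bQ v = 0.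
Proof.
move=> /(ev_eqv (@bW_out k)) e; rewrite ev_bQ; apply/pimod_socle_eq0.
rewrite (socmodE char0) e; exact: evspan_combv.
Qed.

Lemma o_vec_neq0 : ev bQ (nth [::] o_vecs 0) <> 0.
Proof.
rewrite ev_bQ => /pimod_socle_eq0; rewrite (socmodE char0) => -[c e].
(* 18 = 3 * 6 + 0 is the term x_(13) |12> of o_0; it occurs in no vector of the socle. *)
have: coordW (ev b (nth [::] o_vecs 0)) 18 = 0.
  rewrite e; elim/big_rec: _ => [|i x _ x0]; first by rewrite /coordW linear0 mxE.
  rewrite coordW_lin x0 addr0 coordW_ev //.
  have -> : coefv (nth [::] socle_vecs i) 18 = 0; last by rewrite mulr0.
  have chk : all (fun i => coefv (nth [::] socle_vecs i) 18 == 0) (iota 0 10) by vm_compute.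
  exact/eqP/(all_iotaP chk (ltn_ord i)).
by move=> /eqP; rewrite coordW_ev // oner_eq0.
Qed.

Lemma opu_submodule : submodule (evspan bQ opu_vecs).
Proof. exact: (evspan_submodule char0 bQ_table in_socleP _ opu_stable). Qed.

Lemma opu_simple : simple_submodule (evspan bQ opu_vecs).
Proof.
have t0 := o_vec_neq0.
have Qt : evspan bQ opu_vecs (ev bQ (nth [::] o_vecs 0)) by exact: (@evspan_mem _ _ _ opu_vecs 0).
split=> [||N sN NQ]; [exact: opu_submodule | by move=> Q0; apply: t0; rewrite Q0 in Qt |].
have [->|N0] := pselect (N = [set 0]); [by left | right].
have [w Nw w0] := nonzero_mem sN N0.
apply/seteqP; split=> //; apply: (up_table_mem char0 bQ_table in_socleP opu_upP sN).
exact: (down_table_mem char0 bQ_table in_socleP opu_downP sN (NQ w Nw) Nw w0).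
Qed.

End SocleQuotient.

(** * The D(S_3)-submodules O_0, P and U *)

Section DS3Span.
Variables (k : fieldType) (char0 : [pchar k] =i pred0).
Local Notation D := (dalg k).
Variables (X : lmodType D) (b : nat -> X) (bT : table_basis b).
Variables (null : vec -> bool) (nullP : forall v, null v -> ev b v = 0).

Definition ds3_stable vs fs : bool :=
  all6 (fun m => stable_under null vs fs 1 (GG m) && stable_under null vs fs 1 (GD m)).

Lemma evspan_ds3 vs fs : ds3_stable vs fs -> ds3_submodule (evspan b vs).
Proof.
move=> chk.
have gen c : ok_dcode c -> stable_under null vs fs 1 c ->
    forall u, evspan b vs u -> evspan b vs (dcode_elt k c *: u).
  by move=> okc chkc; apply: (maps_underP char0 bT nullP _ okc chkc).
split=> [||g u|h u]; [exact: evspan0 | exact: evspan_lin | | ].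
- by have [m ltm ->] := s3_eltP g; have /andP[chkg _] := all6P chk ltm; apply: (gen (GG m)).
- by have [m ltm ->] := s3_eltP h; have /andP[_ chkd] := all6P chk ltm; apply: (gen (GD m)).
Qed.
End DS3Span.

(** With y = zeta^2 and z = zeta, this rewrites the three terms of the vector u in the integral
    basis [u_vecs]. *)
Lemma sum_zero_combination (R : pzRingType) (V : lmodType R) (y z : R) (u v w : V) :
  y + z + 1 = 0 -> (- y) *: (- u) + z *: (- v) + w = y *: (v + u) + (v + w).
Proof.
move=> e; have {}e : z = - y - 1.
  by apply/eqP; rewrite -subr_eq0 opprD !opprK addrA [z + y]addrC e.
rewrite e scaleNr !scalerN opprK -scaleNr opprD !opprK scalerDl scale1r scalerDr.
by rewrite !addrA [_ *: u + _]addrC.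
Qed.

Section OPUSets.
Variables (k : fieldType) (char0 : [pchar k] =i pred0) (zeta : k).
Hypothesis zeta_prim : 3.-primitive_root zeta.
Local Notation D := (dalg k).
Local Notation W := (verma (Msigma_minus k)).
Local Notation b := (bW k).

Lemma ketE (i : 'I_3) : ket (M := Msigma_minus k) i = b i.
Proof.
rewrite /bW divn_small ?ltn_ord // modn_small ?ltn_ord //.
by rewrite /xword /= big_nil scale1r inord_val.
Qed.

Lemma zeta_sum : zeta ^+ 2 + zeta + 1 = 0.
Proof.
have z3 := prim_expr_order zeta_prim.
have z1 : zeta - 1 != 0.
  rewrite subr_eq0; apply/eqP => z1.
  by have := eq_prim_root_expr zeta_prim 1 0; rewrite z1 expr1n eqxx.
apply: (mulfI z1); rewrite mulr0; have := subrX1 zeta 3.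
rewrite z3 subrr !big_ord_recr big_ord0 /= expr0 add0r => /esym e.
by rewrite -[RHS]e addrC addrA addrAC addrC addrA.
Qed.

Lemma zetaV : zeta^-1 = zeta ^+ 2.
Proof.
have z3 := prim_expr_order zeta_prim.
have z0 : zeta != 0 by apply: contra_eq_neq z3 => ->; rewrite expr0n eq_sym oner_eq0.
by apply: (mulfI z0); rewrite mulfV // -exprS z3.
Qed.

Lemma Dx_word ws j v : all ok_dcode (map GX ws) -> eqv 36 (act_word (map GX ws) [:: (j, 1)]) v ->
  (\prod_(t <- ws) Dx k (s3_elt t)) *: b j = ev b v.
Proof.
move=> okw e; rewrite -(ev1 b j) -(table_act (bW_table k) okw e) /word_elt.
by rewrite big_map.
Qed.

Lemma Dx1_act t j v : (0 < t < 4)%N -> eqv 36 (act_word [:: GX t] [:: (j, 1)]) v ->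
  Dx k (s3_elt t) *: b j = ev b v.
Proof.
by move=> tr e; have := @Dx_word [:: t] j v; rewrite /= tr big_seq1; apply.
Qed.

Lemma Dx2_act t1 t2 j v : (0 < t1 < 4)%N -> (0 < t2 < 4)%N ->
  eqv 36 (act_word [:: GX t1; GX t2] [:: (j, 1)]) v ->
  (Dx k (s3_elt t1) * Dx k (s3_elt t2)) *: b j = ev b v.
Proof.
move=> r1 r2 e; have := @Dx_word [:: t1; t2] j v.
by rewrite /= r1 r2 big_cons big_seq1; apply.
Qed.

Lemma Dx3_act t1 t2 t3 j v : (0 < t1 < 4)%N -> (0 < t2 < 4)%N -> (0 < t3 < 4)%N ->
  eqv 36 (act_word [:: GX t1; GX t2; GX t3] [:: (j, 1)]) v ->
  (Dx k (s3_elt t1) * Dx k (s3_elt t2) * Dx k (s3_elt t3)) *: b j = ev b v.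
Proof.
move=> r1 r2 r3 e; have := @Dx_word [:: t1; t2; t3] j v.
by rewrite /= r1 r2 r3 !big_cons big_nil mulr1 mulrA; apply.
Qed.

Lemma o0_vecE : o0_vec k = ev b (nth [::] o_vecs 0).
Proof.
rewrite /o0_vec !ketE /=.
have e1 := @Dx1_act 3 0 [:: (18, 1)] isT isT.
have e2 := @Dx1_act 1 1 [:: (4, 1)] isT isT.
have e3 := @Dx1_act 2 2 [:: (8, 1)] isT isT.
apply: (etrans (congr2 _ (congr2 _ e1 e2) e3)).
by rewrite -!ev_cat; apply: (ev_eqv (@bW_out k)); vm_compute.
Qed.

Lemma p_vecE : p_vec k = ev b (nth [::] p_vecs 0).
Proof.
rewrite /p_vec !ketE /=.
have e1 := @Dx2_act 3 1 1 [:: (10, -1); (25, -1)] isT isT isT.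
have e2 := @Dx2_act 1 2 1 [:: (10, 1)] isT isT isT.
have e3 := @Dx2_act 3 2 2 [:: (14, -1); (23, -1)] isT isT isT.
have e4 := @Dx2_act 1 3 2 [:: (23, 1)] isT isT isT.
have act2 (p q : D) (w : W) u v : p *: w = ev b u -> q *: w = ev b v ->
    (2%:R *: p + q) *: w = ev b (scalev 2 u ++ v).
  by move=> pw qw; rewrite scalerDl (scalE 2%:R p) -scalerA pw qw ev_cat ev_scal.
apply: (etrans (congr2 (fun u v => - u - v) (act2 _ _ _ _ _ e1 e2) (act2 _ _ _ _ _ e3 e4))).
rewrite -[- ev b _]sub0r -(ev_nil b) -!ev_subv.
by apply: (ev_eqv (@bW_out k)); vm_compute.
Qed.

Lemma u_vecE : u_vec zeta =
  scal (zeta ^+ 2) *: ev b (nth [::] u_vecs 0) + ev b (nth [::] u_vecs 1).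
Proof.
rewrite /u_vec !ketE /=.
have e1 := @Dx3_act 1 3 1 1 [:: (28, -1)] isT isT isT isT.
have e2 := @Dx3_act 1 3 2 2 [:: (17, -1)] isT isT isT isT.
have e3 := @Dx3_act 3 1 2 0 [:: (30, 1)] isT isT isT isT.
have n j : ev b [:: (j, -1)] = - b j by rewrite /ev big_seq1 mulrN1z.
have s i j : ev b [:: (i, 1); (j, 1)] = b i + b j by rewrite ev_cons ev1 mulr1z.
have actZ c (p : D) (w u : W) : p *: w = u -> (c *: p) *: w = scal c *: u.
  by move=> pw; rewrite (scalE c p) -scalerA pw.
apply: (etrans (congr2 +%R (congr2 +%R (actZ _ _ _ _ (etrans e1 (n 28)))
  (actZ _ _ _ _ (etrans e2 (n 17)))) (etrans e3 (ev1 b 30)))).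
rewrite zetaV scalN (s 17 28) (s 17 30); apply: sum_zero_combination.
by rewrite -scal1 -!scalD zeta_sum scal0.
Qed.

End OPUSets.

Section Combinations.
Variables (k : fieldType) (X : lmodType (dalg k)) (b : nat -> X).

Definition evcomb (vs : seq vec) (c : nat -> k) : X :=
  \sum_(i < size vs) scal (c i) *: ev b (nth [::] vs i).

Lemma evspanP vs w : evspan b vs w <-> exists c, w = evcomb vs c.
Proof. by []. Qed.

Lemma evcomb_cat s t c :
  evcomb (s ++ t) c = evcomb s c + evcomb t (fun i => c (size s + i)%N).
Proof.
have F u (a : nat -> k) : evcomb u a = \sum_(0 <= i < size u) scal (a i) *: ev b (nth [::] u i).
  by rewrite big_mkord.
rewrite !F size_cat (big_cat_nat (n := size s)) ?leq_addr //=; congr (_ + _).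
  by apply: eq_big_nat => i /andP[_ lt_i]; rewrite nth_cat lt_i.
rewrite -{1}[size s]add0n big_addn addKn; apply: eq_big_nat => i _.
by rewrite nth_cat ltnNge leq_addl /= addnK addnC.
Qed.

Lemma eq_evcomb vs c d : (forall i, (i < size vs)%N -> c i = d i) -> evcomb vs c = evcomb vs d.
Proof. by move=> cd; apply: eq_bigr => i _; rewrite (cd i (ltn_ord i)). Qed.

Definition glue (n : nat) (c d : nat -> k) (i : nat) : k := if (i < n)%N then c i else d (i - n)%N.

Lemma evcomb_glue s t c d :
  evcomb (s ++ t) (glue (size s) c d) = evcomb s c + evcomb t d.
Proof.
rewrite evcomb_cat; apply: (congr2 +%R); apply: eq_evcomb => i lt_i.
  by rewrite /glue lt_i.
by rewrite /glue ltnNge leq_addr addKn.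
Qed.

Lemma evcomb0 vs c : (forall i, (i < size vs)%N -> c i = 0) -> evcomb vs c = 0.
Proof. by move=> c0; apply: big1 => i _; rewrite c0 // scal0 scale0r. Qed.

Lemma evspan_ds3_min vs (A : set X) : ds3_submodule A ->
  (forall i, (i < size vs)%N -> A (ev b (nth [::] vs i))) -> evspan b vs `<=` A.
Proof.
move=> [A0 Al _ _] Avs w [c ->]; elim/big_rec: _ => [|i x _ Ax] //.
by apply: Al => //; apply: Avs.
Qed.

End Combinations.

Lemma sum_zero_difference (R : pzRingType) (V : lmodType R) (y z : R) (u v : V) :
  y + z + 1 = 0 -> (y *: u + v) - (y *: - u + (v - u)) = (y - z) *: u.
Proof.
move=> e; have -> : z = - y - 1.
  by apply/eqP; rewrite -subr_eq0 opprD !opprK addrA [z + y]addrC e.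
rewrite !opprD !opprK !scalerDl scale1r scalerN opprK.
by rewrite addrACA [- v + u]addrC [v + _]addrC subrK addrA.
Qed.

Section OPUSpan.
Variables (k : fieldType) (char0 : [pchar k] =i pred0) (zeta : k).
Hypothesis zeta_prim : 3.-primitive_root zeta.
Local Notation D := (dalg k).
Local Notation W := (verma (Msigma_minus k)).
Local Notation b := (bW k).
Local Notation bQ := (bQ k).

Lemma ds3_genE (w : W) vs fs : ds3_stable is_zero vs fs -> evspan b vs w ->
  (forall A, ds3_submodule A -> A w -> forall i, (i < size vs)%N -> A (ev b (nth [::] vs i))) ->
  ds3_gen w = evspan b vs.
Proof.
move=> chk Sw gen; have sub := evspan_ds3 char0 (bW_table k) (@is_zeroP k) chk.
apply/seteqP; split=> [v | v Sv A sA Aw]; first by apply.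
exact: (evspan_ds3_min sA (gen A sA Aw) Sv).
Qed.

Lemma O0_subE : @O0_sub k = evspan b o_vecs.
Proof.
have chk : ds3_stable is_zero o_vecs [:: [:: (4, 1)]; [:: (5, 1)]] by vm_compute.
apply: (ds3_genE chk); first by rewrite o0_vecE; exact: (@evspan_mem _ _ _ o_vecs 0).
rewrite o0_vecE => A [_ _ Ag _] Aw [|[|i]] lt_i; [exact: Aw | | by []].
have e : eqv 36 (lin 36 (opG 1) (nth [::] o_vecs 0)) (nth [::] o_vecs 1) by vm_compute.
rewrite -(table_act1 (c := GG 1) (bW_table k) isT e); exact: Ag.
Qed.

Lemma P_subE : @P_sub k = evspan b p_vecs.
Proof.
have chk : ds3_stable is_zero p_vecs [:: [:: (10, 1)]; [:: (12, -1)]; [:: (9, 1)]] by vm_compute.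
apply: (ds3_genE chk); first by rewrite p_vecE; exact: (@evspan_mem _ _ _ p_vecs 0).
rewrite p_vecE => A [_ _ Ag _] Aw [|[|[|i]]] lt_i; [exact: Aw | | | by []].
  have e : eqv 36 (lin 36 (opG 3) (nth [::] p_vecs 0)) (nth [::] p_vecs 1) by vm_compute.
  rewrite -(table_act1 (c := GG 3) (bW_table k) isT e); exact: Ag.
have e : eqv 36 (lin 36 (opG 2) (nth [::] p_vecs 0)) (nth [::] p_vecs 2) by vm_compute.
rewrite -(table_act1 (c := GG 2) (bW_table k) isT e); exact: Ag.
Qed.

Lemma U_subE : U_sub zeta = evspan b u_vecs.
Proof.
have chk : ds3_stable is_zero u_vecs [:: [:: (28, 1)]; [:: (30, 1)]] by vm_compute.
have uE := u_vecE zeta_prim.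
set u0 := ev b (nth [::] u_vecs 0) in uE; set u1 := ev b (nth [::] u_vecs 1) in uE.
apply: (ds3_genE chk).
  rewrite uE; apply: evspan_lin; first exact: (@evspan_mem _ _ _ u_vecs 0).
  exact: (@evspan_mem _ _ _ u_vecs 1).
move=> A [A0 Al Ag _] Au.
have g0 : Dg k (s3_elt 1) *: u0 = - u0.
  have e : eqv 36 (lin 36 (opG 1) (nth [::] u_vecs 0)) (subv [::] (nth [::] u_vecs 0)) by vm_compute.
  by rewrite /u0 (table_act1 (c := GG 1) (bW_table k) isT e) ev_subv ev_nil sub0r.
have g1 : Dg k (s3_elt 1) *: u1 = u1 - u0.
  have e : eqv 36 (lin 36 (opG 1) (nth [::] u_vecs 1))
    (subv (nth [::] u_vecs 1) (nth [::] u_vecs 0)) by vm_compute.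
  by rewrite /u1 (table_act1 (c := GG 1) (bW_table k) isT e) ev_subv.
have AB u v : A u -> A v -> A (u - v).
  by move=> Au1 Av; rewrite addrC -scaleN1r -scal1 -scalN; apply: Al.
have AZ c u : A u -> A (scal c *: u) by move=> Au1; rewrite -[_ *: _]addr0; apply: Al.
(* U is generated by u because u - (12) u = (zeta^2 - zeta) u0 with a nonzero factor; subtracting a
   multiple of u0 from u then leaves u1. *)
have Au0 : A u0.
  have := AB _ _ Au (Ag (s3_elt 1) _ Au).
  have -> : u_vec zeta - Dg k (s3_elt 1) *: u_vec zeta = scal (zeta ^+ 2 - zeta) *: u0.
    rewrite uE (scal_lin _ (Dg k (s3_elt 1))) g0 g1 scalD scalN; apply: sum_zero_difference.
    by rewrite -scal1 -!scalD (zeta_sum zeta_prim) scal0.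
  have z0 : zeta ^+ 2 - zeta != 0.
    rewrite subr_eq0 -{2}[zeta]expr1 (eq_prim_root_expr zeta_prim).
    by [].
  by move/(AZ (zeta ^+ 2 - zeta)^-1); rewrite scalerA -scalM (mulVf z0) scal1 scale1r.
have Au1 : A u1.
  by have := AB _ _ Au (AZ (zeta ^+ 2) _ Au0); rewrite uE addrC addKr.
by case=> [|[|i]] lt_i; [exact: Au0 | exact: Au1 | ].
Qed.

End OPUSpan.

Lemma addr_rev3 (V : zmodType) (u p o : V) : o + (p + u) = u + p + o.
Proof. by rewrite addrC [p + u]addrC. Qed.

Lemma addr4K (V : zmodType) (s u p o : V) : s + u + p + o - (o + (p + u)) = s.
Proof. by rewrite addr_rev3 -[s + u + p]addrA -[s + _ + o]addrA addrK. Qed.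

Lemma subr4K (V : zmodType) (w u p o : V) : w - (o + (p + u)) + u + p + o = w.
Proof. by rewrite addr_rev3 -[_ - _ + u + p]addrA -[_ - _ + _ + o]addrA subrK. Qed.

Section OPUTheory.
Variables (k : fieldType) (char0 : [pchar k] =i pred0) (zeta : k).
Hypothesis zeta_prim : 3.-primitive_root zeta.
Local Notation D := (dalg k).
Local Notation W := (verma (Msigma_minus k)).
Local Notation S := (socmod W).
Local Notation b := (bW k).
Local Notation bQ := (bQ k).
Local Notation o0 := (nth [::] o_vecs 0).

Lemma evcomb_bQ vs c : evcomb bQ vs c = pimod S (evcomb b vs c).
Proof.
rewrite /evcomb (big_morph _ (@pimodD _ _ S) (pimod0 S)); apply: eq_bigr => i _.
by rewrite ev_bQ pimodZ.
Qed.

Lemma opu_evcomb (co cp cu : nat -> k) :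
  evcomb b o_vecs co + (evcomb b p_vecs cp + evcomb b u_vecs cu) =
  evcomb b opu_vecs (glue 2 co (glue 3 cp cu)).
Proof. by rewrite /opu_vecs (evcomb_glue b o_vecs) (evcomb_glue b p_vecs). Qed.

(** OPU is the full preimage of a seven-dimensional subspace of M(sigma, -) / S, so its properties
    can be read off in the quotient. *)
Lemma OPUP w : OPU zeta w <-> evspan bQ opu_vecs (pimod S w).
Proof.
split=> [[s [u [p [o [Ss Uu Pp Oo ->]]]]] | /evspanP[c wc]].
  rewrite (U_subE char0 zeta_prim) in Uu; rewrite (P_subE char0) in Pp.
  rewrite (O0_subE char0) in Oo.
  have /evspanP[cu uE] := Uu; have /evspanP[cp pE] := Pp; have /evspanP[co oE] := Oo.
    apply/evspanP; exists (glue 2 co (glue 3 cp cu)).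
  rewrite evcomb_bQ -opu_evcomb uE pE oE.
  by apply/pimod_eq; rewrite addr4K; apply: sub_gen_submodule.
pose cp i := c (2 + i)%N; pose cu i := cp (3 + i)%N.
have vE : evcomb b opu_vecs c = evcomb b o_vecs c + (evcomb b p_vecs cp + evcomb b u_vecs cu).
  by rewrite /opu_vecs (evcomb_cat b o_vecs) (evcomb_cat b p_vecs).
exists (w - evcomb b opu_vecs c), (evcomb b u_vecs cu), (evcomb b p_vecs cp), (evcomb b o_vecs c).
rewrite (U_subE char0 zeta_prim) (P_subE char0) (O0_subE char0); split.
- apply/pimod_socle_eq0; rewrite linearB /= wc -evcomb_bQ; exact: subrr.
- by exists cu.
- by exists cp.
- by exists c.
by rewrite vE subr4K.
Qed.

Lemma submodule_OPU : submodule (OPU zeta).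
Proof.
have sQ := opu_submodule char0; case: (sQ) => Q0 Ql.
split=> [|a u v /OPUP Qu /OPUP Qv]; apply/OPUP; first by rewrite linear0.
by rewrite linearP; apply: Ql.
Qed.

Lemma opu_inj c : evcomb bQ opu_vecs c = 0 -> forall i, (i < 7)%N -> c i = 0.
Proof. exact: (down_table_inj char0 (bQ_table k) (in_socleP char0) opu_downP (o_vec_neq0 char0)). Qed.

Lemma OPU_directP : OPU_direct zeta.
Proof.
move=> s u p o Ss Uu Pp Oo w0.
rewrite (U_subE char0 zeta_prim) in Uu; rewrite (P_subE char0) in Pp.
rewrite (O0_subE char0) in Oo.
have /evspanP[cu uE] := Uu; have /evspanP[cp pE] := Pp; have /evspanP[co oE] := Oo.
(* Modulo S the term s disappears, and the seven vectors stay independent there. *)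
have c0 : forall i, (i < 7)%N -> glue 2 co (glue 3 cp cu) i = 0.
  apply: opu_inj; rewrite evcomb_bQ -opu_evcomb -uE -pE -oE.
  have -> : o + (p + u) = - s.
    by apply/eqP; rewrite -addr_eq0 addr_rev3 addrC !addrA w0.
  by rewrite linearN /= (_ : pimod S s = 0) ?oppr0 //; apply/pimod_socle_eq0.
have u0 : u = 0.
  rewrite uE; apply: evcomb0 => -[|[|i]] lt_i; [exact: (c0 5%N) | exact: (c0 6%N) | by []].
have p0 : p = 0.
  by rewrite pE; apply: evcomb0 => -[|[|[|i]]] lt_i;
    [exact: (c0 2%N) | exact: (c0 3%N) | exact: (c0 4%N) | ].
have o0 : o = 0.
  by rewrite oE; apply: evcomb0 => -[|[|i]] lt_i; [exact: (c0 0%N) | exact: (c0 1%N) | ].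
by move: w0; rewrite u0 p0 o0 !addr0.
Qed.

Lemma OPU_mod_SE : OPU_mod_S zeta = evspan bQ opu_vecs.
Proof.
apply/seteqP; split=> [q [w /OPUP Qw <-] // | q Qq].
by have [w qw] := pimod_surj q; exists w; [apply/OPUP; rewrite -qw | rewrite qw].
Qed.

Lemma simple_OPU_mod_S : simple_submodule (OPU_mod_S zeta).
Proof. by rewrite OPU_mod_SE; apply: opu_simple. Qed.

Definition tau_to_opu (v : 'rV[k]_(ds3_dim (Mtau0 k))) : quotmod S :=
  \sum_i scal (v 0 i) *: ev bQ (nth [::] o_vecs i).

Lemma tau_to_opu_hom : ds3_hom tau_to_opu.
Proof.
have chk : class_table o_vecs [:: 4; 5]%N (fun=> 1) 2 by vm_compute.
apply: (@class_hom_table k _ 2 tau_deg (fun=> 1) tau_deg_inj tau_deg_stable _ _ bQ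
  (bQ_table k) o_vecs [:: 4; 5]%N (fun=> 1) _ _ chk); last by [].
by case=> [[|[|i]]].
Qed.

(** The tables show that the y_t kill O_0 already in M(sigma, -), before passing to the quotient. *)
Lemma tau_to_opu_y t v : Dy k t *: tau_to_opu v = 0.
Proof.
rewrite /tau_to_opu scaler_sumr; apply: big1 => i _.
rewrite scal_swap (Dy_ev_eq0 (bQ_table k)) ?scaler0 //.
by case: i => [[|[|]]].
Qed.

End OPUTheory.

(** * The Verma module of weight (tau, 0) *)

Lemma sum_ord_recl (V : nmodType) (n : nat) (F : nat -> V) :
  \sum_(m < n.+1) F m = F 0%N + \sum_(1 <= m < n.+1) F m.
Proof. by rewrite -(big_mkord xpredT F) big_nat_recl // big_add1. Qed.

Section VermaNakayama.
Variables (k : fieldType) (M : ds3_module k).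
Local Notation D := (dalg k).
Local Notation V := (verma M).
Local Notation xw := (xword (Dxi k)).
Local Notation xlen m := (size (nth [::] xwords m)).

(** The subspace generated by words of length at least j acting on arbitrary elements of V, not
    merely on M; this allows substitution in the nilpotency argument. *)
Definition xdeep (j : nat) (z : V) : Prop :=
  exists w : nat -> V, z = \sum_(m < 12 | (j <= xlen m)%N) xw m *: w m.

Lemma xdeep0 j : xdeep j 0.
Proof. by exists (fun=> 0); rewrite big1 // => m _; apply: scaler0. Qed.

Lemma xdeepD j u v : xdeep j u -> xdeep j v -> xdeep j (u + v).
Proof.
move=> [f ->] [g ->]; exists (fun m => f m + g m); rewrite -big_split.
by apply: eq_bigr => m _; rewrite scalerDr.
Qed.

Lemma xdeep_xw j m v : (m < 12)%N -> (j <= xlen m)%N -> xdeep j (xw m *: v).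
Proof.
move=> lt_m le_j; exists (fun n => if n == m then v else 0).
rewrite (bigD1 (Ordinal lt_m)) //= eqxx big1 ?addr0 // => n /andP[_].
by rewrite -val_eqE /= => /negPf ->; rewrite scaler0.
Qed.

Lemma xdeep_le i j z : (i <= j)%N -> xdeep j z -> xdeep i z.
Proof.
move=> le_ij [w ->]; elim/big_ind: _ => [||m le_j]; [exact: xdeep0 | exact: xdeepD | ].
by apply: xdeep_xw (leq_trans le_ij le_j).
Qed.

(** The relations are homogeneous, so normalising x_t times a word never shortens it; the table
    [xmul] is checked for this. *)
Lemma xdeep_Dx t j z : (0 < t < 4)%N -> xdeep j z -> xdeep j.+1 (Dxi k t *: z).
Proof.
move=> tr [w ->]; rewrite scaler_sumr.
elim/big_ind: _ => [||m le_j]; [exact: xdeep0 | exact: xdeepD | ].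
have sqr n : (0 < n < 4)%N -> Dxi k n * Dxi k n = 0 by apply: Dxi_sqr.
rewrite scalerA.
rewrite (xmulE (sqr 1 isT) (sqr 2 isT) (sqr 3 isT) (Dxi_acbacb k) (Dxi_cabcab k)) //.
have chk : all (fun t => all (fun m => all (fun p => (p.1 < 12) && (xlen m < xlen p.1))%N
    (xmul t m)) (iota 0 12)) (iota 0 4) by vm_compute.
have lt_t : (t < 4)%N by case/andP: tr.
have /allP := all_iotaP (all_iotaP chk lt_t) (ltn_ord m).
rewrite scaler_suml; elim: (xmul t m) => [|p r IH] chk_r; first by rewrite big_nil; apply: xdeep0.
rewrite big_cons; apply: xdeepD; last by apply: IH => q qr; apply: chk_r; rewrite inE qr orbT.
have /andP[lt_p len_p] := chk_r p (mem_head _ _).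
rewrite -scalerMzl scalerMzr; apply: xdeep_xw => //.
exact: leq_ltn_trans le_j len_p.
Qed.

Lemma xdeep_mul m j z : (m < 12)%N -> xdeep j z -> xdeep (xlen m + j) (xw m *: z).
Proof.
move=> lt_m zj; rewrite /xword lt_m.
have: all (fun t => 0 < t < 4)%N (nth [::] xwords m).
  by have /all_nthP := erefl (all (all (fun t => 0 < t < 4)%N) xwords); apply.
elim: (nth [::] xwords m) => [_|t s IH /= /andP[tr sr]]; first by rewrite big_nil scale1r.
by rewrite big_cons -scalerA addSn; apply: xdeep_Dx => //; apply: IH.
Qed.

Lemma xdeep5 z : xdeep 5 z -> z = 0.
Proof.
move=> [w ->]; apply: big_pred0 => m; apply/negP/negP; rewrite -ltnNge.
have chk : all (fun m => xlen m < 5)%N (iota 0 12) by vm_compute.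
exact: all_iotaP chk (ltn_ord m).
Qed.

Lemma xdeep1_split w : exists v z, xdeep 1 z /\ w = vtensor v + z.
Proof.
have [c ->] := verma_span w; exists (c 0%N), (\sum_(1 <= m < 12) xw m *: vtensor (c m)).
split.
  rewrite big_nat; elim/big_ind: _ => [||m /andP[m_gt0 m_lt]].
  - exact: xdeep0.
  - exact: xdeepD.
  apply: xdeep_xw => //; move: m_gt0 m_lt.
  have chk : all (fun m => (0 < m) ==> (1 <= xlen m))%N (iota 0 12) by vm_compute.
  by move=> m0 /(all_iotaP chk); rewrite m0.
have xw0 : xw 0 = 1 by rewrite /xword /= big_nil.
by rewrite -[vtensor (c 0%N)]scale1r -xw0; exact: (sum_ord_recl 11 (fun m => xw m *: vtensor (c m))).
Qed.

(* Nakayama's lemma: the augmentation ideal of B(V) is nilpotent. *)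
Lemma verma_nakayama (N : set V) : submodule N ->
  (forall v, exists n z, [/\ N n, xdeep 1 z & vtensor v = n + z]) -> forall w, N w.
Proof.
move=> sN gen; pose dec j w := exists n z, [/\ N n, xdeep j z & w = n + z].
have decD j u v : dec j u -> dec j v -> dec j (u + v).
  move=> [m [x [Nm xj ->]]] [n [y [Nn yj ->]]]; exists (m + n), (x + y).
  by split; [exact: submoduleD | exact: xdeepD | rewrite addrACA].
have dec_deep j z : xdeep j z -> dec j z.
  by move=> zj; exists 0, z; split; rewrite ?add0r //; case: sN.
have dec_N j n : N n -> dec j n.
  by move=> Nn; exists n, 0; split; rewrite ?addr0 //; exact: xdeep0.
have dec1 w : dec 1%N w.
  have [v [z [z1 ->]]] := xdeep1_split w.
  by apply: decD; [exact: gen | exact: dec_deep].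
(* In w = n + z with z of depth 1, each vector to which a word of z is applied is itself split at
   depth j; the words raise its deep part to depth j + 1, and N absorbs the rest. *)
have decS j : (forall w, dec j w) -> forall w, dec j.+1 w.
  move=> IH w; have [n [z [Nn [f ->] ->]]] := dec1 w; apply: (decD j.+1); first exact: (dec_N j.+1).
  elim/big_ind: _ => [||m len_m]; [exact: (dec_deep j.+1 _ (xdeep0 _)) | exact: (decD j.+1) | ].
  have [n' [z' [Nn' zj ->]]] := IH (f m); rewrite scalerDr; apply: (decD j.+1).
    by apply: (dec_N j.+1); apply: submoduleZ.
  apply: (dec_deep j.+1); apply: xdeep_le (xdeep_mul (ltn_ord m) zj).
  by rewrite -add1n leq_add2r.
(* Four steps lead from depth 1 to depth 5, beyond the top degree 4 of B(V). *)
move=> w; have [n [z [Nn /xdeep5 -> ->]]] := decS _ (decS _ (decS _ (decS _ dec1))) w.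
by rewrite addr0.
Qed.

End VermaNakayama.

Lemma ds3_hom_inj (k : fieldType) (M : ds3_module k) (W : lmodType (dalg k))
    (f : 'rV[k]_(ds3_dim M) -> W) :
  ds3_hom f -> (forall v, f v = 0 -> v = 0) -> injective f.
Proof.
move=> [f_lin _ _] f0 u v uv; apply/eqP; rewrite eq_sym -subr_eq0; apply/eqP; apply: f0.
by rewrite addrC -scaleN1r f_lin uv scalN scal1 scaleN1r addNr.
Qed.

Section TauVerma.
Variables (k : fieldType) (char0 : [pchar k] =i pred0).
Local Notation D := (dalg k).
Local Notation W := (verma (Msigma_minus k)).
Local Notation S := (socmod W).
Local Notation bQ := (bQ k).
Local Notation V := (verma (Mtau0 k)).
Local Notation OQ := (evspan bQ opu_vecs).

Definition row_coord n (v : 'rV[k]_n) (i : nat) : k := oapp (v 0) 0 (insub i).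

Lemma row_coordE n (v : 'rV[k]_n) (i : 'I_n) : row_coord v i = v 0 i.
Proof. by rewrite /row_coord valK. Qed.

Lemma row_coord_eq0 n (v : 'rV[k]_n) : (forall i, (i < n)%N -> row_coord v i = 0) -> v = 0.
Proof. by move=> v0; apply/rowP=> i; rewrite mxE -row_coordE v0. Qed.

Lemma tau_to_opuE (v : 'rV[k]_2) : tau_to_opu v = evcomb bQ o_vecs (row_coord v).
Proof. by apply: eq_bigr => i _; rewrite (row_coordE v i). Qed.

Lemma tau_to_opu_eq0 v : tau_to_opu v = 0 :> quotmod S -> v = 0.
Proof.
rewrite (tau_to_opuE v) => /(down_table_inj char0 (bQ_table k) (in_socleP char0) o_downP).
by move=> /(_ (o_vec_neq0 char0)); apply: row_coord_eq0.
Qed.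

Lemma tau_to_opu_inj : injective (@tau_to_opu k).
Proof. exact: ds3_hom_inj (tau_to_opu_hom k) (@tau_to_opu_eq0). Qed.

Lemma tau_to_opu_range v : OQ (tau_to_opu v).
Proof.
rewrite tau_to_opuE; apply/evspanP; exists (glue 2 (row_coord v) (fun=> 0)).
by rewrite /opu_vecs (evcomb_glue bQ o_vecs) [X in _ + X]evcomb0 ?addr0.
Qed.

Lemma tau_to_opu_delta : tau_to_opu (delta_mx 0 0 : 'rV[k]_2) = ev bQ (nth [::] o_vecs 0).
Proof.
rewrite /tau_to_opu (bigD1 (0 : 'I_2)) //= mxE !eqxx scal1 scale1r big1 ?addr0 // => i.
by rewrite mxE eqxx => /negPf ->; rewrite scal0 scale0r.
Qed.

Lemma gen_tau_to_opu : gen_submodule (range (@tau_to_opu k)) = OQ.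
Proof.
apply/seteqP; split=> [w /(_ _ (opu_submodule char0)) | ].
  by apply=> _ [v _ <-]; apply: tau_to_opu_range.
apply: (up_table_mem char0 (bQ_table k) (in_socleP char0) opu_upP (gen_submoduleP _)).
by apply: sub_gen_submodule; rewrite -tau_to_opu_delta; exists (delta_mx 0 0).
Qed.

Lemma highest_weight_OPU (zeta : k) : 3.-primitive_root zeta ->
  highest_weight (Mtau0 k) (OPU_mod_S zeta).
Proof.
move=> zeta_prim; exists (range (@tau_to_opu k)); split.
- by exists (@tau_to_opu k); split; [exact: tau_to_opu_hom | exact: tau_to_opu_inj | ].
- by move=> t _ [v _ <-]; apply: tau_to_opu_y.
by rewrite (OPU_mod_SE char0 zeta_prim) gen_tau_to_opu.
Qed.

Variable Phi : {linear V -> quotmod S}.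
Hypothesis PhiE : forall v, Phi (vtensor v) = tau_to_opu v.

Lemma Phi_range w : OQ (Phi w).
Proof.
have [Q0 Ql] := opu_submodule char0.
apply: (verma_gen (N := [set w | OQ (Phi w)])) => [|v] /=.
  by split=> /= [|a u v Qu Qv]; rewrite ?linear0 ?linearP //; apply: Ql.
by rewrite PhiE; apply: tau_to_opu_range.
Qed.

Lemma Phi_image (N : set V) : submodule N -> (exists2 w, N w & Phi w <> 0) ->
  forall q, OQ q -> exists2 w, N w & Phi w = q.
Proof.
move=> sN [w0 Nw0 Pw0] q Qq; pose N' := [set Phi w | w in N].
have sN' : submodule N'.
  split=> [|a _ _ [u Nu <-] [v Nv <-]]; first by exists 0; rewrite ?linear0 //; case: sN.
  by exists (a *: u + v); rewrite ?linearP //; case: sN => _; apply.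
have [_ _ Omin] := opu_simple char0.
have N'Q : N' `<=` OQ by move=> _ [w _ <-]; apply: Phi_range.
have [N'0|N'E] := Omin N' sN' N'Q.
  have N'w : N' (Phi w0) by exists w0.
  by rewrite N'0 in N'w.
have N'q : N' q by rewrite N'E.
by case: N'q => w; exists w.
Qed.

Lemma Phi_surj q : OQ q -> exists w, Phi w = q.
Proof.
move=> Qq; have sT : submodule [set: V] by split.
have [|w _ Pw] := Phi_image sT _ Qq; last by exists w.
exists (vtensor (M := Mtau0 k) (delta_mx 0 0 : 'rV[k]_2)) => //.
by rewrite PhiE tau_to_opu_delta; apply: o_vec_neq0.
Qed.

(** The augmentation ideal of B(V) never reaches O_0, which keeps highest weight vectors apart from
    deep ones. *)
Lemma x_opu t q : (0 < t < 4)%N -> OQ q -> evspan bQ (p_vecs ++ u_vecs) (Dxi k t *: q).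
Proof.
move=> tr; have chk : all (fun t => maps_under in_socle opu_vecs (p_vecs ++ u_vecs)
  (drop 2 opu_funs) 2 (GX t)) [:: 1; 2; 3]%N by vm_compute.
have chk_t : maps_under in_socle opu_vecs (p_vecs ++ u_vecs) (drop 2 opu_funs) 2 (GX t).
  by have /allP := chk; apply; case: t tr => [|[|[|[|t]]]].
exact: (maps_underP char0 (bQ_table k) (in_socleP char0) (c := GX t) _ tr chk_t).
Qed.

Lemma Phi_xdeep z : xdeep 1 z -> evspan bQ (p_vecs ++ u_vecs) (Phi z).
Proof.
move=> [f ->]; rewrite linear_sum.
elim/big_ind: _ => [||m len_m]; first exact: evspan0.
  by move=> u v Su Sv; rewrite -[u]scale1r -scal1; apply: evspan_lin.
rewrite linearZ /= /xword ltn_ord.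
have: all (fun t => 0 < t < 4)%N (nth [::] xwords m).
  by have /all_nthP := erefl (all (all (fun t => 0 < t < 4)%N) xwords); apply.
case: (nth [::] xwords m) len_m => [|t s] //= _ /andP[tr sr].
rewrite big_cons -scalerA; apply: x_opu => //.
exact: submoduleZ (opu_submodule char0) (Phi_range _).
Qed.

Lemma submodule_sub_ker (N : set V) : submodule N -> N <> setT -> N `<=` [set w | Phi w = 0].
Proof.
move=> sN NT w0 Nw0; apply: contrapT => Pw0; apply: NT; apply/seteqP; split=> // w _.
apply: (verma_nakayama sN _ w) => v.
have [|n Nn Pn] := Phi_image sN _ (tau_to_opu_range v); first by exists w0.
exists n, (vtensor v - n); split=> //; last by rewrite addrC subrK.
have [v0 [z [z1 vnE]]] := xdeep1_split (vtensor v - n).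
suff v00 : v0 = 0 by rewrite vnE v00 (ds3_hom0 (vtensor_hom _)) add0r.
have Pvn : Phi (vtensor v - n) = 0 by rewrite linearB /= PhiE Pn subrr.
have /evspanP[c Pz] := Phi_xdeep z1.
(* The image 0 of v - n = v0 + z splits into a part in O_0 coming from v0 and a part in P + U coming
   from z. Independence of [opu_vecs] forces v0 = 0, so v - n is deep. *)
have : evcomb bQ opu_vecs (glue 2 (row_coord v0) c) = 0.
  by rewrite /opu_vecs (evcomb_glue bQ o_vecs) -Pz -tau_to_opuE -PhiE -linearD -vnE.
move/(opu_inj char0) => c0; apply: row_coord_eq0 => i lt_i.
by have := c0 i (leq_trans lt_i _); rewrite /glue lt_i => ->.
Qed.

Lemma radmodE : radmod V = [set w | Phi w = 0].
Proof.
have sK := linear_ker_submodule Phi.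
have KT : [set w | Phi w = 0] <> setT.
  move=> KT; have : [set w | Phi w = 0] (vtensor (M := Mtau0 k) (delta_mx 0 0 : 'rV[k]_2)) by rewrite KT.
  by rewrite /= PhiE tau_to_opu_delta; apply: o_vec_neq0.
apply/seteqP; split=> [w Rw | w Kw N [sN NT Nmax]].
  apply: Rw; split=> // N sN KN.
  have [NT|NT] := pselect (N = setT); [by right | left].
  by apply/seteqP; split=> //; apply: submodule_sub_ker.
have [<-|KT'] := Nmax _ sK (submodule_sub_ker sN NT); first exact: Kw.
by case: KT.
Qed.

End TauVerma.

(** * The two-dimensional representation of S_3 *)

Section StandardRepresentation.
Variables (k : fieldType) (zeta : k) (zeta_prim : 3.-primitive_root zeta).
Variables (rho : mx_representation k [set: 'S_3]%SET 2) (rho_irr : mx_irreducible rho).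
Local Notation A := (rho (s3_elt 4)).
Local Notation B := (rho (s3_elt 1)).

Lemma rho_mulc m n : rho (s3_elt (mulc m n)) = rho (s3_elt n) *m rho (s3_elt m).
Proof. by rewrite -s3_eltM /pcomp repr_mxM ?inE. Qed.

Lemma rho_BA : B *m A = A *m A *m B.
Proof.
rewrite -(rho_mulc 4 1) -(rho_mulc 4 4) -(rho_mulc 1 (mulc 4 4)).
by congr (rho (s3_elt _)); vm_compute.
Qed.

Lemma rho_BB : B *m B = 1%:M.
Proof. by rewrite -(rho_mulc 1 1) -[mulc 1 1]/0%N; exact: repr_mx1. Qed.

Lemma rho_AAA : A *m A *m A = 1%:M.
Proof. by rewrite -(rho_mulc 4 4) -rho_mulc -[mulc _ _]/0%N; exact: repr_mx1. Qed.

Lemma s3_generated (P : 'S_3 -> Prop) :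
  P 1%g -> (forall g h, P g -> P h -> P (g ∘ h)) -> P (s3_elt 1) -> P (s3_elt 4) ->
  forall g, P g.
Proof.
move=> P1 PM Ps Pt g; have [m ltm ->] := s3_eltP g.
have Pm m' n : P (s3_elt m') -> P (s3_elt n) -> P (s3_elt (mulc m' n)).
  by rewrite -s3_eltM; apply: PM.
have P5 := Pm 4 4 Pt Pt.
case: m ltm => [|[|[|[|[|[|m]]]]]] // _; [exact: (Pm 1 4) | exact: (Pm 4 1)].
Qed.

(** A and B are the matrices of tau and (12), which generate S_3: a common eigenvector would span an
    invariant line. *)
Lemma no_eigenline (w : 'rV[k]_2) a b : w *m A = a *: w -> w *m B = b *: w -> w = 0.
Proof.
move=> wA wB; apply/eqP/negPn/negP => w0.
have wg g : exists c, w *m rho g = c *: w.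
  elim/s3_generated: g => [|g h [c wg] [d wh]||]; last 2 first.
  - by exists b.
  - by exists a.
  - by exists 1; rewrite repr_mx1 mulmx1 scale1r.
  by exists (d * c); rewrite /pcomp repr_mxM ?inE // mulmxA wh -scalemxAl wg scalerA.
have [_ _ irr] := rho_irr.
have sub : (1%:M <= <<w>>)%MS.
  apply: irr; rewrite ?submx1 //.
    apply/mxmoduleP => g _; rewrite genmxE (eqmxMr _ (genmxE w)).
    by have [c ->] := wg g; rewrite scalemx_sub.
  by rewrite -mxrank_eq0 genmxE mxrank_eq0.
have := mxrankS sub; rewrite mxrank1 genmxE => rk2.
by have := leq_trans rk2 (rank_leq_row w).
Qed.

(** Each row w of this matrix is fixed by tau. Then w + w B is fixed by tau and (12), hence zero; so
    (12) acts on w by -1 and w vanishes too. *)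
Lemma rho_sum : A *m A + A + 1%:M = 0.
Proof.
apply/row_matrixP => i; rewrite row0; set w := row i _.
have wA : w *m A = w.
  rewrite /w -row_mul; congr (row i _).
  by rewrite !mulmxDl mul1mx rho_AAA -addrA addrC.
have wBA : w *m B *m A = w *m B by rewrite -mulmxA rho_BA !mulmxA !wA.
have wB0 : w + w *m B = 0.
  apply: (@no_eigenline _ 1 1); rewrite scale1r mulmxDl ?wA ?wBA //.
  by rewrite -mulmxA rho_BB mulmx1 addrC.
apply: (@no_eigenline _ 1 (-1)); first by rewrite scale1r.
by rewrite scaleN1r; apply/eqP; rewrite -addr_eq0 addrC wB0.
Qed.

(** By [rho_sum], (A - zeta^2)(A - zeta) = 0, so any nonzero row of A - zeta^2 will do. If A were
    the scalar zeta^2, then [rho_BA] would force B = 0. *)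
Lemma eigenrow : exists2 e : 'rV[k]_2, e != 0 & e *m A = zeta *: e.
Proof.
have zs := zeta_sum zeta_prim; have z3 := prim_expr_order zeta_prim.
have z3' : zeta * zeta ^+ 2 = 1 by rewrite -exprS.
have zz : zeta ^+ 2 + zeta = -1 by apply/eqP; rewrite -addr_eq0 zs.
have [A0|] := eqVneq (A - (zeta ^+ 2)%:M) 0; last first.
  case/matrix0Pn => i [j ij]; exists (row i (A - (zeta ^+ 2)%:M)).
    by apply/rV0Pn; exists j; rewrite mxE.
  rewrite -row_mul -linearZ /=; congr (row i _); apply/eqP; rewrite -subr_eq0.
  rewrite mulmxBl mul_scalar_mx scalerBr scale_scalar_mx z3' opprB addrACA -opprD -scalerDl.
  by rewrite zz scaleN1r opprK addrAC rho_sum.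
have Ac : A = (zeta ^+ 2)%:M by apply/eqP; rewrite -subr_eq0 A0.
have z4 : zeta ^+ 2 * zeta ^+ 2 = zeta by rewrite {1}expr2 -mulrA z3' mulr1.
have := rho_BA; rewrite Ac -scalar_mxM z4 mul_mx_scalar mul_scalar_mx.
move/eqP; rewrite -subr_eq0 -scalerBl scaler_eq0 => /orP[|/eqP B0].
  by rewrite subr_eq0 -{2}[zeta]expr1 (eq_prim_root_expr zeta_prim).
by have := rho_BB; rewrite B0 mul0mx => /eqP; rewrite eq_sym oner_eq0.
Qed.

Lemma eigenbasis : exists e0 e1 : 'rV[k]_2, [/\ e0 *m A = zeta *: e0,
  e1 *m A = zeta ^+ 2 *: e1, e0 *m B = e1, e1 *m B = e0 & row_free (col_mx e0 e1)].
Proof.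
have [e e0 eA] := eigenrow; exists e, (e *m B).
have eBB : e *m B *m B = e by rewrite -mulmxA rho_BB mulmx1.
have eBA : e *m B *m A = zeta ^+ 2 *: (e *m B).
  by rewrite -mulmxA rho_BA !mulmxA eA -scalemxAl eA -!scalemxAl scalerA.
split=> //; rewrite -kermx_eq0; apply/eqP/row_matrixP => i; rewrite row0.
have : row i (kermx (col_mx e (e *m B))) *m col_mx e (e *m B) = 0.
  by rewrite -row_mul mulmx_ker row0.
set v := row i _; rewrite -[v]hsubmxK mul_row_col.
rewrite [lsubmx v]mx11_scalar [rsubmx v]mx11_scalar !mul_scalar_mx.
set a := lsubmx v 0 0; set b := rsubmx v 0 0 => ab.
have zz : zeta ^+ 2 - zeta != 0.
  by rewrite subr_eq0 -{2}[zeta]expr1 (eq_prim_root_expr zeta_prim).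
(* The usual argument for distinct eigenvalues: apply A to the relation and subtract zeta times the
   relation. *)
have b0 : b = 0.
  have := congr1 (mulmx^~ A) ab; rewrite mul0mx mulmxDl -!scalemxAl eA eBA => abA.
  have := congr1 ( *:%R zeta) ab; rewrite scaler0 scalerDr => zab.
  have: (b * (zeta ^+ 2 - zeta)) *: (e *m B) = 0.
    rewrite mulrBr scalerBl -[RHS](subrr 0) -{1}abA -zab !scalerA.
    by rewrite [zeta * a]mulrC [zeta * b]mulrC opprD addrACA subrr add0r.
  move/eqP; rewrite scaler_eq0 mulf_eq0 (negPf zz) orbF => /orP[/eqP //|/eqP eB0].
  by move: e0; rewrite -eBB eB0 mul0mx eqxx.
have a0 : a = 0.
  by move/eqP: ab; rewrite b0 scale0r addr0 scaler_eq0 (negPf e0) orbF => /eqP.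
by rewrite a0 b0 -scalemx1 scale0r row_mx0.
Qed.

End StandardRepresentation.

(** * Decomposition of the head *)

(** For q0 and q1 the classes of [u_vecs], (12) sends q0 to -q0 and q1 to q1 - q0; hence it
    exchanges the vectors y q0 + q1 for y = zeta and y = zeta^2. The next lemma shows in the same
    way that tau multiplies such a vector by the inverse of y. *)
Lemma sum_zero_act1 (R : pzRingType) (V : lmodType R) (y z : R) (u v : V) :
  y + z + 1 = 0 -> y *: - u + (v - u) = z *: u + v.
Proof.
move=> e; have -> : z = - y - 1.
  by apply/eqP; rewrite -subr_eq0 opprD !opprK addrA [z + y]addrC e.
by rewrite scalerDl scaleNr scaleN1r scalerN addrA addrAC.
Qed.

Lemma sum_zero_act2 (R : pzRingType) (V : lmodType R) (y z : R) (u v : V) :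
  y + z + 1 = 0 -> z * y = 1 -> y *: - v + (u - v) = z *: (y *: u + v).
Proof.
by move=> e zy; rewrite (sum_zero_act1 v u e) scalerDr scalerA zy scale1r addrC.
Qed.

Lemma scale2_lin (R : pzRingType) (V : lmodType R) (c x y x' y' : R) (u v : V) :
  (c * x + x') *: u + (c * y + y') *: v = c *: (x *: u + y *: v) + (x' *: u + y' *: v).
Proof. by rewrite scalerDr !scalerA addrACA -!scalerDl. Qed.

Lemma scale2_collect (R : pzRingType) (V : lmodType R) (x y p q : R) (u v : V) :
  x *: (p *: u + v) + y *: (q *: u + v) = (x * p + y * q) *: u + (x + y) *: v.
Proof. by rewrite !scalerDr !scalerA addrACA -!scalerDl. Qed.

Lemma sum_ord2 (V : nmodType) (F : nat -> V) : \sum_(i < 2) F i = F 0%N + F 1%N.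
Proof. by rewrite !big_ord_recl big_ord0 addr0. Qed.

Section OPUParts.
Variables (k : fieldType) (char0 : [pchar k] =i pred0).
Local Notation D := (dalg k).
Local Notation W := (verma (Msigma_minus k)).
Local Notation S := (socmod W).
Local Notation Q := (quotmod S).
Local Notation bQ := (bQ k).

Definition evspan_iso (M : ds3_module k) (f : 'rV[k]_(ds3_dim M) -> Q) (vs : seq vec) : Prop :=
  [/\ ds3_hom f, forall v, f v = 0 -> v = 0, forall v, evspan bQ vs (f v) &
      forall q, evspan bQ vs q -> exists v, f v = q].

Lemma opu_parts_inj co cp cu :
  evcomb bQ o_vecs co + (evcomb bQ p_vecs cp + evcomb bQ u_vecs cu) = 0 ->
  [/\ forall i, (i < 2)%N -> co i = 0, forall i, (i < 3)%N -> cp i = 0 &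
      forall i, (i < 2)%N -> cu i = 0].
Proof.
rewrite -(evcomb_glue bQ p_vecs) -(evcomb_glue bQ o_vecs) => /(opu_inj char0) c0.
have glue_lt n (a b : nat -> k) i : (i < n)%N -> glue n a b i = a i by rewrite /glue => ->.
have glue_ge n (a b : nat -> k) i : glue n a b (n + i) = b i.
  by rewrite /glue ltnNge leq_addr addKn.
split=> i lt_i.
- by rewrite -(c0 i (leq_trans lt_i _)) // glue_lt.
- by rewrite -(c0 (2 + i)%N) ?glue_ge ?glue_lt // -[7%N]/(2 + 5)%N ltn_add2l (leq_trans lt_i).
by rewrite -(c0 (2 + (3 + i))%N) ?glue_ge // -[7%N]/(2 + (3 + 2))%N !ltn_add2l.
Qed.

Lemma table_part (M : ds3_module k) (f : 'rV[k]_(ds3_dim M) -> Q) vs :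
  ds3_hom f -> ds3_dim M = size vs ->
  (forall v, f v = evcomb bQ vs (row_coord v)) ->
  (forall c, evcomb bQ vs c = 0 -> forall i, (i < size vs)%N -> c i = 0) ->
  evspan_iso f vs.
Proof.
move=> f_hom sz fE f_inj; split=> // [v|v|q /evspanP[c ->]].
- by rewrite fE => /f_inj v0; apply: row_coord_eq0 => i lt_i; apply: v0; rewrite -sz.
- by rewrite fE; apply/evspanP; exists (row_coord v).
exists (\row_i c i); rewrite fE; apply: eq_evcomb => i; rewrite -sz => lt_i.
by rewrite -[i]/(val (Ordinal lt_i)) row_coordE mxE.
Qed.

Lemma tau_part : evspan_iso (@tau_to_opu k) o_vecs.
Proof.
apply: table_part; [exact: tau_to_opu_hom | by [] | exact: tau_to_opuE | ].
move=> c c0; have [|ci _ _] := @opu_parts_inj c (fun=> 0) (fun=> 0); last exact: ci.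
by rewrite c0 !evcomb0 ?addr0.
Qed.

Definition plus_to_opu (v : 'rV[k]_(ds3_dim (Msigma_plus k))) : Q :=
  \sum_i scal (v 0 i) *: ev bQ (nth [::] p_vecs i).

Lemma plus_to_opu_hom : ds3_hom plus_to_opu.
Proof.
have chk : class_table p_vecs [:: 1; 2; 3]%N (fun=> 1) 3 by vm_compute.
apply: (@class_hom_table k _ 3 transp_deg (fun=> 1) transp_deg_inj transp_deg_stable _ _ bQ
  (bQ_table k) p_vecs [:: 1; 2; 3]%N (fun=> 1) _ _ chk); last by [].
by move=> i; rewrite transp_degE; case: i => [[|[|[|i]]]].
Qed.

Lemma plus_to_opuE (v : 'rV[k]_3) : plus_to_opu v = evcomb bQ p_vecs (row_coord v).
Proof. by apply: eq_bigr => i _; rewrite (row_coordE v i). Qed.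

Lemma plus_part : evspan_iso plus_to_opu p_vecs.
Proof.
apply: table_part; [exact: plus_to_opu_hom | by [] | exact: plus_to_opuE | ].
move=> c c0; have [|_ ci _] := @opu_parts_inj (fun=> 0) c (fun=> 0); last exact: ci.
by rewrite c0 !evcomb0 ?addr0.
Qed.

Section Rho.
Variables (zeta : k) (zeta_prim : 3.-primitive_root zeta).
Variables (rho : mx_representation k [set: 'S_3]%SET 2) (rho_irr : mx_irreducible rho).
Local Notation A := (rho (s3_elt 4)).
Local Notation B := (rho (s3_elt 1)).

Lemma rho_part : exists f : 'rV[k]_(ds3_dim (Me rho)) -> Q, evspan_iso f u_vecs.
Proof.
have [e0 [e1 [e0A e1A e0B e1B free]]] := eigenbasis zeta_prim rho_irr.
have zs := zeta_sum zeta_prim; have z3 := prim_expr_order zeta_prim.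
pose E : 'M[k]_2 := col_mx e0 e1; have Eu : E \in unitmx by rewrite -row_free_unit.
pose w (v : 'rV[k]_2) : 'rV[k]_(1 + 1) := v *m invmx E.
pose al v := lsubmx (w v) 0 0; pose be v := rsubmx (w v) 0 0.
have vE v : v = al v *: e0 + be v *: e1.
  rewrite -!mul_scalar_mx -!mx11_scalar -mul_row_col hsubmxK -/E /w.
  by rewrite mulmxKV.
have coordE x y : (al (x *: e0 + y *: e1) = x) * (be (x *: e0 + y *: e1) = y).
  rewrite /al /be /w -!mul_scalar_mx -mul_row_col -/E.
  by rewrite mulmxK // row_mxKl row_mxKr !mxE.
pose q0 := ev bQ (nth [::] u_vecs 0); pose q1 := ev bQ (nth [::] u_vecs 1).
(* U0 and U1 are the classes of u and (12) u; tau acts on them by zeta and zeta^2, just as it does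
   on e0 and e1. *)
pose U0 := scal (zeta ^+ 2) *: q0 + q1; pose U1 := scal zeta *: q0 + q1.
have szs : scal (zeta ^+ 2) + scal zeta + 1 = 0 :> D by rewrite -scal1 -!scalD zs scal0.
have szs' : scal zeta + scal (zeta ^+ 2) + 1 = 0 :> D by rewrite [scal zeta + _]addrC.
have z12 : scal zeta * scal (zeta ^+ 2) = 1 :> D by rewrite -scalM -exprS z3 scal1.
have z21 : scal (zeta ^+ 2) * scal zeta = 1 :> D by rewrite -scalM -exprSr z3 scal1.
have evq vs m i v : eqv 36 (lin 36 (opG m) (nth [::] vs i)) v -> (m < 6)%N ->
    Dg k (s3_elt m) *: ev bQ (nth [::] vs i) = ev bQ v.
  by move=> e ltm; apply: (table_act1 (c := GG m) (bQ_table k)).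
have sq0 : Dg k (s3_elt 1) *: q0 = - q0.
  have e : eqv 36 (lin 36 (opG 1) (nth [::] u_vecs 0)) (subv [::] (nth [::] u_vecs 0)) by vm_compute.
  by rewrite /q0 (evq _ _ _ _ e isT) ev_subv ev_nil sub0r.
have sq1 : Dg k (s3_elt 1) *: q1 = q1 - q0.
  have e : eqv 36 (lin 36 (opG 1) (nth [::] u_vecs 1))
    (subv (nth [::] u_vecs 1) (nth [::] u_vecs 0)) by vm_compute.
  by rewrite /q1 (evq _ _ _ _ e isT) ev_subv.
have tq0 : Dg k (s3_elt 4) *: q0 = - q1.
  have e : eqv 36 (lin 36 (opG 4) (nth [::] u_vecs 0)) (subv [::] (nth [::] u_vecs 1)) by vm_compute.
  by rewrite /q0 (evq _ _ _ _ e isT) ev_subv ev_nil sub0r.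
have tq1 : Dg k (s3_elt 4) *: q1 = q0 - q1.
  have e : eqv 36 (lin 36 (opG 4) (nth [::] u_vecs 1))
    (subv (nth [::] u_vecs 0) (nth [::] u_vecs 1)) by vm_compute.
  by rewrite /q1 (evq _ _ _ _ e isT) ev_subv.
have gU c m : Dg k (s3_elt m) *: (scal c *: q0 + q1) =
    scal c *: (Dg k (s3_elt m) *: q0) + Dg k (s3_elt m) *: q1 by apply: scal_lin.
have sU0 : Dg k (s3_elt 1) *: U0 = U1.
  by rewrite /U0 gU sq0 sq1; exact: (sum_zero_act1 q0 q1 szs).
have sU1 : Dg k (s3_elt 1) *: U1 = U0.
  by rewrite /U1 gU sq0 sq1; exact: (sum_zero_act1 q0 q1 szs').
have tU0 : Dg k (s3_elt 4) *: U0 = scal zeta *: U0.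
  by rewrite /U0 gU tq0 tq1; exact: (sum_zero_act2 q0 q1 szs z12).
have tU1 : Dg k (s3_elt 4) *: U1 = scal (zeta ^+ 2) *: U1.
  by rewrite /U1 gU tq0 tq1; exact: (sum_zero_act2 q0 q1 szs' z21).
have U0E : U0 = scal (zeta ^+ 2) *: q0 + q1 := erefl.
have U1E : U1 = scal zeta *: q0 + q1 := erefl.
have q0E : q0 = ev bQ (nth [::] u_vecs 0) := erefl.
have q1E : q1 = ev bQ (nth [::] u_vecs 1) := erefl.
clearbody U0 U1 q0 q1; clear evq sq0 sq1 tq0 tq1 gU.
have [f fdef] : exists f : 'rV[k]_2 -> Q, forall v, f v = scal (al v) *: U0 + scal (be v) *: U1.
  exact: (ex_intro _ (fun v => scal (al v) *: U0 + scal (be v) *: U1) (fun=> erefl)).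
have fE x y : f (x *: e0 + y *: e1) = scal x *: U0 + scal y *: U1 by rewrite fdef !coordE.
have f_lin c u v : f (c *: u + v) = scal c *: f u + f v.
  have -> : c *: u + v = (c * al u + al v) *: e0 + (c * be u + be v) *: e1.
    by rewrite {1}(vE u) {1}(vE v) scalerDr !scalerA addrACA -!scalerDl.
  rewrite fE !fdef (scalD (c * al u)) (scalD (c * be u)) !scalM; exact: scale2_lin.
have f_g g v : f (v *m rho g) = Dg k g *: f v.
  elim/s3_generated: g v => [v|g h IHg IHh v|v|v].
  - by rewrite repr_mx1 mulmx1 Dg1 scale1r.
  - have e : rho (g ∘ h) = rho h *m rho g by rewrite /pcomp repr_mxM ?inE.
    by rewrite e mulmxA IHg IHh -(Dg_Dg k g h); exact: scalerA.
  - rewrite {1}(vE v) mulmxDl -!scalemxAl e0B e1B addrC fE addrC.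
    by rewrite fdef (scal_lin (al v) (Dg k (s3_elt 1))) (scal_swap (be v) (Dg k (s3_elt 1))) sU0 sU1.
  rewrite {1}(vE v) mulmxDl -!scalemxAl e0A e1A !scalerA fE.
  rewrite fdef (scal_lin (al v) (Dg k (s3_elt 4))) (scal_swap (be v) (Dg k (s3_elt 4))) tU0 tU1.
  rewrite (scalM (al v) zeta) (scalM (be v) (zeta ^+ 2)).
  by apply: (congr2 +%R); exact: esym (scalerA _ _ _).
have fu v : f v = evcomb bQ u_vecs
    (fun i => if i == 0%N then al v * zeta ^+ 2 + be v * zeta else al v + be v).
  apply: etrans (esym (sum_ord2 (fun i => scal (if i == 0%N then al v * zeta ^+ 2 + be v * zeta
    else al v + be v) *: ev bQ (nth [::] u_vecs i)))).
  rewrite /= -q0E -q1E fdef U0E U1E (scalD (al v * _)) (scalD (al v)) !scalM.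
  exact: scale2_collect.
have zz : zeta ^+ 2 - zeta != 0.
  by rewrite subr_eq0 -{2}[zeta]expr1 (eq_prim_root_expr zeta_prim).
exists f; split.
- split=> [//|g v|h v]; first exact: f_g.
  have dv : ds3_delta (M := Me rho) h v = if h == 1%g then v else 0.
    apply/rowP => i; rewrite ds3_deltaE /= eq_sym.
    by case: (h == 1%g); rewrite ?mxE.
  have f0 : f 0 = 0 by have := f_lin (-1) 0 0; rewrite scaler0 addr0 scalN scal1 scaleN1r addNr.
  have [m ltm hE] := s3_eltP h.
  have dq i : (i < 2)%N -> Ddelta k h *: ev bQ (nth [::] u_vecs i) =
      if h == 1%g then ev bQ (nth [::] u_vecs i) else 0.
    have chk : all6 (fun m => all (fun i => eqv 36 (lin 36 (opD m) (nth [::] u_vecs i))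
      (if m == 0%N then nth [::] u_vecs i else [::])) (iota 0 2)) by vm_compute.
    move=> lt_i; have chk_i := all_iotaP (all6P chk ltm) lt_i.
    have h1 : (h == 1%g) = (m == 0%N) by rewrite hE; exact: (s3_elt_eq ltm (isT : (0 < 6)%N)).
    rewrite h1 hE; apply: etrans (table_act1 (c := GD m) (bQ_table k) ltm chk_i) _.
    by case: (m == 0%N); [exact: erefl | exact: ev_nil].
  have dU c : Ddelta k h *: (scal c *: q0 + q1) = if h == 1%g then scal c *: q0 + q1 else 0.
    rewrite (scal_lin c (Ddelta k h)) q0E q1E (dq 0%N isT) (dq 1%N isT).
    by case: (h == 1%g); [exact: erefl | rewrite scaler0 addr0].
  have dU0 : Ddelta k h *: U0 = if h == 1%g then U0 else 0 by rewrite U0E dU.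
  have dU1 : Ddelta k h *: U1 = if h == 1%g then U1 else 0 by rewrite U1E dU.
  rewrite dv (fdef v) (scal_lin (al v) (Ddelta k h)) (scal_swap (be v) (Ddelta k h)) dU0 dU1.
  by case: (h == 1%g); [exact: fdef | rewrite f0 !scaler0 addr0].
- move=> v; rewrite fu => v0.
  have [|_ _ c0] := @opu_parts_inj (fun=> 0) (fun=> 0) (fun i => if i == 0%N
    then al v * zeta ^+ 2 + be v * zeta else al v + be v).
    by rewrite v0 !evcomb0 ?addr0.
  have /= c00 := c0 0%N isT; have /= c01 := c0 1%N isT.
  have bE : be v = - al v by apply/eqP; rewrite -addr_eq0 addrC c01.
  have a0 : al v = 0.
    move: c00; rewrite bE mulNr -mulrBr => /eqP.
    by rewrite mulf_eq0 (negPf zz) orbF => /eqP.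
  by rewrite (vE v) bE a0 oppr0 !scale0r addr0.
- move=> v; rewrite fu; apply/evspanP; eexists; exact: erefl.
move=> q /evspanP[c ->].
(* The coefficients of U0 and U1 must add up to c_1, so they are x and c_1 - x; comparing
   coefficients of q0 gives this equation for x. *)
have [x xz] : exists x, x * (zeta ^+ 2 - zeta) = c 0%N - c 1%N * zeta.
  by exists ((c 0%N - c 1%N * zeta) / (zeta ^+ 2 - zeta)); rewrite divfK.
have xE : x * zeta ^+ 2 + (c 1%N - x) * zeta = c 0%N.
  by rewrite mulrBl addrCA -mulrBr xz addrC subrK.
exists (x *: e0 + (c 1%N - x) *: e1); apply: etrans (fu _) _; apply: eq_evcomb => i lt_i.
have [-> ->] := coordE x (c 1%N - x).
case: i lt_i => [|[|i]] lt_i; [exact: xE | | by case: (ltnP i.+2 2) lt_i].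
by rewrite /= addrC subrK.
Qed.

End Rho.
End OPUParts.

Section DirectSumHom.
Variables (k : fieldType) (W : lmodType (dalg k)) (M N : ds3_module k).
Local Notation m := (ds3_dim M).
Local Notation n := (ds3_dim N).

Lemma dsum_hom (f : 'rV[k]_m -> W) (g : 'rV[k]_n -> W) : ds3_hom f -> ds3_hom g ->
  ds3_hom (M := dsum M N) (fun v : 'rV[k]_(m + n) => f (lsubmx v) + g (rsubmx v)).
Proof.
move=> [f_lin f_g f_d] [g_lin g_g g_d]; split=> [c u v|h v|h v].
- have [-> ->] : lsubmx (c *: u + v : 'rV[k]_(m + n)) = c *: lsubmx u + lsubmx v /\
      rsubmx (c *: u + v : 'rV[k]_(m + n)) = c *: rsubmx u + rsubmx v.
    by split; rewrite linearP.
  by rewrite f_lin g_lin scalerDr addrACA.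
- have e : ds3_g (M := dsum M N) h v =
      row_mx (ds3_g (M := M) h (lsubmx v)) (ds3_g (M := N) h (rsubmx v)).
    rewrite /ds3_g -{1}[v]hsubmxK; apply: etrans (mul_row_block _ _ _ _ _ _) _.
    by rewrite !mulmx0 addr0 add0r.
  by rewrite e row_mxKl row_mxKr f_g g_g scalerDr.
have e : ds3_delta (M := dsum M N) h v =
    row_mx (ds3_delta (M := M) h (lsubmx v)) (ds3_delta (M := N) h (rsubmx v)).
  apply/rowP => i; rewrite ds3_deltaE /= /dsum_deg mxE.
  by case: splitP => j ij; rewrite ds3_deltaE mxE; congr (if _ then v 0 _ else _); apply: val_inj.
by rewrite e row_mxKl row_mxKr f_d g_d scalerDr.
Qed.
End DirectSumHom.

Section HeadIso.
Variables (k : fieldType) (V X : lmodType (dalg k)) (M : ds3_module k).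
Variables (Phi : {linear V -> X}) (f : 'rV[k]_(ds3_dim M) -> X).
Hypotheses (f_hom : ds3_hom f) (f_inj : injective f).
Hypothesis f_range : forall q, (exists w, Phi w = q) <-> (exists v, f v = q).
Hypothesis rad_ker : radmod V = [set w | Phi w = 0].

(** The head is V modulo the kernel of Phi, that is the image of Phi, and f identifies M with the
    same image. The isomorphism sends a vector of M to the class of a chosen Phi-preimage, which
    does not depend on the choice. *)
Lemma head_iso : ds3_iso (headmod V) M.
Proof.
have eq_pi u v : pimod (radmod V) u = pimod (radmod V) v <-> Phi u = Phi v.
  have E : gen_submodule (radmod V) (u - v) <-> Phi u = Phi v.
    rewrite gen_submodule_id; last exact: radmodP.
    rewrite rad_ker /= linearB; split=> [/eqP|->]; last exact: subrr.
    by rewrite subr_eq0 => /eqP.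
  by split=> [/pimod_eq/E | /E/pimod_eq].
have /choice[s sE] : forall v, exists w, Phi w = f v.
  by move=> v; apply/f_range; exists v.
have [f_lin f_g f_d] := f_hom.
exists (fun v => pimod (radmod V) (s v)).
  split=> [c u v|g v|h v]; rewrite -?pimodZ -?pimodD; apply/eq_pi.
  - by rewrite linearP !sE f_lin.
  - by rewrite linearZ /= !sE f_g.
  - by rewrite linearZ /= !sE f_d.
have /choice[t tE] : forall q, exists v, pimod (radmod V) (s v) = q.
  move=> q; have [w ->] := pimod_surj q.
  have [v fv] : exists v, f v = Phi w by apply/f_range; exists w.
  by exists v; apply/eq_pi; rewrite sE.
exists t => // v; apply: f_inj; rewrite -!sE; apply/eq_pi.
exact: tE.
Qed.
End HeadIso.

Theorem corollary24 (k : closedFieldType) (char0 : [pchar k]%R =i pred0)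
    (zeta : k) (zeta_prim : (3.-primitive_root zeta)%R)
    (rho : mx_representation k [set: 'S_3]%SET 2) (rho_irr : mx_irreducible rho) :
  [/\ submodule (OPU zeta), OPU_direct zeta,
      simple_submodule (OPU_mod_S zeta),
      highest_weight (Mtau0 k) (OPU_mod_S zeta) &
      ds3_iso (Lmod (Mtau0 k)) (dsum (dsum (Mtau0 k) (Msigma_plus k)) (Me rho))].
Proof.
split.
- exact: submodule_OPU.
- exact: OPU_directP.
- exact: simple_OPU_mod_S.
- exact: highest_weight_OPU.
have [Phi PhiE] := verma_lift (tau_to_opu_hom k) (@tau_to_opu_y k).
have [f_hom f0 f_in f_onto] := tau_part char0.
have [g_hom g0 g_in g_onto] := plus_part char0.
have [r [r_hom r0 r_in r_onto]] := rho_part char0 zeta_prim rho_irr.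
(* O_0, P and U carry the three summands; the combined map is a bijection onto OPU / S, which is
   also the image of Phi. *)
have hom := dsum_hom (dsum_hom f_hom g_hom) r_hom.
apply: (head_iso hom _ _ (radmodE char0 PhiE)) => [|q].
  apply: (ds3_hom_inj hom) => v v0.
  have /evspanP[co fE] := f_in (lsubmx (lsubmx v)).
  have /evspanP[cp gE] := g_in (rsubmx (lsubmx v)).
  have /evspanP[cu rE] := r_in (rsubmx v).
  have [|co0 cp0 cu0] := opu_parts_inj char0 (co := co) (cp := cp) (cu := cu).
    by rewrite -fE -gE -rE addrA.
  have v1 : lsubmx (lsubmx v) = 0 by apply: f0; rewrite fE evcomb0.
  have v2 : rsubmx (lsubmx v) = 0 by apply: g0; rewrite gE evcomb0.
  have v3 : rsubmx v = 0 by apply: r0; rewrite rE evcomb0.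
  by rewrite -[v]hsubmxK -[lsubmx v]hsubmxK v1 v2 v3 !row_mx0.
split=> [[w <-] | [v <-]].
  have /evspanP[c ->] := Phi_range char0 PhiE w.
  rewrite /opu_vecs (evcomb_cat _ o_vecs) (evcomb_cat _ p_vecs).
  have [v1 f1] := f_onto _ (ex_intro _ c erefl).
  have [v2 g2] := g_onto _ (ex_intro _ (fun i => c (2 + i)%N) erefl).
  have [v3 r3] := r_onto _ (ex_intro _ (fun i => c (2 + (3 + i))%N) erefl).
  exists (row_mx (row_mx v1 v2) v3); rewrite !row_mxKl !row_mxKr f1 g2 r3.
  exact: esym (addrA _ _ _).
apply: (Phi_surj char0 PhiE); apply/evspanP.
have /evspanP[co fE] := f_in (lsubmx (lsubmx v)).
have /evspanP[cp gE] := g_in (rsubmx (lsubmx v)).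
have /evspanP[cu rE] := r_in (rsubmx v).
exists (glue 2 co (glue 3 cp cu)); rewrite /opu_vecs (evcomb_glue _ o_vecs) (evcomb_glue _ p_vecs).
by rewrite fE gE rE; exact: esym (addrA _ _ _).
Qed.
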